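(* Let $d\ge1$, $\Omega=\mathbb{R}^d$ or $\mathbb{T}^d$, and $K\in L^\infty(\Omega;\mathbb{R}^d)$. Assume that $f\in L^\infty\cap L^1(\Omega\times\mathbb{R}^d)$ with $f\ge0$ and $\int f=1$, that $\nabla_vf\in W^{1,p}_{loc}$ for every $1\le p\le\infty$ with $\sup_{p<\infty}\frac{M_p}{p}<\infty$, and that $\|K\|_{L^\infty}\big(\sup_p\frac{M_p}{p}\big)<\frac1{8e^2}$. Then for every $N\ge1$ $$\int_{(\Omega\times\mathbb{R}^d)^N}\bar f_N\exp(|R_N|)\,dZ\le5+6\left(\frac{8e^2\|K\|_{L^\infty}\big(\sup_p\frac{M_p}{p}\big)}{1-\big(8e^2\|K\|_{L^\infty}\big(\sup_p\frac{M_p}{p}\big)\big)^2}\right)^2<\infty .$$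
   Context: For $1\le p<\infty$, $M_p=\Big(\int_{\Omega\times\mathbb{R}^d}|\nabla_v\log f|^p f\,dx\,dv\Big)^{1/p}$. Write $z_i=(x_i,v_i)$, $Z=(z_1,\dots,z_N)$, $\bar f_N(Z)=\prod_{i=1}^Nf(x_i,v_i)$, $\rho(x)=\int_{\mathbb{R}^d}f(x,v)\,dv$, and $$R_N=\frac1N\sum_{i,j=1}^N\nabla_{v_i}\log f(x_i,v_i)\cdot\{K(x_i-x_j)-K\star\rho(x_i)\},$$ with the convention $K(0)=0$. *)

(* Defs.v *)
From HB Require Import structures.
From mathcomp Require Import all_boot all_order all_algebra.
From mathcomp Require Import all_classical all_reals all_analysis.

Set Implicit Arguments.
Unset Strict Implicit.
Unset Printing Implicit Defensive.

Import Order.TTheory GRing.Theory Num.Theory.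
Import numFieldNormedType.Exports.

Local Open Scope classical_set_scope.
Local Open Scope ring_scope.

Lemma sigma_finite_pushforward d1 d2 (T1 : measurableType d1)
    (T2 : measurableType d2) (R : realType)
    (mu : set T1 -> \bar R) (h : T1 -> T2) (g : T2 -> T1) :
  sigma_finite setT mu -> cancel h g -> cancel g h -> measurable_fun setT g ->
  sigma_finite setT (pushforward mu h).
Proof.
move=> [F TF mF] hK gK mg.
exists (fun i => g @^-1` F i) => [|i].
  by rewrite -preimage_bigcup -TF.
split; first by rewrite -[X in measurable X]setTI; apply: mg => //; exact: (mF i).1.
have -> : pushforward mu h (g @^-1` F i) = mu (F i).
  by rewrite /pushforward -comp_preimage (_ : g \o h = id)//; apply/funext.
exact: (mF i).2.
Qed.

(* The library infers a sigma-finite structure on m1 \x m2 only when m1 and m2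
   are subprobabilities. *)
Section prod_measure.
Context d1 d2 (T1 : measurableType d1) (T2 : measurableType d2) (R : realType).
Variables (m1 : {sigma_finite_measure set T1 -> \bar R})
  (m2 : {sigma_finite_measure set T2 -> \bar R}).

Definition prod_measure : set (T1 * T2) -> \bar R := (m1 \x m2)%E.

HB.instance Definition _ := Measure.on prod_measure.

Let prod_measure_sigma_finite : sigma_finite setT prod_measure.
Proof.
have /sigma_finiteP[F [TF ndF Foo]] := sigma_finiteT m1.
have /sigma_finiteP[G [TG ndG Goo]] := sigma_finiteT m2.
exists (fun n => F n `*` G n).
  rewrite -setXTT TF TG predeqE => -[x y]; split.
    move=> [/= [n _ Fnx] [k _ Gky]]; exists (maxn n k) => //; split.
    - by move: x Fnx; exact/subsetPset/ndF/leq_maxl.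
    - by move: y Gky; exact/subsetPset/ndG/leq_maxr.
  by move=> [n _ []/= ? ?]; split; exists n.
move=> k; have [? ?] := Foo k; have [? ?] := Goo k.
split; first exact: measurableX.
by rewrite /prod_measure product_measure1E// lte_mul_pinfty// ge0_fin_numE.
Qed.

HB.instance Definition _ := Measure_isSigmaFinite.Build _ _ _ prod_measure
  prod_measure_sigma_finite.

End prod_measure.

(* Product measure mu^{\otimes n} on n-tuples. *)
Section tuple_power.
Context d (T : measurableType d) (R : realType).

Definition tcons n (p : T * n.-tuple T) : n.+1.-tuple T := [tuple of p.1 :: p.2].

Definition tuncons n (t : n.+1.-tuple T) : T * n.-tuple T :=
  (thead t, [tuple of behead t]).

Lemma tconsK n : cancel (@tcons n) (@tuncons n).
Proof. by case=> x t; congr pair; apply/val_inj. Qed.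

Lemma tunconsK n : cancel (@tuncons n) (@tcons n).
Proof. by move=> t; rewrite [RHS]tuple_eta; apply/val_inj. Qed.

Lemma measurable_tcons n : measurable_fun setT (@tcons n).
Proof. exact: measurable_cons. Qed.

Lemma measurable_tuncons n : measurable_fun setT (@tuncons n).
Proof.
apply/measurable_fun_pair; first exact: measurable_tnth.
exact: measurable_behead.
Qed.

Section cons_measure.
Variables (n : nat) (mu : {sigma_finite_measure set T -> \bar R})
  (nu : {sigma_finite_measure set (n.-tuple T) -> \bar R}).

Definition cons_measure : set (n.+1.-tuple T) -> \bar R :=
  pushforward (prod_measure mu nu) (@tcons n).

Let cons_measure0 : cons_measure set0 = 0%E.
Proof. by rewrite /cons_measure /pushforward preimage_set0 measure0. Qed.

Let cons_measure_ge0 A : (0 <= cons_measure A)%E.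
Proof.
exact: (@measure_ge0 _ _ _
  (measure_function_pushforward__canonical__measure_function_Measure
     (prod_measure mu nu) (@measurable_tcons n))).
Qed.

Let cons_measure_sigma_additive : semi_sigma_additive cons_measure.
Proof.
exact: (@measure_semi_sigma_additive _ _ _
  (measure_function_pushforward__canonical__measure_function_Measure
     (prod_measure mu nu) (@measurable_tcons n))).
Qed.

HB.instance Definition _ := isMeasure.Build _ _ _ cons_measure
  cons_measure0 cons_measure_ge0 cons_measure_sigma_additive.

Let cons_measure_sigma_finite : sigma_finite setT cons_measure.
Proof.
apply: (sigma_finite_pushforward _ (@tconsK n) (@tunconsK n)
  (@measurable_tuncons n)).
exact: sigma_finiteT.
Qed.

HB.instance Definition _ := Measure_isSigmaFinite.Build _ _ _ cons_measure
  cons_measure_sigma_finite.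

End cons_measure.

Fixpoint tuple_power (mu : {sigma_finite_measure set T -> \bar R}) (n : nat) :
    {sigma_finite_measure set (n.-tuple T) -> \bar R} :=
  if n is n'.+1 then cons_measure mu (tuple_power mu n')
  else \d_([tuple] : 0.-tuple T).

Lemma tuple_power_box (mu : {sigma_finite_measure set T -> \bar R}) n
    (A : 'I_n -> set T) : (forall i, measurable (A i)) ->
  tuple_power mu n [set t | forall i, A i (tnth t i)] = (\prod_(i < n) mu (A i))%E.
Proof.
elim: n A => [|n IHn] A mA /=.
  by rewrite diracE big_ord0 mem_set// => -[].
rewrite big_ord_recl /cons_measure /pushforward.
rewrite (_ : _ @^-1` _ =
    A ord0 `*` [set t | forall i, A (lift ord0 i) (tnth t i)]); last first.
  apply/seteqP; split=> -[x t] /= H.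
    split=> [|i]; first by have := H ord0; rewrite tnth0.
    by have := H (lift ord0 i); rewrite tnthS.
  by case: H => H0 HS i; case: (unliftP ord0 i) => [j ->|->];
    rewrite ?tnth0 ?tnthS.
have mB : measurable [set t : n.-tuple T | forall i, A (lift ord0 i) (tnth t i)].
  rewrite (_ : mkset _ =
      \big[setI/setT]_(i < n) ((tnth (T:=T))^~ i @^-1` A (lift ord0 i))).
    apply: bigsetI_measurable => i _.
    by rewrite -[X in measurable X]setTI; exact: measurable_tnth.
  rewrite -bigcap_seq; apply/seteqP; split=> t /= H i //=.
  by apply: H => /=; rewrite mem_index_enum.
by rewrite /prod_measure product_measure1E// (IHn (fun i => A (lift ord0 i))).
Qed.

End tuple_power.

(* 'rV[T]_n with the product sigma-algebra, i.e. generated by the coordinates. *)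
Definition measure_rV_display : measure_display -> measure_display.
Proof. exact. Qed.

Section measurable_rV.
Context d (T : measurableType d) (n : nat).

Definition rV_coord (i : 'I_n) (x : 'rV[T]_n) : T := x ord0 i.

HB.instance Definition _ := @isMeasurable.Build (measure_rV_display d)
  'rV[T]_n (g_sigma_preimage rV_coord) (@sigma_algebra0 _ _ _)
  (@sigma_algebraC _ _) (@sigma_algebra_bigcup _ _ _).

Lemma measurable_rV_coord i : measurable_fun setT (rV_coord i).
Proof.
move=> _ Y mY; rewrite setTI; apply: sub_sigma_algebra => /=.
rewrite -bigcup_seq/=; exists i => /=; first by rewrite mem_index_enum.
by exists Y => //; rewrite setTI.
Qed.

Lemma measurable_fun_rVP d' (U : measurableType d') (f : U -> 'rV[T]_n) :
  measurable_fun setT f <-> forall i, measurable_fun setT (rV_coord i \o f).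
Proof.
split=> [mf i|mf _ B mB].
  exact: (measurableT_comp (measurable_rV_coord i)).
rewrite setTI.
have : g_sigma_preimage (fun i => rV_coord i \o f) (f @^-1` B).
  by rewrite g_sigma_preimage_comp; exists B => //; rewrite setTI.
apply: smallest_sub; first exact: sigma_algebra_measurable.
rewrite -bigcup_seq; apply: bigcup_sub => i _ A [C mC <-].
exact: mf.
Qed.

Definition row_of_tuple (t : n.-tuple T) : 'rV[T]_n := \row_i tnth t i.
Definition tuple_of_row (x : 'rV[T]_n) : n.-tuple T := [tuple x ord0 i | i < n].

Lemma row_of_tupleK : cancel row_of_tuple tuple_of_row.
Proof. by move=> t; apply: eq_from_tnth => i; rewrite tnth_mktuple mxE. Qed.

Lemma tuple_of_rowK : cancel tuple_of_row row_of_tuple.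
Proof. by move=> x; apply/rowP => i; rewrite mxE tnth_mktuple. Qed.

Lemma measurable_row_of_tuple : measurable_fun setT row_of_tuple.
Proof.
apply/measurable_fun_rVP => i.
rewrite (_ : _ \o _ = (tnth (T:=T))^~ i); first exact: measurable_tnth.
by apply/funext => t; rewrite /rV_coord /= mxE.
Qed.

Lemma measurable_tuple_of_row : measurable_fun setT tuple_of_row.
Proof.
apply/measurable_fun_tnthP => i.
rewrite (_ : _ \o _ = rV_coord i); first exact: measurable_rV_coord.
by apply/funext => x; rewrite /= tnth_mktuple.
Qed.

End measurable_rV.

(* lebesgue_measure lives on measurableTypeR R, whose sigma-algebra is the one
   of R but whose display differs. *)
Section lebesgue_R.
Context (R : realType).

Definition lebesgue_R : set R -> \bar R := @lebesgue_measure R.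

Let lebesgue_R0 : lebesgue_R set0 = 0%E.
Proof. exact: (@measure0 _ _ _ (@lebesgue_measure R)). Qed.

Let lebesgue_R_ge0 A : (0 <= lebesgue_R A)%E.
Proof. exact: (@measure_ge0 _ _ _ (@lebesgue_measure R)). Qed.

Let lebesgue_R_sigma_additive : semi_sigma_additive lebesgue_R.
Proof. exact: (@measure_semi_sigma_additive _ _ _ (@lebesgue_measure R)). Qed.

HB.instance Definition _ := isMeasure.Build _ _ _ lebesgue_R
  lebesgue_R0 lebesgue_R_ge0 lebesgue_R_sigma_additive.

Let lebesgue_R_sigma_finite : sigma_finite setT lebesgue_R.
Proof. exact: (@sigma_finiteT _ _ _ (@lebesgue_measure R)). Qed.

HB.instance Definition _ := Measure_isSigmaFinite.Build _ _ _ lebesgue_R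
  lebesgue_R_sigma_finite.

End lebesgue_R.

Section lebesgue_rV.
Context (R : realType) (d : nat).

Definition lebesgue_rV : set 'rV[R]_d -> \bar R :=
  pushforward (tuple_power (@lebesgue_R R) d) (@row_of_tuple _ R d).

Let lebesgue_rV0 : lebesgue_rV set0 = 0%E.
Proof. by rewrite /lebesgue_rV /pushforward preimage_set0 measure0. Qed.

Let lebesgue_rV_ge0 A : (0 <= lebesgue_rV A)%E.
Proof.
exact: (@measure_ge0 _ _ _
  (measure_function_pushforward__canonical__measure_function_Measure
     (tuple_power (@lebesgue_R R) d) (@measurable_row_of_tuple _ R d))).
Qed.

Let lebesgue_rV_sigma_additive : semi_sigma_additive lebesgue_rV.
Proof.
exact: (@measure_semi_sigma_additive _ _ _
  (measure_function_pushforward__canonical__measure_function_Measure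
     (tuple_power (@lebesgue_R R) d) (@measurable_row_of_tuple _ R d))).
Qed.

HB.instance Definition _ := isMeasure.Build _ _ _ lebesgue_rV
  lebesgue_rV0 lebesgue_rV_ge0 lebesgue_rV_sigma_additive.

Let lebesgue_rV_sigma_finite : sigma_finite setT lebesgue_rV.
Proof.
apply: (sigma_finite_pushforward _ (@row_of_tupleK _ R d)
  (@tuple_of_rowK _ R d) (@measurable_tuple_of_row _ R d)).
exact: sigma_finiteT.
Qed.

HB.instance Definition _ := Measure_isSigmaFinite.Build _ _ _ lebesgue_rV
  lebesgue_rV_sigma_finite.

Lemma lebesgue_rV_box (A : 'I_d -> set R) : (forall i, measurable (A i)) ->
  lebesgue_rV [set x | forall i, A i (x ord0 i)] =
  (\prod_(i < d) lebesgue_measure (A i))%E.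
Proof.
move=> mA; rewrite -(tuple_power_box (@lebesgue_R R) mA).
apply: (congr1 (tuple_power (@lebesgue_R R) d)).
by apply/seteqP; split=> t /= H i; have := H i; rewrite mxE.
Qed.

End lebesgue_rV.

(* A function on T^d = R^d / Z^d is a Z^d-periodic function on R^d, integrated
   over the unit cell [0, 1)^d; its weak derivatives are those of the periodic
   function on R^d. *)
Variant domain := whole_space | flat_torus.

Section space_domain.
Context (R : realType) (d : nat).

Definition cell (Omega : domain) : set 'rV[R]_d :=
  if Omega is flat_torus then [set x | forall i, x ord0 i \in `[0, 1[] else setT.

Definition on_domain (Omega : domain) (T : Type) (u : 'rV[R]_d -> T) : Prop :=
  if Omega is flat_torus then
    forall (i : 'I_d) x, u (x + delta_mx ord0 i) = u x
  else True.

Lemma measurable_cell Omega : measurable (cell Omega).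
Proof.
rewrite /cell; case: Omega; first exact: measurableT.
rewrite [X in measurable X](_ : _ =
    \big[setI/setT]_(i < d) (@rV_coord _ R d i @^-1` [set` `[0%R, 1%R[])).
  apply: bigsetI_measurable => i _.
  by rewrite -[X in measurable X]setTI; exact: measurable_rV_coord.
rewrite -bigcap_seq; apply/seteqP; split=> t H i.
  by move=> _; exact: H.
exact: (H i (mem_index_enum i)).
Qed.

Definition vol (Omega : domain) : set 'rV[R]_d -> \bar R :=
  mrestr (@lebesgue_rV R d) (measurable_cell Omega).

HB.instance Definition _ Omega := Measure.on (vol Omega).

Let vol_sigma_finite Omega : sigma_finite setT (vol Omega).
Proof.
have [F TF mF] := sigma_finiteT (@lebesgue_rV R d).
exists F => // i; split; first exact: (mF i).1.
apply: le_lt_trans (mF i).2; rewrite /vol /mrestr le_measure ?inE//.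
- by apply: measurableI; [exact: (mF i).1|exact: measurable_cell].
- exact: (mF i).1.
Qed.

HB.instance Definition _ Omega :=
  Measure_isSigmaFinite.Build _ _ _ (vol Omega) (vol_sigma_finite Omega).

End space_domain.

Notation phase R d := ('rV[R]_d * 'rV[R]_d)%type.

Definition phase_vol (R : realType) (d : nat) (Omega : domain) :
    {sigma_finite_measure set (phase R d) -> \bar R} :=
  prod_measure (@vol R d Omega) (@lebesgue_rV R d).

Section euclidean.
Context (R : realType) (d : nat).

(* The library norm on 'rV[R]_d is the sup norm. *)
Definition dot (u v : 'rV[R]_d) : R := \sum_(k < d) u ord0 k * v ord0 k.

Definition enorm (u : 'rV[R]_d) : R := Num.sqrt (dot u u).

End euclidean.

Section weak_derivatives.
Context (R : realType) (d : nat).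
Local Notation V := (phase R d).
Local Notation lebV := (prod_measure (@lebesgue_rV R d) (@lebesgue_rV R d)).

Definition smooth (phi : V -> R^o) : Prop :=
  forall (s : seq V) (z : V),
    differentiable (foldr (fun e (g : V -> R^o) => 'D_e g) phi s) z.

Definition test_function (phi : V -> R^o) : Prop :=
  smooth phi /\ compact (closure [set z | phi z != 0]).

Definition Lploc (p : \bar R) (u : V -> R) : Prop :=
  forall C : set V, compact C -> (u \* \1_C) \in Lfun lebV p.

Definition weak_derivative (e : V) (u g : V -> R) : Prop :=
  [/\ Lploc 1 u, Lploc 1 g & forall phi : V -> R^o, test_function phi ->
    \int[lebV]_z (u z * 'D_e phi z) = - \int[lebV]_z (g z * phi z)].

Definition xdir (k : 'I_d) : V := (delta_mx ord0 k, 0).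
Definition vdir (k : 'I_d) : V := (0, delta_mx ord0 k).

Definition W1ploc (p : \bar R) (u : V -> R) : Prop :=
  Lploc p u /\
  forall k : 'I_d,
    (exists2 g, weak_derivative (xdir k) u g & Lploc p g) /\
    (exists2 g, weak_derivative (vdir k) u g & Lploc p g).

Definition weak_vgrad (f : V -> R) (G : V -> 'rV[R]_d) : Prop :=
  forall k : 'I_d, weak_derivative (vdir k) f (fun z => G z ord0 k).

End weak_derivatives.

Section theorem_data.
Context (R : realType) (d : nat) (Omega : domain).
Variables (K : 'rV[R]_d -> 'rV[R]_d) (f : phase R d -> R)
  (* G is the weak gradient of f in v *)
  (G : phase R d -> 'rV[R]_d).

Definition Linfty_norm : \bar R := 'N[@vol R d Omega]_+oo [EFin \o @enorm R d \o K].

(* \nabla_v \log f = \nabla_v f / f; \log f need not be a distribution where f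
   vanishes, but this field only enters integrals with weight f, so its value
   there (0) is immaterial. *)
Definition grad_log (z : phase R d) : 'rV[R]_d := (f z)^-1 *: G z.

Definition Mp (p : R) : \bar R :=
  ((\int[phase_vol R d Omega]_z (enorm (grad_log z) `^ p * f z)%:E) `^ p^-1)%E.

Definition supMp : \bar R :=
  ereal_sup [set (Mp p * (p^-1)%:E)%E | p in [set p : R | 1 <= p]].

Definition rho (x : 'rV[R]_d) : R := \int[@lebesgue_rV R d]_v f (x, v).

Definition K_conv_rho (x : 'rV[R]_d) : 'rV[R]_d :=
  \row_k \int[@vol R d Omega]_y (K (x - y) ord0 k * rho y).

Definition RN (N : nat) (Z : N.-tuple (phase R d)) : R :=
  N%:R^-1 * \sum_(i < N) \sum_(j < N)
    dot (grad_log (tnth Z i))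
        (K ((tnth Z i).1 - (tnth Z j).1) - K_conv_rho (tnth Z i).1).

Definition fbar (N : nat) (Z : N.-tuple (phase R d)) : R :=
  \prod_(i < N) f (tnth Z i).

End theorem_data.

(* Main.v *)
Require Import Defs.
From HB Require Import structures.
From mathcomp Require Import all_boot all_order all_algebra.
From mathcomp Require Import all_classical all_reals all_analysis.
From mathcomp Require Import measurable_realfun ess_sup_inf.
From mathcomp Require Import lra ring zify.

Set Implicit Arguments.
Unset Strict Implicit.
Unset Printing Implicit Defensive.

Import Order.TTheory GRing.Theory Num.Theory.
Import numFieldNormedType.Exports.

Local Open Scope classical_set_scope.
Local Open Scope ring_scope.

(* Let P = f dx dv. Then the weight is the product probability P^N, and R_N is
   the sum of y_i = N^-1 sum_j q(z_i, z_j), where q(z, z') is the scalar product of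
   grad_v log f(z) and K(x - x') - K*rho(x). Two cancellations hold: q(z, .) has
   P-mean 0, and grad_v log f integrates to 0 against every function of x. Bound
   exp |R_N| by exp R_N + exp (- R_N) and expand: only even powers of R_N
   remain, and the multinomial formula splits them into monomials
   prod_i y_i^a_i / a_i!. The second cancellation removes the monomials having an
   exponent a_i = 1; the first one gives sum_j q(z_i, z_j) the size of the square
   root of N, which compensates the number of the remaining monomials. With
   M_p <= M p the absolute moments of grad_v log f of order a are at most
   (e M)^a a!, whence a geometric series in (8 e^2 |K| M)^2.

   The second cancellation is integration by parts in v for G = grad_v f, once
   (G / f) f = G is known, that is G = 0 a.e. on {f = 0}. There f is minimal, and
   since the second derivatives are locally bounded, Taylor's formula of order 2
   (tested against smooth functions approaching indicators of subsets of {f = 0})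
   forces G to vanish. *)

(** * Product measures *)

(** The constant 8 e^2 is a product of three losses: 2 because K(x - x') - K*rho(x) is bounded by
    2|K|, e from the moments, since (M a)^a <= (e M)^a a!, and 4 e from the combinatorics. With C =
    2 |K| e M everything rests on bounding the mean of R_N^(2k) / (2k)! by 4 (4 e C)^(2k), uniformly
    in N. When k is large against N, counting all exponent vectors is affordable. When it is small,
    the vectors without exponent 1 number about (N/k)^k, and the first cancellation must gain about
    (k/N)^k on each monomial. The obstacle is that a monomial multiplies powers of several sums
    sum_j q(z_i, z_j), which are not independent. The product is therefore replaced by a power of a
    single one of them; given z_i, its exponential moment factors over the particles. On the
    analytic side f and G are related only by weak derivatives, so the argument by a minimum of f is
    carried out on pairings with explicit smooth functions built from exp(-1/t). *)

Section tuple_tonelli.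
Context d (T : measurableType d) (R : realType).
Variable P : {sigma_finite_measure set T -> \bar R}.
Local Open Scope ereal_scope.

Lemma ge0_integral_tuple_powerS n (F : n.+1.-tuple T -> \bar R) :
  measurable_fun setT F -> (forall Z, 0 <= F Z) ->
  \int[tuple_power P n.+1]_Z F Z =
  \int[P]_z \int[tuple_power P n]_Z F [tuple of z :: Z].
Proof.
move=> mF F0.
rewrite [LHS](@ge0_integral_pushforward _ _ _ _ R (@tcons _ T n)
  (@measurable_tcons _ T n) (prod_measure P (tuple_power P n)) setT F)//=.
rewrite preimage_setT.
rewrite (@fubini_tonelli1 _ _ _ _ R P (tuple_power P n)
  (F \o @tcons _ T n))//=.
apply: measurableT_comp => //; exact: measurable_tcons.
Qed.

Definition tset n (Z : n.-tuple T) (i : 'I_n) (z : T) : n.-tuple T :=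
  [tuple if j == i then z else tnth Z j | j < n].

Lemma tnth_tset n (Z : n.-tuple T) i z j :
  tnth (tset Z i z) j = if j == i then z else tnth Z j.
Proof. by rewrite tnth_mktuple. Qed.

Lemma tset_cons0 n (Z : n.-tuple T) z z' :
  tset [tuple of z :: Z] ord0 z' = [tuple of z' :: Z].
Proof.
apply: eq_from_tnth => j; rewrite tnth_tset.
by case: (unliftP ord0 j) => [k ->|->]; rewrite ?tnth0 ?tnthS.
Qed.

Lemma tset_consS n (Z : n.-tuple T) i z z' :
  tset [tuple of z :: Z] (lift ord0 i) z' = [tuple of z :: tset Z i z'].
Proof.
apply: eq_from_tnth => j; rewrite tnth_tset.
case: (unliftP ord0 j) => [k ->|->]; rewrite ?tnth0 ?tnthS ?tnth_tset//.
Qed.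

Lemma measurable_tset n (i : 'I_n) :
  measurable_fun setT (fun x : n.-tuple T * T => tset x.1 i x.2).
Proof.
apply/measurable_fun_tnthP => j.
apply: (eq_measurable_fun
  (fun x : n.-tuple T * T => if j == i then x.2 else tnth x.1 j)).
  by move=> x _ /=; rewrite tnth_tset.
case: (j == i); first exact: measurable_snd.
exact: (measurableT_comp (measurable_tnth j) measurable_fst).
Qed.

Hypothesis PT : P setT = 1.

Lemma tuple_power_setT n : tuple_power P n setT = 1.
Proof.
have := @tuple_power_box _ _ _ P n (fun=> setT) (fun=> measurableT).
rewrite big1 => [<-|//]; congr (tuple_power P n _).
by apply/seteqP; split.
Qed.

(** Since [P] has mass 1, redrawing coordinate [i] leaves the law of the tuple unchanged. This acts
    as Fubini with an arbitrary coordinate singled out and avoids permuting the recursive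
    product. *)
Lemma ge0_integral_resample n (i : 'I_n) (F : n.-tuple T -> \bar R) :
  measurable_fun setT F -> (forall Z, 0 <= F Z) ->
  \int[tuple_power P n]_Z F Z =
  \int[tuple_power P n]_Z \int[P]_z F (tset Z i z).
Proof.
elim: n i F => [[]//|n IHn] i F mF F0.
have mFi : measurable_fun setT (fun x => F (tset x.1 i x.2)).
  exact: (measurableT_comp mF (measurable_tset i)).
rewrite ge0_integral_tuple_powerS//.
rewrite ge0_integral_tuple_powerS//; last 2 first.
- exact: (@measurable_fun_fubini_tonelli_F _ _ _ _ R P
    (fun x => F (tset x.1 i x.2))).
- by move=> Z; apply: integral_ge0.
have mF' : measurable_fun setT (fun x : T * n.-tuple T => F [tuple of x.1 :: x.2]).
  by apply: measurableT_comp mF _; exact: measurable_tcons.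
case: (unliftP ord0 i) => [j ->|->].
  apply: eq_integral => z _; rewrite (IHn j)//.
    apply: eq_integral => Z _; apply: eq_integral => z' _.
    by rewrite tset_consS.
  exact: (measurableT_comp mF' (measurable_pair1 z)).
(* For the head coordinate the outer variable [z1] is a dummy and integrates to 1. *)
transitivity (\int[P]_z1 \int[tuple_power P n]_Z \int[P]_z F [tuple of z :: Z]).
  rewrite integral_cst// [X in _ = _ * X](_ : _ = 1)// mule1.
  exact: (@fubini_tonelli _ _ _ _ R P (tuple_power P n)
    (fun x => F [tuple of x.1 :: x.2])).
apply: eq_integral => z1 _; apply: eq_integral => Z _.
by apply: eq_integral => z _; rewrite tset_cons0.
Qed.

End tuple_tonelli.

Section density.
Context d (T : measurableType d) (R : realType).
Variables (mu : {sigma_finite_measure set T -> \bar R}) (f : T -> R).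
Local Open Scope ereal_scope.
Hypotheses (mf : measurable_fun setT f) (f0 : forall x, (0 <= f x)%R).
Hypothesis f1 : \int[mu]_x (f x)%:E = 1.

Let fi : mu.-integrable setT (EFin \o f).
Proof.
apply/integrableP; split; first exact/measurable_EFinP.
under eq_integral do rewrite /= ger0_norm ?f0//.
by rewrite f1 ltry.
Qed.

Let nu (A : set T) : \bar R := \int[mu]_(x in A) (f x)%:E.

Let nu0 : nu set0 = 0. Proof. by rewrite /nu integral_set0. Qed.

Let nu_ge0 A : 0 <= nu A.
Proof. by apply: integral_ge0 => x _; rewrite lee_fin. Qed.

Let nu_sigma_additive : semi_sigma_additive nu.
Proof.
move=> /= A mA tA mUA; rewrite /nu integral_bigcup//=; last first.
  exact: (integrableS _ _ (subsetT _)).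
apply: is_cvg_ereal_nneg_natsum_cond => n _ _.
by apply: integral_ge0 => /= x ?; rewrite lee_fin.
Qed.

Let nuT : nu setT = 1. Proof. exact: f1. Qed.

HB.instance Definition _ := isMeasure.Build _ _ _ nu nu0 nu_ge0 nu_sigma_additive.
HB.instance Definition _ := @Measure_isProbability.Build _ _ R nu nuT.

(** The measure stays hidden behind its change of variables formula. That formula holds because [f]
    and the Radon-Nikodym derivative of [nu] have the same integral over every measurable set, hence
    agree almost everywhere. *)
Lemma density_probability : exists P : probability T R,
  forall g, measurable_fun setT g -> (forall x, 0 <= g x) ->
    \int[P]_x g x = \int[mu]_x (g x * (f x)%:E).
Proof.
exists nu => g mg g0.
have numu : nu `<< mu.
  apply/null_content_dominatesP => A mA muA0.
  by apply: null_set_integral => //; exact: measurable_funTS (measurable_int _ fi).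
pose f' := Radon_Nikodym_SigmaFinite.f nu mu.
rewrite -(Radon_Nikodym_SigmaFinite.change_of_variables numu)//.
have mf' : measurable_fun setT f'.
  exact: measurable_int (Radon_Nikodym_SigmaFinite.f_integrable numu).
apply: ae_eq_integral => //.
- exact: emeasurable_funM.
- by apply: emeasurable_funM => //; exact/measurable_EFinP.
- apply: ae_eqe_mul2l; apply: integral_ae_eq => //.
  + exact: Radon_Nikodym_SigmaFinite.f_integrable.
  + exact/measurable_EFinP.
  + by move=> A _ mA; rewrite -Radon_Nikodym_SigmaFinite.f_integral.
Qed.

End density.

Section density_tuple.
Context d (T : measurableType d) (R : realType).
Variables (mu P : {sigma_finite_measure set T -> \bar R}) (f : T -> R).
Local Open Scope ereal_scope.
Hypotheses (mf : measurable_fun setT f) (f0 : forall x, (0 <= f x)%R).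
Hypothesis Pf : forall g, measurable_fun setT g -> (forall x, 0 <= g x) ->
  \int[P]_x g x = \int[mu]_x (g x * (f x)%:E).

Lemma ge0_integral_tuple_power_density n (F : n.-tuple T -> \bar R) :
  measurable_fun setT F -> (forall Z, 0 <= F Z) ->
  \int[tuple_power P n]_Z F Z =
  \int[tuple_power mu n]_Z (F Z * (\prod_(i < n) f (tnth Z i))%:E).
Proof.
elim: n F => [|n IHn] F mF F0.
  by apply: eq_integral => Z _; rewrite big_ord0 mule1.
have mfp m : measurable_fun setT
    (fun Z : m.-tuple T => (\prod_(i < m) f (tnth Z i))%:E).
  apply/measurable_EFinP; apply: measurable_prod => i _.
  exact: (measurableT_comp mf (measurable_tnth i)).
have fp0 m (Z : m.-tuple T) : 0 <= (\prod_(i < m) f (tnth Z i))%:E.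
  by rewrite lee_fin prodr_ge0.
have mF' : measurable_fun setT (fun x : T * n.-tuple T => F [tuple of x.1 :: x.2]).
  by apply: measurableT_comp mF _; exact: measurable_tcons.
rewrite !ge0_integral_tuple_powerS//; last 2 first.
- exact: (emeasurable_funM mF (mfp _)).
- by move=> Z; rewrite mule_ge0.
rewrite Pf; last 2 first.
- exact: (@measurable_fun_fubini_tonelli_F _ _ _ _ R (tuple_power P n)
    (fun x => F [tuple of x.1 :: x.2])).
- by move=> z; apply: integral_ge0.
apply: eq_integral => z _; rewrite IHn//; last first.
  exact: (measurableT_comp mF' (measurable_pair1 z)).
have mFz := measurableT_comp mF' (measurable_pair1 z).
rewrite -ge0_integralZr//; last 3 first.
- exact: (emeasurable_funM mFz (mfp _)).
- by move=> ? _; exact: mule_ge0.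
- by rewrite lee_fin.
apply: eq_integral => Z _; rewrite -muleA -EFinM big_ord_recl tnth0 mulrC.
by congr (_ * (_ * _)%:E); apply: eq_bigr => i _; rewrite tnthS.
Qed.

End density_tuple.

Section product_probability.
Context d (T : measurableType d) (R : realType) (P : probability T R).
Local Open Scope ereal_scope.

(** Resampling is applied to the positive and the negative part separately: on each slice the two
    have the same finite integral. *)
Lemma integral_resample_eq0 n (i : 'I_n) (F : n.-tuple T -> R) :
  (tuple_power P n).-integrable setT (EFin \o F) ->
  (forall Z, P.-integrable setT (fun z => (F (tset Z i z))%:E)) ->
  (forall Z, \int[P]_z (F (tset Z i z))%:E = 0) ->
  \int[tuple_power P n]_Z (F Z)%:E = 0.
Proof.
move=> iF iFz Fz0; have mF := measurable_int _ iF.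
have PT : P setT = 1 by exact: probability_setT.
rewrite integralE.
have Fpm : \int[tuple_power P n]_Z ((EFin \o F)^\+ Z) =
           \int[tuple_power P n]_Z ((EFin \o F)^\- Z).
  rewrite (ge0_integral_resample PT i); last 2 first.
  - exact: measurable_funepos.
  - by move=> Z; exact: funepos_ge0.
  rewrite [RHS](ge0_integral_resample PT i); last 2 first.
  - exact: measurable_funeneg.
  - by move=> Z; exact: funeneg_ge0.
  apply: eq_integral => Z _.
  have := Fz0 Z; rewrite integralE => /eqP; rewrite sube_eq.
  - rewrite add0e => /eqP; under eq_integral do rewrite funeposE.
    under [in X in _ = X -> _]eq_integral do rewrite funenegE.
    move=> h; under eq_integral do rewrite funeposE.
    by under [in RHS]eq_integral do rewrite funenegE.
  - exact/integrable_pos_fin_num/iFz.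
  - by rewrite fin_num_adde_defl// integrable_neg_fin_num//; exact: iFz.
by rewrite [X in X - _]Fpm subee// integrable_neg_fin_num.
Qed.

Lemma ge0_integral_tuple_power_prod_le n (i0 : 'I_n) (g : 'I_n -> T * T -> R)
    (C : 'I_n -> R) :
  (forall j, measurable_fun setT (g j)) -> (forall j x, (0 <= g j x)%R) ->
  (forall j, j != i0 -> forall z0, \int[P]_z (g j (z0, z))%:E <= (C j)%:E) ->
  \int[P]_z (g i0 (z, z))%:E <= (C i0)%:E ->
  \int[tuple_power P n]_Z (\prod_(j < n) g j (tnth Z i0, tnth Z j))%:E
    <= (\prod_(j < n) C j)%:E.
Proof.
move=> mg g0 gC gC0.
have PT : P setT = 1 by exact: probability_setT.
have mgt j k : measurable_fun setT (fun Z : n.-tuple T => g j (tnth Z i0, tnth Z k)).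
  by apply: measurableT_comp (mg j) _; apply/measurable_fun_pair; exact: measurable_tnth.
have C0 j : (0 <= C j)%R.
  have [->|ji0] := eqVneq j i0.
    rewrite -lee_fin; apply: le_trans gC0.
    by apply: integral_ge0 => z _; rewrite lee_fin.
  rewrite -lee_fin; apply: le_trans (gC j ji0 point).
  by apply: integral_ge0 => z _; rewrite lee_fin.
have mgs (s : seq 'I_n) : measurable_fun setT (fun Z : n.-tuple T =>
    (g i0 (tnth Z i0, tnth Z i0) * \prod_(j <- s) g j (tnth Z i0, tnth Z j))%:E).
  apply/measurable_EFinP; apply: measurable_funM => //.
  by apply: measurable_prod => j _.
have gs0 (s : seq 'I_n) (Z : n.-tuple T) :
    (0 <= g i0 (tnth Z i0, tnth Z i0) * \prod_(j <- s) g j (tnth Z i0, tnth Z j))%R.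
  by rewrite mulr_ge0// prodr_ge0.
(* In a duplicate-free list avoiding [i0] the head occurs in a single factor, so redrawing that
   coordinate touches nothing else. *)
suff H (s : seq 'I_n) : uniq s -> i0 \notin s ->
    \int[tuple_power P n]_Z
      (g i0 (tnth Z i0, tnth Z i0) * \prod_(j <- s) g j (tnth Z i0, tnth Z j))%:E
    <= (C i0 * \prod_(j <- s) C j)%:E.
  have us : uniq [seq j <- index_enum 'I_n | j != i0].
    by rewrite filter_uniq// index_enum_uniq.
  have i0s : i0 \notin [seq j <- index_enum 'I_n | j != i0].
    by rewrite mem_filter eqxx.
  rewrite [X in _ <= X%:E](bigD1 i0)//=.
  have := H _ us i0s; rewrite big_filter => h; apply: le_trans h.
  rewrite le_eqVlt; apply/orP; left; apply/eqP; apply: eq_integral => Z _.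
  by rewrite (bigD1 i0)//= big_filter.
elim: s => [_ _|j s IHs /= /andP[js us]].
  rewrite big_nil mulr1 (ge0_integral_resample PT i0)//; last first.
    by move=> Z; rewrite lee_fin.
  under eq_integral => Z _.
    under eq_integral => z _ do rewrite big_nil mulr1 tnth_tset eqxx.
    over.
  rewrite integral_cst//= [X in _ * X](_ : _ = 1) ?mule1//.
  exact: tuple_power_setT.
rewrite inE negb_or => /andP[i0j i0s].
rewrite (ge0_integral_resample PT j)//; last by move=> Z; rewrite lee_fin.
have key Z : \int[P]_z (g i0 (tnth (tset Z j z) i0, tnth (tset Z j z) i0) *
      \prod_(k <- (j :: s)) g k (tnth (tset Z j z) i0, tnth (tset Z j z) k))%:E
    <= (g i0 (tnth Z i0, tnth Z i0) *
        \prod_(j <- s) g j (tnth Z i0, tnth Z j))%:E * (C j)%:E.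
  rewrite [leLHS](_ : _ = \int[P]_z ((g i0 (tnth Z i0, tnth Z i0) *
        \prod_(j <- s) g j (tnth Z i0, tnth Z j))%:E * (g j (tnth Z i0, z))%:E)).
    rewrite ge0_integralZl//; last 3 first.
    - apply/measurable_EFinP; apply: measurableT_comp (mg j) _.
      exact: measurable_pair1.
    - by move=> z _; rewrite lee_fin.
    - by rewrite lee_fin.
    by apply: lee_wpmul2l; [rewrite lee_fin|apply: gC; rewrite eq_sym].
  apply: eq_integral => z _; rewrite -EFinM big_cons !tnth_tset eqxx (negbTE i0j).
  rewrite [X in (_ * (_ * X))%R](_ : _ =
      \prod_(j <- s) g j (tnth Z i0, tnth Z j))%R.
    by congr EFin; ring.
  rewrite big_seq [RHS]big_seq; apply: eq_bigr => k ks; rewrite tnth_tset.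
  by case: eqP => // kj; move: js; rewrite -kj ks.
apply: (@le_trans _ _ (\int[tuple_power P n]_Z ((g i0 (tnth Z i0, tnth Z i0) *
        \prod_(j <- s) g j (tnth Z i0, tnth Z j))%:E * (C j)%:E))).
  apply: ge0_le_integral => //.
  - by move=> Z _; apply: integral_ge0 => z _; rewrite lee_fin.
  - apply: (@measurable_fun_fubini_tonelli_F _ _ _ _ R P (fun x => (g i0
     (tnth (tset x.1 j x.2) i0, tnth (tset x.1 j x.2) i0) *
    \prod_(k <- (j :: s)) g k (tnth (tset x.1 j x.2) i0, tnth (tset x.1 j x.2) k))%:E)).
      exact: (measurableT_comp (mgs _) (@measurable_tset _ _ n j)).
    by move=> x; rewrite lee_fin.
  - by apply: emeasurable_funM => //; exact: mgs.
rewrite ge0_integralZr//; last 2 first.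
- by move=> Z _; rewrite lee_fin.
- by rewrite lee_fin.
rewrite big_cons mulrCA mulrC EFinM lee_wpmul2r ?lee_fin//.
exact: IHs.
Qed.

End product_probability.

(** * Exponential moments of a doubly cancelling interaction *)

Section multinomial.
Context (R : realType).

Definition truncated_exp n (y : R) : {poly R} :=
  \poly_(a < n.+1) (y ^+ a / a`!%:R).

(** Coefficients up to degree n do not feel the truncation, so products obey exp(sX) exp(tX) =
    exp((s + t)X), which is the binomial formula coefficient by coefficient. *)
Lemma coef_prod_truncated_exp n (I : finType) (y : I -> R) m : (m <= n)%N ->
  (\prod_i truncated_exp n (y i))`_m = (\sum_i y i) ^+ m / m`!%:R.
Proof.
move: m; apply: (big_ind2 (fun (p : {poly R}) (s : R) =>
  forall m, (m <= n)%N -> p`_m = s ^+ m / m`!%:R)) => /=.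
- by move=> [|m] _; rewrite coef1/= ?expr0 ?fact0 ?divr1// expr0n mul0r.
- move=> p s q t Hp Hq m mn; rewrite coefM exprDn mulr_suml.
  rewrite [RHS](reindex_inj rev_ord_inj)/=.
  apply: eq_bigr => j _; have jm : (j <= m)%N by rewrite -ltnS.
  rewrite Hp ?(leq_trans jm)// Hq ?(leq_trans (leq_subr _ _))// subSS subKn//.
  rewrite bin_sub// -(bin_fact jm) !natrM -mulr_natr.
  have /= ? := fact_gt0 j; have /= ? := fact_gt0 (m - j)%N.
  have ? : ('C(m, j)%:R : R) != 0 by rewrite pnatr_eq0 -lt0n bin_gt0.
  field.
  by rewrite !pnatr_eq0 -!lt0n; apply/and3P; split=> //; rewrite bin_gt0.
- by move=> i _ m mn; rewrite coef_poly ltnS mn.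
Qed.

Lemma sum_exp_multinomial n N (y : 'I_N -> R) :
  (\sum_i y i) ^+ n / n`!%:R =
  \sum_(a : {ffun 'I_N -> 'I_n.+1} | (\sum_i a i)%N == n)
    \prod_i (y i ^+ a i / (a i)`!%:R).
Proof.
rewrite -(@coef_prod_truncated_exp n)//.
under eq_bigr do rewrite /truncated_exp poly_def.
rewrite bigA_distr_bigA/= coef_sum [RHS]big_mkcond/=; apply: eq_bigr => a _.
under eq_bigr do rewrite -mul_polyC.
rewrite big_split/= -rmorph_prod/= coefCM prodrXr coefXn.
  by rewrite eq_sym; case: ifP; rewrite ?mulr1 ?mulr0.
Qed.

End multinomial.

Section counting.
Context (R : realType).

(* The generating function of the admissible exponents, evaluated at x. *)
Lemma card_compositions_le n N (A : pred nat) (x c : R) : 0 < x ->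
  \sum_(a < n.+1 | A a) x ^+ a <= c ->
  #|[pred a : {ffun 'I_N -> 'I_n.+1} |
     ((\sum_i a i)%N == n) && [forall i, A (a i)]]|%:R <= c ^+ N / x ^+ n.
Proof.
move=> x0 xc; rewrite ler_pdivlMr ?exprn_gt0//.
have -> : c ^+ N = \prod_(i < N) c by rewrite prodr_const card_ord.
apply: (@le_trans _ _ (\prod_(i < N) \sum_(a < n.+1 | A a) x ^+ a)); last first.
  apply: ler_prod => i _; rewrite xc andbT.
  by apply: sumr_ge0 => a _; rewrite exprn_ge0// ltW.
rewrite bigA_distr_big_dep.
rewrite -sum1_card natr_sum mulr_suml.
rewrite [leRHS]big_mkcond [leLHS]big_mkcond/=; apply: ler_sum => a _.
rewrite inE; case: ifPn => [/andP[/eqP an /forallP Aa]|_].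
  have -> : a \in family (fun (i : 'I_N) (a : 'I_n.+1) => A a) by apply/familyP.
  by rewrite mul1r prodrXr an.
by case: ifP => // _; rewrite prodr_ge0// => i _; rewrite exprn_ge0// ltW.
Qed.

End counting.

Section elementary_inequalities.
Context (R : realType).
Implicit Types (x y : R).

(** Dividing by exp(y) = exp(-y/3)^(-3) and using 1 - y/3 <= exp(-y/3) reduces the claim to a
    polynomial inequality. The third root is chosen because 1 - y and (1 - y/2)^2 in its place fail
    at y = 1/2. *)
Lemma expR_le1DDsqr y : -1 <= 2 * y -> 2 * y <= 1 -> expR y <= 1 + y + y ^+ 2.
Proof.
move=> y1 y2.
have h : 1 - y / 3 <= expR (- (y / 3)) by exact: expR_ge1Dx.
have e3 : expR y * expR (- (y / 3)) ^+ 3 = 1.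
  rewrite -expRM_natl -expRD -[RHS]expR0; congr expR.
  by rewrite -mulr_natl; field.
have p : 0 < 1 - y / 3 by lra.
have : (1 - y / 3) ^+ 3 <= expR (- (y / 3)) ^+ 3.
  by rewrite lerXn2r ?nnegrE ?expR_ge0// ltW.
have q : 0 < (1 - y / 3) ^+ 3 by rewrite exprn_gt0.
have e0 := expR_gt0 y.
have key : 1 <= (1 + y + y ^+ 2) * (1 - y / 3) ^+ 3.
  rewrite -subr_ge0.
  have -> : (1 + y + y ^+ 2) * (1 - y / 3) ^+ 3 - 1 =
    y ^+ 2 * (9 - 19 * y + 8 * y ^+ 2 - y ^+ 3) / 27 by field.
  rewrite divr_ge0// mulr_ge0 ?sqr_ge0//.
  have : 0 <= y ^+ 2 by exact: sqr_ge0.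
  have : y ^+ 3 = y * y ^+ 2 by rewrite exprS.
  by nra.
move=> cmp; rewrite -(ler_pM2r q); apply: le_trans key.
by rewrite -[leRHS]e3 ler_pM2l.
Qed.

Lemma expR1_sqr_ge4 : 4 <= expR 1 ^+ 2 :> R.
Proof. by have := @expR_ge1Dx R 1; nra. Qed.

(** The power 32 of 1 - 1/16 <= exp(-1/16) bounds exp(-2) below by (15/16)^32, which is just above
    1/8. *)
Lemma expR1_sqr_le8 : expR 1 ^+ 2 <= 8 :> R.
Proof.
have h : (15 / 16 : R) <= expR (- (1 / 16)).
  by have := @expR_ge1Dx R (- (1/16)); lra.
have e16 : expR 1 ^+ 2 * expR (- (1 / 16)) ^+ 32 = 1 :> R.
  rewrite -!expRM_natl -expRD -[RHS]expR0; congr expR; by field.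
have h32 : (15 / 16 : R) ^+ 32 <= expR (- (1 / 16)) ^+ 32.
  by rewrite lerXn2r ?nnegrE ?expR_ge0//; lra.
have : expR 1 ^+ 2 * (15 / 16) ^+ 32 <= 1 :> R.
  by rewrite -[leRHS]e16 ler_pM2l// exprn_gt0// expR_gt0.
have : 1 <= 8 * (15 / 16 : R) ^+ 32.
  by lra.
have : 0 < (15 / 16 : R) ^+ 32 by rewrite exprn_gt0//; lra.
set u := _ ^+ 32; set v := expR 1 ^+ 2; nra.
Qed.

(** Pair the factors: (k + j)(k - j) <= k^2 for 0 < j < k; the two unpaired factors are k and 2k. *)
Lemma fact_double_le k : (0 < k)%N -> ((2 * k)`! <= 2 * k ^ (2 * k))%N.
Proof.
move=> k0.
have H m : (m < k)%N -> ((k + m)`! <= k ^ (2 * m).+1 * (k - m.+1)`!)%N.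
  elim: m => [_|m IH mk].
    by rewrite addn0 muln0 expn1 subn1 -[X in (X`! <= _)%N](prednK k0) factS prednK.
  have {IH} := IH (ltnW mk).
  rewrite addnS factS (_ : (k - m.+1)%N = (k - m.+2).+1); last by rewrite subnSK.
  rewrite factS => IH.
  rewrite (_ : (2 * m.+1).+1 = (2 * m).+1 + 2)%N; last by lia.
  rewrite expnD -mulnA; apply: (@leq_trans ((k + m).+1 * (k ^ (2 * m).+1 * ((k - m.+2).+1 * (k - m.+2)`!)))%N).
    by rewrite leq_mul2l IH orbT.
  rewrite mulnCA leq_mul2l; apply/orP; right.
  rewrite mulnA leq_mul2r; apply/orP; right.
  rewrite (_ : (k - m.+2).+1 = k - m.+1)%N; last by lia.
  by rewrite expnS expn1; nia.
have := H k.-1; rewrite ltn_predL => /(_ k0).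
rewrite prednK// subnn fact0 muln1.
rewrite (_ : (k + k.-1)%N = (2 * k).-1); last by lia.
rewrite (_ : (2 * k.-1).+1 = (2 * k).-1); last by lia.
move=> h; have k2 : (0 < 2 * k)%N by lia.
rewrite -[X in (X`! <= _)%N](prednK k2) factS prednK//.
rewrite -[X in (_ <= 2 * k ^ X)%N](prednK k2) expnS mulnA.
by rewrite leq_mul2l h orbT.
Qed.

(** The product is at most the n-th power of the largest |S_i| among those with a_i > 0, and a sum
    dominates that maximum. This decouples the sums attached to different particles. *)
Lemma prod_norm_expr_le_sum N (n : nat) (S : 'I_N -> R) (a : 'I_N -> nat) :
  (0 < n)%N -> (\sum_i a i)%N = n ->
  \prod_i `|S i| ^+ a i <= \sum_(i | (0 < a i)%N) `|S i| ^+ n.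
Proof.
move=> n0 an.
have [i0 ai0] : exists i, (0 < a i)%N.
  apply/existsP; rewrite -[X in is_true X]negbK; apply/negP => /existsPn h.
  by move: n0; rewrite -an big1// => i _; have := h i; rewrite lt0n negbK => /eqP.
have [j aj jmax] := @arg_maxP _ R _ i0 (fun i => (0 < a i)%N) (fun i => `|S i|) ai0.
apply: (@le_trans _ _ (`|S j| ^+ n)).
  rewrite -an -prodrXr; apply: ler_prod => i _; rewrite exprn_ge0//=.
  have [->|ai] := posnP (a i); first by rewrite !expr0.
  by apply: lerXn2r; rewrite ?nnegrE//; exact: jmax.
by rewrite (bigD1 j)//= lerDl sumr_ge0// => i _; rewrite exprn_ge0.
Qed.

End elementary_inequalities.

Lemma finite_measure_integrable_le d (T : measurableType d) (R : realType)
    (mu : {finite_measure set T -> \bar R}) (h : T -> R) (b : R) :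
  measurable_fun setT h -> (forall x, `|h x| <= b) ->
  mu.-integrable setT (EFin \o h).
Proof.
move=> mh hb; apply: (@le_integrable _ _ _ _ _ _ _ (EFin \o cst b)) => //.
- exact/measurable_EFinP.
- by move=> x _ /=; rewrite lee_fin (le_trans (hb x))// ler_norm.
- exact: finite_measure_integrable_cst.
Qed.

(** Without its linear term the geometric series is 1 + x^2 / (1 - x). With x^2 = k / N the N-th
    power of the bound then stays below exp(2k). *)
Lemma sum_expr_geometric_le (R : realType) n (x : R) : 0 <= x -> 2 * x <= 1 ->
  \sum_(a < n.+1 | a != 1%N :> nat) x ^+ a <= 1 + 2 * x ^+ 2.
Proof.
move=> x0 x1.
have H m : \sum_(a < m) x ^+ a * (1 - x) = 1 - x ^+ m.
  elim: m => [|m IH]; first by rewrite big_ord0 expr0 subrr.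
  by rewrite big_ord_recr/= IH exprSr; ring.
case: n => [|n].
  rewrite big_mkcond big_ord_recl big_ord0/= expr0 addr0 lerDl mulr_ge0//.
  exact: sqr_ge0.
rewrite big_mkcond big_ord_recl/= expr0 lerD2l big_ord_recl/= add0r.
have x1' : 0 < 1 - x by lra.
rewrite -(ler_pM2r x1') mulr_suml.
apply: (@le_trans _ _ (x ^+ 2 * \sum_(a < n) x ^+ a * (1 - x))).
  rewrite mulr_sumr; apply: ler_sum => i _ /=.
  by rewrite /bump/= !add1n/= mulrA !exprS; lra.
have := exprn_ge0 n x0; have := sqr_ge0 x; rewrite H; set u := x ^+ 2; set v := x ^+ n; nra.
Qed.

Section cosh_series.
Context (R : realType).
Implicit Type r : R.

Definition cosh_series r : R^nat :=
  fun K => \sum_(k < K) 2 * (r ^+ (2 * k) / (2 * k)`!%:R).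

Lemma cosh_seriesE r K : cosh_series r K =
  series (exp_coeff r) (2 * K)%N + series (exp_coeff (- r)) (2 * K)%N.
Proof.
rewrite /cosh_series /series/=; elim: K => [|K IH].
  by rewrite big_ord0 muln0 !big_nil addr0.
rewrite big_ord_recr/= IH mulnS add2n !big_nat_recr//= /exp_coeff/=.
have -> : (- r) ^+ (2 * K) = r ^+ (2 * K) by rewrite exprM sqrrN -exprM.
have -> : (- r) ^+ (2 * K).+1 = - r ^+ (2 * K).+1.
  by rewrite exprS [in RHS]exprS exprM sqrrN -exprM mulNr.
by rewrite mulNr; ring.
Qed.

Lemma cvg_cosh_series r : cosh_series r @ \oo --> expR r + expR (- r).
Proof.
rewrite (_ : cosh_series r = (fun K => series (exp_coeff r) (muln 2 K) +
  series (exp_coeff (- r)) (muln 2 K))); last by apply/funext => K; exact: cosh_seriesE.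
have h (u : R^nat) l : u @ \oo --> l -> (fun K => u (muln 2 K)) @ \oo --> l.
  by move=> ul A /ul[n _ nA]; exists n => // K nK; apply: nA => /=; rewrite -[n]mul1n leq_mul.
by apply: cvgD; apply: h; exact: is_cvg_series_exp_coeff.
Qed.

End cosh_series.

Section moments.
Context dX dV (X : measurableType dX) (V : measurableType dV) (R : realType)
  (d : nat).
Let T : measurableType _ := (X * V)%type.
Variables (P : probability T R) (xi : 'I_d -> T -> R) (kappa : 'I_d -> X -> X -> R)
  (w : T -> R) (B C : R).

(** The coefficients [kappa] depend on positions only, so that the velocity of [z] enters through
    [xi] alone; the cancellation of [xi] against functions of position can then act. *)
Definition interaction (z z' : T) : R := \sum_(c < d) xi c z * kappa c z.1 z'.1.
Local Notation q := interaction.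

Hypotheses (mxi : forall c, measurable_fun setT (xi c))
  (ixi : forall c, P.-integrable setT (EFin \o xi c))
  (mkappa : forall c, measurable_fun setT (fun p : X * X => kappa c p.1 p.2))
  (kappaB : forall c x x', `|kappa c x x'| <= B)
  (mw : measurable_fun setT w)
  (qw : forall z z', `|q z z'| <= w z)
  (q0 : forall z, (\int[P]_z' (q z z')%:E = 0)%E)
  (xi0 : forall c (h : X -> R), measurable_fun setT h ->
    (exists b, forall x, `|h x| <= b) -> (\int[P]_z (xi c z * h z.1)%:E = 0)%E)
  (wC : forall a, (\int[P]_z (w z ^+ a)%:E <= (C ^+ a * a`!%:R)%:E)%E).

Let w0 z : 0 <= w z. Proof. exact: le_trans (normr_ge0 _) (qw z z). Qed.

Let C0 : 0 <= C.
Proof.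
rewrite -lee_fin; have := wC 1%N; rewrite expr1 mulr1 => h; apply: le_trans h.
by apply: integral_ge0 => z _; rewrite lee_fin expr1.
Qed.

Let PT : P setT = 1%E. Proof. exact: probability_setT. Qed.

Let mq : measurable_fun setT (fun p : T * T => q p.1 p.2).
Proof.
apply: measurable_sum => c; apply: measurable_funM.
  exact: (measurableT_comp (mxi c) measurable_fst).
have mg : measurable_fun setT (fun p : T * T => (p.1.1, p.2.1)).
  apply/measurable_fun_pair.
    exact: (measurableT_comp measurable_fst measurable_fst).
  exact: (measurableT_comp measurable_fst measurable_snd).
exact: (measurableT_comp (mkappa c) mg).
Qed.

Variable N : nat.
Hypothesis N0 : (0 < N)%N.

Definition mean_interaction (i : 'I_N) (Z : N.-tuple T) : R :=
  N%:R^-1 * \sum_(j < N) q (tnth Z i) (tnth Z j).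
Local Notation y := mean_interaction.
Local Notation PN := (tuple_power P N).

Let my i : measurable_fun setT (y i).
Proof.
apply: measurable_funM => //; apply: measurable_sum => j.
have mg : measurable_fun setT (fun Z : N.-tuple T => (tnth Z i, tnth Z j)).
  by apply/measurable_fun_pair; exact: measurable_tnth.
exact: (measurableT_comp mq mg).
Qed.

Let yw i Z : `|y i Z| <= w (tnth Z i).
Proof.
rewrite /y normrM ger0_norm ?invr_ge0// ler_pdivrMl ?ltr0n//.
apply: le_trans (ler_norm_sum _ _ _) _.
rewrite -[X in X%:R * _](card_ord N) -sumr_const mulr_suml.
by apply: ler_sum => j _; rewrite mul1r.
Qed.

Definition monomial (a : 'I_N -> nat) (Z : N.-tuple T) : R :=
  \prod_i y i Z ^+ a i.

Let mmono a : measurable_fun setT (monomial a).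
Proof. by apply: measurable_prod => i _; exact: measurable_funX. Qed.

Let mono_w a Z : `|monomial a Z| <= \prod_i w (tnth Z i) ^+ a i.
Proof.
rewrite normr_prod; apply: ler_prod => i _; rewrite normr_ge0 normrX/=.
by apply: lerXn2r; rewrite ?nnegrE.
Qed.

Let mwprod a : measurable_fun setT
  (fun Z : N.-tuple T => \prod_i w (tnth Z i) ^+ a i).
Proof.
apply: measurable_prod => i _; apply: measurable_funX.
exact: (measurableT_comp mw (measurable_tnth i)).
Qed.

Let wprodC a : (\int[PN]_Z (\prod_i w (tnth Z i) ^+ a i)%:E <=
  (\prod_i (C ^+ a i * (a i)`!%:R))%:E)%E.
Proof.
have := @ge0_integral_tuple_power_prod_le _ _ _ P N (Ordinal N0)
  (fun j p => w p.2 ^+ a j) (fun j => C ^+ a j * (a j)`!%:R); apply => //=.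
- move=> j; apply: measurable_funX.
  exact: (measurableT_comp mw measurable_snd).
- by move=> j p; rewrite exprn_ge0.
Qed.

Let imono a : PN.-integrable setT (EFin \o monomial a).
Proof.
apply: (@le_integrable _ _ _ _ _ _ _
  (EFin \o (fun Z : N.-tuple T => \prod_i w (tnth Z i) ^+ a i))) => //.
- exact/measurable_EFinP.
- move=> Z _ /=; rewrite lee_fin; apply: le_trans (mono_w _ _) _.
  exact: ler_norm.
- apply/integrableP; split; first exact/measurable_EFinP.
  under eq_integral => Z _.
    rewrite /= ger0_norm; last by rewrite prodr_ge0// => i _; rewrite exprn_ge0.
    over.
  by apply: le_lt_trans (wprodC a) _; rewrite ltry.
Qed.

Lemma monomial_le a : (\int[PN]_Z `|monomial a Z|%:E <=
  (\prod_i (C ^+ a i * (a i)`!%:R))%:E)%E.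
Proof.
apply: le_trans (wprodC a); apply: ge0_le_integral => //.
- by apply/measurable_EFinP; exact: measurableT_comp.
- exact/measurable_EFinP.
- by move=> Z _; rewrite lee_fin.
Qed.

(** The velocity of particle [m] occurs only in y_m, through [xi], because every other y_i sees
    particle [m] through its position. As y_m has exponent 1, the monomial is linear in [xi] at that
    particle, with bounded coefficients depending on its position. *)
Lemma integral_monomial_eq0 a m : a m = 1 -> (\int[PN]_Z (monomial a Z)%:E = 0)%E.
Proof.
move=> am1.
(* Only the position of particle [m] is replaced; its velocity is an arbitrary filler taken from
   [Z], which makes the cofactor [h] a function of position. *)
pose arg (Z : N.-tuple T) x : N.-tuple T := tset Z m (x, (tnth Z m).2).
pose h (Z : N.-tuple T) c (x : X) : R :=
  N%:R^-1 * \sum_(j < N) kappa c x (tnth (arg Z x) j).1 *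
  \prod_(i < N | i != m) y i (arg Z x) ^+ a i.
have marg Z : measurable_fun setT (arg Z).
  have mg : measurable_fun setT (fun x : X => (Z, (x, (tnth Z m).2))).
    by apply/measurable_fun_pair => //; apply/measurable_fun_pair.
  exact: (measurableT_comp (@measurable_tset _ _ N m) mg).
have mh Z c : measurable_fun setT (h Z c).
  apply: measurable_funM => //; apply: measurable_sum => j.
  apply: measurable_funM; last first.
    under eq_fun do rewrite big_mkcond.
    apply: measurable_prod => i _; case: (i != m) => //; apply: measurable_funX.
    exact: (measurableT_comp (my i) (marg Z)).
  have mg : measurable_fun setT (fun x : X => (x, (tnth (arg Z x) j).1)).
    apply/measurable_fun_pair => //; apply: measurableT_comp => //.
    exact: (measurableT_comp (measurable_tnth j) (marg Z)).
  exact: (measurableT_comp (mkappa c) mg).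
have hb Z c : exists b, forall x, `|h Z c x| <= b.
  exists (N%:R^-1 * \sum_(j < N) (B * \prod_(i < N | i != m) w (tnth Z i) ^+ a i)) => x.
  rewrite /h normrM ger0_norm ?invr_ge0//; apply: ler_wpM2l; first by rewrite invr_ge0.
  apply: le_trans (ler_norm_sum _ _ _) _; apply: ler_sum => j _.
  rewrite normrM ler_pM// normr_prod; apply: ler_prod => i im.
  rewrite normr_ge0 normrX/=; apply: lerXn2r; rewrite ?nnegrE//.
  by apply: le_trans (yw _ _) _; rewrite tnth_tset (negbTE im).
have monoE Z z : monomial a (tset Z m z) = \sum_c xi c z * h Z c z.1.
  have mi i : (tnth (tset Z m z) i).1 = (tnth (arg Z z.1) i).1.
    by rewrite !tnth_tset; case: eqP.
  rewrite /monomial (bigD1 m)//= am1 expr1.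
  have -> : \prod_(i < N | i != m) y i (tset Z m z) ^+ a i =
            \prod_(i < N | i != m) y i (arg Z z.1) ^+ a i.
    apply: eq_bigr => i im; congr (_ ^+ _); rewrite /y; congr (_ * _).
    apply: eq_bigr => j _; rewrite /q; apply: eq_bigr => c _.
    by rewrite !mi; congr (xi c _ * _); rewrite !tnth_tset (negbTE im).
  rewrite /y /q tnth_tset eqxx exchange_big/= mulr_sumr mulr_suml.
  apply: eq_bigr => c _; rewrite -!mulr_sumr.
  rewrite /h -mulr_suml mulrCA !mulrA; congr (_ * _ * _).
  by apply: eq_bigr => j _; rewrite mi.
have ixh Z c : P.-integrable setT (fun z => (xi c z * h Z c z.1)%:E).
  have [b hbb] := hb Z c.
  have := @integrableMl _ _ _ P setT measurableT (EFin \o xi c) (h Z c \o fst).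
  apply=> //; first exact: (measurableT_comp (mh Z c) measurable_fst).
  exists b; split; first by rewrite num_real.
  by move=> x bx z _ /=; rewrite (le_trans (hbb _))// ltW.
apply: (@integral_resample_eq0 _ _ _ P N m) => // Z.
  under eq_fun do rewrite monoE -sumEFin.
  by apply: integrable_sum => // c _; exact: ixh.
under eq_integral do rewrite monoE -sumEFin.
rewrite integral_sum//.
by rewrite big1// => c _; apply: xi0.
Qed.

(* Since [tau z] is centered and bounded by 1, the exponential moments of
   sum_j tau z_i z_j are subgaussian; this is the source of the decay in N. *)
Let tau z z' := q z z' / w z.

(** Where [w z = 0] the quotient is 0 by the convention for the inverse of 0, and [q] vanishes as
    well, being bounded by [w]. *)
Let tauE z z' : q z z' = w z * tau z z'.
Proof.
rewrite /tau; have [wz|wz] := eqVneq (w z) 0; last by rewrite mulrCA divff// mulr1.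
by rewrite wz mul0r; apply/eqP; rewrite -normr_le0 -wz.
Qed.

Let tau_le1 z z' : `|tau z z'| <= 1.
Proof.
rewrite /tau; have [wz|wz] := eqVneq (w z) 0.
  by rewrite wz invr0 mulr0 normr0.
rewrite normrM normfV [X in _ / X]ger0_norm// ler_pdivrMr ?mul1r//.
by rewrite lt_neqAle eq_sym wz w0.
Qed.

Let mtau : measurable_fun setT (fun p : T * T => tau p.1 p.2).
Proof.
apply: measurable_funM; first exact: mq.
apply: (eq_measurable_fun (fun p : T * T => w p.1 `^ (-1))).
  by move=> p _; rewrite powR_inv1.
exact: (measurableT_comp (measurable_powR _) (measurableT_comp mw measurable_fst)).
Qed.

(** The linear term of the quadratic bound on exp integrates to 0 because [q] is centered, which
    leaves 1 + t^2 <= exp(t^2). *)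
Let exp_tau z t : -1 <= 2 * t -> 2 * t <= 1 ->
  (\int[P]_z' (expR (t * tau z z'))%:E <= (expR (t ^+ 2))%:E)%E.
Proof.
move=> t1 t2.
have mtz : measurable_fun setT (tau z) by exact: (measurableT_comp mtau (measurable_pair1 z)).
have itau : P.-integrable setT (EFin \o tau z).
  exact: (@finite_measure_integrable_le _ _ _ P _ 1).
apply: (@le_trans _ _ (\int[P]_z' ((1 + t ^+ 2)%:E + t%:E * (tau z z')%:E))%E).
  apply: ge0_le_integral => //.
  - apply/measurable_EFinP; apply: measurableT_comp => //.
    exact: measurable_funM.
  - apply: emeasurable_funD => //; apply: emeasurable_funM => //.
    exact/measurable_EFinP.
  - move=> z' _; rewrite -EFinM -EFinD lee_fin.
    have := tau_le1 z z'; rewrite ler_norml => /andP[u1 u2].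
    apply: le_trans (expR_le1DDsqr _ _) _; [nra|nra|].
    rewrite exprMn; have := sqr_ge0 t; have : tau z z' ^+ 2 <= 1.
      by rewrite expr2; nra.
    by set v := tau z z' ^+ 2; set u := t ^+ 2; nra.
rewrite integralD//; last 2 first.
- exact: finite_measure_integrable_cst.
- exact: integrableZl.
rewrite integral_cst//= PT mule1 integralZl//.
have -> : (\int[P]_x (tau z x)%:E = 0)%E.
  rewrite /tau; under eq_integral do rewrite mulrC EFinM.
  rewrite integralZl//; first by rewrite q0 mule0.
  apply: (@finite_measure_integrable_le _ _ _ P _ (w z)) => //.
  exact: (measurableT_comp mq (measurable_pair1 z)).
by rewrite mule0 adde0 lee_fin expR_ge1Dx.
Qed.

Let S i (Z : N.-tuple T) := \sum_(j < N) tau (tnth Z i) (tnth Z j).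

Let E a t i (Z : N.-tuple T) : R :=
  \prod_j w (tnth Z j) ^+ a j * expR (t * S i Z).

Let mE a t i : measurable_fun setT (E a t i).
Proof.
apply: measurable_funM => //; apply: measurableT_comp => //.
apply: measurable_funM => //; apply: measurable_sum => j.
have mg : measurable_fun setT (fun Z : N.-tuple T => (tnth Z i, tnth Z j)).
  by apply/measurable_fun_pair; exact: measurable_tnth.
exact: (measurableT_comp mtau mg).
Qed.

Let E0 a t i Z : 0 <= E a t i Z.
Proof. by rewrite mulr_ge0 ?expR_ge0// prodr_ge0// => j _; rewrite exprn_ge0. Qed.

(** Given z_i the integrand factors over j. Where a_j = 0, centering gives exp(t^2). Where a_j > 0,
    the weight w^a_j spoils the centering and only |tau| <= 1 is used, for at most n indices. The
    assumption a_i > 0 puts the diagonal factor tau(z_i, z_i), which is not centered, in the second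
    class. *)
Let exp_S a t i n : -1 <= 2 * t -> 2 * t <= 1 -> (0 < a i)%N ->
  (\sum_i a i)%N = n ->
  (\int[PN]_Z (E a t i Z)%:E <=
    (\prod_j (C ^+ a j * (a j)`!%:R) * expR (`|t| * n%:R + t ^+ 2 * N%:R))%:E)%E.
Proof.
move=> t1 t2 ai an.
pose g j (p : T * T) := w p.2 ^+ a j * expR (t * tau p.1 p.2).
pose D j := (C ^+ a j * (a j)`!%:R) * expR (if a j == 0%N then t ^+ 2 else `|t|).
have mg j : measurable_fun setT (g j).
  apply: measurable_funM.
    exact: measurable_funX (measurableT_comp mw measurable_snd).
  by apply: measurableT_comp => //; apply: measurable_funM.
have g_le j z z' : (0 < a j)%N -> g j (z, z') <= w z' ^+ a j * expR `|t|.
  move=> aj; rewrite ler_wpM2l ?exprn_ge0// ler_expR.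
  by apply: le_trans (ler_norm _) _; rewrite normrM ler_piMr.
have ig_le j (u : T -> T) : measurable_fun setT u -> (0 < a j)%N ->
    (\int[P]_z (g j (u z, z))%:E <= (D j)%:E)%E.
  move=> mu aj; rewrite /D gtn_eqF//.
  apply: (@le_trans _ _ (\int[P]_z ((w z ^+ a j)%:E * (expR `|t|)%:E))%E).
    apply: ge0_le_integral => //.
    - by move=> z _; rewrite lee_fin mulr_ge0 ?exprn_ge0 ?expR_ge0.
    - apply/measurable_EFinP; apply: (measurableT_comp (mg j)).
      exact/measurable_fun_pair.
    - apply: emeasurable_funM => //; apply/measurable_EFinP.
      exact: measurable_funX.
    - by move=> z _; rewrite -EFinM lee_fin g_le.
  rewrite ge0_integralZr//.
  - by rewrite EFinM lee_wpmul2r// lee_fin expR_ge0.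
  - by apply/measurable_EFinP; exact: measurable_funX.
  - by move=> z _; rewrite lee_fin exprn_ge0.
apply: (@le_trans _ _ (\prod_j D j)%:E).
  rewrite (_ : (\int[PN]_Z (E a t i Z)%:E)%E =
      (\int[PN]_Z (\prod_j g j (tnth Z i, tnth Z j))%:E)%E); last first.
    apply: eq_integral => Z _; rewrite /g/= big_split/= /E; congr (_ * _)%:E.
    by rewrite -expR_sum mulr_sumr.
  apply: ge0_integral_tuple_power_prod_le => //.
  - by move=> j p; rewrite mulr_ge0 ?exprn_ge0 ?expR_ge0.
  - move=> j ji z0; have [aj|aj] := posnP (a j); last exact: ig_le.
    rewrite /g/D aj/=; under eq_integral do rewrite expr0 mul1r.
    by rewrite expr0 mulr1 mul1r; exact: exp_tau.
  - exact: ig_le.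
rewrite lee_fin /D big_split/= -expR_sum; apply: ler_wpM2l.
  by rewrite prodr_ge0// => j _; rewrite mulr_ge0 ?exprn_ge0.
rewrite ler_expR -an natr_sum mulr_sumr.
have -> : t ^+ 2 * N%:R = \sum_(j < N) t ^+ 2 by rewrite sumr_const card_ord mulr_natr.
rewrite -big_split/=; apply: ler_sum => j _; case: eqP => [->|/eqP aj].
  by rewrite mulr0 add0r.
apply: (@le_trans _ _ (`|t| * (a j)%:R)); last by rewrite lerDl sqr_ge0.
by rewrite ler_peMr// ler1n lt0n.
Qed.

(** Since y_i = w_i S_i / N, the weights come out and a product of powers of the S_i remains. It is
    reduced to single n-th powers, each bounded through u^n / n! <= exp(u) at u = x |S_i|; the
    parameter x is left free for optimization. *)
Let monomial_S a n x Z : 0 < x -> (0 < n)%N -> (\sum_i a i)%N = n ->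
  `|monomial a Z| <= \sum_i (N%:R ^- n * (n`!%:R / x ^+ n) * (a i)%:R) *
    (E a x i Z + E a (- x) i Z).
Proof.
move=> x0 n0 an.
have -> : `|monomial a Z| =
    \prod_i w (tnth Z i) ^+ a i * (N%:R ^- n * \prod_i `|S i Z| ^+ a i).
  rewrite normr_prod -an -exprVn -prodrXr -!big_split/=; apply: eq_bigr => i _.
  rewrite normrX -!exprMn; congr (_ ^+ _); rewrite /y.
  under eq_bigr do rewrite tauE.
  by rewrite -mulr_sumr mulrCA !normrM ger0_norm// ger0_norm ?invr_ge0.
(* The indicator of a_i > 0 is enlarged to a_i: the weights then add up to n, and the terms with a_i
   = 0, to which [exp_S] does not apply, carry the coefficient 0. *)
apply: (@le_trans _ _ (\prod_i w (tnth Z i) ^+ a i *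
    (N%:R ^- n * \sum_i (a i)%:R * `|S i Z| ^+ n))).
  apply: ler_wpM2l; first by rewrite prodr_ge0// => j _; rewrite exprn_ge0.
  apply: ler_wpM2l; first by rewrite invr_ge0 exprn_ge0.
  apply: le_trans (prod_norm_expr_le_sum _ n0 an) _.
  rewrite big_mkcond/=; apply: ler_sum => i _; case: ifPn => ai.
    by rewrite ler_peMl ?exprn_ge0// ler1n.
  by rewrite mulr_ge0// exprn_ge0.
rewrite 2!mulr_sumr; apply: ler_sum => i _.
have key : `|S i Z| ^+ n <= n`!%:R / x ^+ n * (expR (x * S i Z) + expR (- x * S i Z)).
  have xn : 0 < x ^+ n by rewrite exprn_gt0.
  have fn : (0 : R) < n`!%:R by rewrite ltr0n fact_gt0.
  have h : (x * `|S i Z|) ^+ n / n`!%:R <= expR (x * `|S i Z|).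
    have xS : 0 <= x * `|S i Z| by rewrite mulr_ge0// ltW.
    have := @expR_ge1Dxn _ _ n.-1 xS; rewrite prednK//; apply: le_trans.
    by rewrite lerDr.
  have h2 : expR (x * `|S i Z|) <= expR (x * S i Z) + expR (- x * S i Z).
    have [S0|S0] := leP 0 (S i Z).
      by rewrite ger0_norm// lerDl expR_ge0.
    by rewrite ltr0_norm// mulrN mulNr lerDr expR_ge0.
  have := le_trans h h2; rewrite ler_pdivrMr// exprMn => h3.
  by rewrite mulrAC ler_pdivlMr// mulrC [n`!%:R * _]mulrC.
rewrite /E -mulrDr [leRHS](_ : _ = \prod_j w (tnth Z j) ^+ a j * (N%:R ^- n *
  ((a i)%:R * (n`!%:R / x ^+ n * (expR (x * S i Z) + expR (- x * S i Z)))))); last by ring.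
apply: ler_wpM2l; first by rewrite prodr_ge0// => j _; rewrite exprn_ge0.
by rewrite ler_wpM2l ?invr_ge0 ?exprn_ge0// ler_wpM2l.
Qed.

Lemma monomial_le_exp a n x : 0 < x -> 2 * x <= 1 -> (0 < n)%N ->
  (\sum_i a i)%N = n ->
  (\int[PN]_Z `|monomial a Z|%:E <=
    (\prod_j (C ^+ a j * (a j)`!%:R) *
     (N%:R ^- n * (n`!%:R / x ^+ n) * (2 * n%:R) *
      expR (x * n%:R + x ^+ 2 * N%:R)))%:E)%E.
Proof.
move=> x0 x1 n0 an.
set D := \prod_j _; set e := expR _; set c := N%:R ^- n * _.
have c0 : 0 <= c.
  by rewrite mulr_ge0 ?invr_ge0 ?exprn_ge0// divr_ge0// exprn_ge0// ltW.
apply: (@le_trans _ _ (\int[PN]_Z \sum_i ((c * (a i)%:R)%:E *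
    ((E a x i Z)%:E + (E a (- x) i Z)%:E)))%E).
  apply: ge0_le_integral => //.
  - by apply/measurable_EFinP; exact: measurableT_comp.
  - apply: emeasurable_sum => i; apply: emeasurable_funM => //.
    by apply: emeasurable_funD; exact/measurable_EFinP.
  - move=> Z _; under eq_bigr do rewrite -EFinD -EFinM.
    by rewrite sumEFin lee_fin monomial_S.
rewrite ge0_integral_sum//; last 2 first.
- move=> i; apply: emeasurable_funM => //.
  by apply: emeasurable_funD; exact/measurable_EFinP.
- move=> i Z _; apply: mule_ge0; first by rewrite lee_fin mulr_ge0.
  by apply: adde_ge0; rewrite lee_fin.
apply: (@le_trans _ _ (\sum_i (c * (a i)%:R * (2 * (D * e)))%:E)%E).
  apply: lee_sum => i _; rewrite ge0_integralZl//; last 3 first.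
  - by apply: emeasurable_funD; exact/measurable_EFinP.
  - by move=> Z _; apply: adde_ge0; rewrite lee_fin.
  - by rewrite lee_fin mulr_ge0.
  rewrite [leRHS]EFinM; have [ai|ai] := posnP (a i); first by rewrite ai mulr0 !mul0e.
  apply: lee_wpmul2l; first by rewrite lee_fin mulr_ge0.
  rewrite ge0_integralD//; last 4 first.
  - by move=> Z _; rewrite lee_fin.
  - exact/measurable_EFinP.
  - by move=> Z _; rewrite lee_fin.
  - exact/measurable_EFinP.
  rewrite mulr_natl mulr2n EFinD; apply: leeD.
    have := @exp_S a x i n; rewrite ger0_norm ?(ltW x0)//; apply=> //.
    by lra.
  have := @exp_S a (- x) i n; rewrite sqrrN normrN ger0_norm ?(ltW x0)//; apply=> //; lra.
rewrite sumEFin lee_fin -mulr_suml -mulr_sumr -natr_sum an.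
by rewrite le_eqVlt; apply/orP; left; apply/eqP; ring.
Qed.

(** The factors 1 / a_i! of the multinomial formula cancel the a_i! of the moment bound, so every
    surviving monomial contributes at most C^n K and only their number matters. [A] selects the
    exponents that survive; [K] is the correction due to the centering. *)
Lemma moment_le_card (A : pred nat) (K : R) n :
  (forall a, (\sum_i a i)%N = n -> ~~ [forall i, A (a i)] ->
    (\int[PN]_Z (monomial a Z)%:E = 0)%E) ->
  (forall a, (\sum_i a i)%N = n ->
    (\int[PN]_Z `|monomial a Z|%:E <= (\prod_i (C ^+ a i * (a i)`!%:R) * K)%:E)%E) ->
  0 <= K ->
  (\int[PN]_Z ((\sum_i y i Z) ^+ n / n`!%:R)%:E <=
   (#|[pred a : {ffun 'I_N -> 'I_n.+1} |
     ((\sum_i a i)%N == n) && [forall i, A (a i)]]|%:R * (C ^+ n * K))%:E)%E.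
Proof.
move=> Abad Agood K0.
pose c (a : {ffun 'I_N -> 'I_n.+1}) : R := \prod_i ((a i)`!%:R)^-1.
have c0 a : 0 <= c a by rewrite prodr_ge0// => i _; rewrite invr_ge0.
rewrite (_ : (\int[PN]_Z _)%E = (\int[PN]_Z
    \sum_(a : {ffun 'I_N -> 'I_n.+1} | (\sum_i a i)%N == n)
      ((c a)%:E * (monomial (fun i => a i) Z)%:E))%E); last first.
  apply: eq_integral => Z _; rewrite sum_exp_multinomial -sumEFin.
  apply: eq_bigr => a _; rewrite -EFinM big_split/= mulrC; congr (_ * _)%:E.
rewrite integral_sum//; last by move=> a; apply: integrableZl => //; exact: imono.
rewrite -sum1_card natr_sum mulr_suml -sumEFin big_mkcondr/=.
apply: lee_sum => a /eqP an.
rewrite integralZl//; last exact: imono.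
case: ifPn => [_|aA]; last by rewrite Abad// mule0.
apply: (@le_trans _ _ ((c a)%:E * (\prod_i (C ^+ a i * (a i)`!%:R) * K)%:E)%E).
  apply: lee_wpmul2l; first by rewrite lee_fin.
  apply: le_trans (Agood _ an).
  apply: le_integral => //.
  - exact: imono.
  - have := integrable_abse (@imono (fun i => a i)); exact.
  - by move=> Z _; rewrite lee_fin ler_norm.
rewrite -EFinM lee_fin mul1r mulrA; apply: ler_wpM2r => //.
rewrite -big_split/= (eq_bigr (fun i => C ^+ a i)).
  by rewrite prodrXr an.
by move=> i _; rewrite mulrCA mulVf ?mulr1// pnatr_eq0 -lt0n fact_gt0.
Qed.

Let e2 : R := expR 1 ^+ 2.

Let expR_nat k : expR (2 * k%:R) = e2 ^+ k.
Proof.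
rewrite /e2 -expRM_natl -[RHS]expRM_natl; congr expR.
by rewrite mulr1 mulrC.
Qed.

(* Below [4 * k] particles the absolute moments suffice, and all exponents are
   counted with x = 1/2. *)
Let moment_le_few k : (0 < k)%N -> (N < 4 * k)%N ->
  (\int[PN]_Z ((\sum_i y i Z) ^+ (2 * k) / (2 * k)`!%:R)%:E <=
   (4 * ((4 * expR 1 * C) ^+ 2) ^+ k)%:E)%E.
Proof.
move=> k0 Nk.
have := @moment_le_card predT 1 (2 * k)%N.
move=> /(_ _ _ ler01) h; apply: le_trans (h _ _) _.
- by move=> a _ /negP[]; apply/forallP.
- by move=> a _; rewrite mulr1; exact: monomial_le.
have half n : \sum_(a < n.+1 | predT (a : nat)) (1 / 2) ^+ a <= 2 :> R.
  rewrite (eq_bigl predT)//.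
  suff -> : \sum_(a < n.+1) (1 / 2) ^+ a = 2 - (1 / 2) ^+ n :> R.
    by rewrite gerBl exprn_ge0// divr_ge0.
  elim: n => [|n IH]; first by rewrite big_ord_recl big_ord0 !expr0; lra.
  by rewrite big_ord_recr/= IH exprS; lra.
have half0 : (0 : R) < 1 / 2 by rewrite divr_gt0.
rewrite lee_fin mulr1.
apply: (@le_trans _ _ (2 ^+ N / (1 / 2) ^+ (2 * k) * C ^+ (2 * k))).
  by apply: ler_wpM2r; [rewrite exprn_ge0|exact: card_compositions_le].
rewrite -exprVn div1r invrK -[(_ ^+ 2) ^+ k]exprM exprMn mulrA.
apply: ler_wpM2r; first by rewrite exprn_ge0.
(* As N < 4k, the count is at most 64^k, and 64 <= 16 e^2. *)
apply: (@le_trans _ _ (2 ^+ (4 * k) * 2 ^+ (2 * k))).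
  by rewrite ler_wpM2r ?exprn_ge0// ler_weXn2l ?ler1n// ltnW.
rewrite [in leRHS]exprM -exprD -mulnDl exprM.
apply: (@le_trans _ _ (1 * ((4 * expR 1) ^+ 2) ^+ k)).
  rewrite mul1r; apply: lerXn2r; rewrite ?nnegrE ?exprn_ge0 ?mulr_ge0 ?expR_ge0//.
  by rewrite exprMn; have := @expR1_sqr_ge4 R; lra.
by rewrite ler_wpM2r ?exprn_ge0 ?mulr_ge0 ?expR_ge0// ler1n.
Qed.

(* Exponents equal to 1 contribute 0; the others are counted with
   x = sqrt (k / N), which also balances the exponential moment. *)
Let moment_le_many k : (0 < k)%N -> (4 * k <= N)%N ->
  (\int[PN]_Z ((\sum_i y i Z) ^+ (2 * k) / (2 * k)`!%:R)%:E <=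
   (4 * ((4 * expR 1 * C) ^+ 2) ^+ k)%:E)%E.
Proof.
move=> k0 kN.
have k0' : (0 : R) < k%:R by rewrite ltr0n.
have N0' : (0 : R) < N%:R by rewrite ltr0n.
pose x : R := Num.sqrt (k%:R / N%:R).
have x0 : 0 < x by rewrite sqrtr_gt0 divr_gt0.
have xx : x ^+ 2 = k%:R / N%:R by rewrite sqr_sqrtr// divr_ge0// ltW.
(* The threshold 4k <= N is exactly x <= 1/2, the range allowed by both the exponential moment and
   the geometric sum. *)
have x1 : 2 * x <= 1.
  rewrite -(@ler_pXn2r _ 2)// ?nnegrE ?mulr_ge0 ?(ltW x0)//.
  rewrite exprMn xx expr1n mulrA ler_pdivrMr// mul1r -natrX -natrM ler_nat.
  by rewrite (_ : (2 ^ 2 = 4)%N).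
have n0 : (0 < 2 * k)%N by rewrite muln_gt0.
pose n := (2 * k)%N.
pose K : R := N%:R ^- n * (n`!%:R / x ^+ n) * (2 * n%:R) *
      expR (x * n%:R + x ^+ 2 * N%:R).
have K0 : 0 <= K.
  rewrite !mulr_ge0 ?expR_ge0 ?invr_ge0 ?exprn_ge0//; exact: ltW.
have := @moment_le_card (fun a => a != 1%N) K n.
move=> /(_ _ _ K0) h; apply: le_trans (h _ _) _.
- move=> a _ /forallPn[m]; rewrite negbK => /eqP am.
  exact: integral_monomial_eq0 am.
- by move=> a an; apply: monomial_le_exp.
rewrite lee_fin.
apply: (@le_trans _ _ ((1 + 2 * x ^+ 2) ^+ N / x ^+ n * (C ^+ n * K))).
  apply: ler_wpM2r; first by rewrite mulr_ge0// exprn_ge0.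
  apply: (@card_compositions_le R n N (fun a => a != 1%N) x) => //.
  by apply: sum_expr_geometric_le => //; exact: ltW.
have xN : x ^+ 2 * N%:R = k%:R by rewrite xx divfK// gt_eqF.
have X0 : 0 < x ^+ n by rewrite exprn_gt0.
have M0 : (0 : R) < N%:R ^+ n by rewrite exprn_gt0.
(* One factor x^n comes from the count and one from the moment. Together with N^n they leave k^n, so
   N disappears, and k^n cancels against the bound on (2k)!. *)
have XXM : x ^+ n * x ^+ n * N%:R ^+ n = k%:R ^+ n.
  by rewrite -exprMn -expr2 -exprMn xN.
have e20 : 0 <= e2 ^+ k by rewrite exprn_ge0// sqr_ge0.
have h1 : (1 + 2 * x ^+ 2) ^+ N <= e2 ^+ k.
  rewrite -expR_nat -xN mulrA expRM_natr; apply: lerXn2r.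
  - by rewrite nnegrE addr_ge0// mulr_ge0// sqr_ge0.
  - by rewrite nnegrE expR_ge0.
  - exact: expR_ge1Dx.
have h2 : expR (x * n%:R + x ^+ 2 * N%:R) <= e2 ^+ k.
  rewrite -expR_nat ler_expR xN mulr_natl mulr2n lerD2r /n natrM mulrA.
  by rewrite -[leRHS]mul1r ler_pM2r// mulrC.
have h3 : n`!%:R <= 2 * k%:R ^+ n :> R.
  by rewrite -natrX -natrM ler_nat fact_double_le.
have pow2 j : (0 < j)%N -> (2 * j <= 2 ^ j)%N.
  by case: j => // j _; rewrite expnS leq_mul2l ltn_expl.
(* The numerical factors multiply to 8k, and the exponentials to e^(4k). Half of the latter is
   merged with 2k into 16^k, by 2k <= 2^k and e^2 <= 8; the rest gives the e^(2k) of the claim. *)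
have h4 : 2 * k%:R * e2 ^+ k <= 16 ^+ k :> R.
  apply: (@le_trans _ _ (2 ^+ k * 8 ^+ k)); last first.
    by rewrite -exprMn (_ : 2 * 8 = 16)//; ring.
  apply: ler_pM => //.
    by rewrite -natrM -natrX ler_nat pow2.
  by apply: lerXn2r; rewrite ?nnegrE ?sqr_ge0//; exact: expR1_sqr_le8.
have Cn0 : 0 <= C ^+ n by rewrite exprn_ge0.
have bE : (4 * expR 1 * C) ^+ 2 = C ^+ 2 * (16 * e2) by rewrite /e2; ring.
have -> : (4 * ((4 * expR 1 * C) ^+ 2) ^+ k) = C ^+ n * (4 * (16 ^+ k * e2 ^+ k)) :> R.
  rewrite bE [(C ^+ 2 * _) ^+ k]exprMn [(16 * e2) ^+ k]exprMn.
  by rewrite [4 * (C ^+ 2 ^+ k * _)]mulrCA [C ^+ n]exprM.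
rewrite mulrCA; apply: ler_wpM2l => //.
apply: (@le_trans _ _ (e2 ^+ k / x ^+ n *
   (N%:R ^- n * (2 * k%:R ^+ n / x ^+ n) * (2 * n%:R) * e2 ^+ k))).
  apply: ler_pM => //.
  - by rewrite mulr_ge0 ?invr_ge0 ?exprn_ge0 ?addr_ge0 ?mulr_ge0 ?sqr_ge0// ltW.
  - by rewrite ler_wpM2r// invr_ge0 ltW.
  - apply: ler_pM => //; first by rewrite !mulr_ge0 ?invr_ge0// ltW.
    rewrite ler_wpM2r ?mulr_ge0// ler_wpM2l ?invr_ge0 ?(ltW M0)//.
    by rewrite ler_wpM2r ?invr_ge0 ?(ltW X0).
rewrite -XXM.
rewrite [leLHS](_ : _ = 4 * ((2 * k%:R * e2 ^+ k) * e2 ^+ k)).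
  by rewrite ler_wpM2l// ler_wpM2r.
rewrite /n natrM; field; by rewrite !gt_eqF.
Qed.

Lemma even_moment_le k : (0 < k)%N ->
  (\int[PN]_Z ((\sum_i y i Z) ^+ (2 * k) / (2 * k)`!%:R)%:E <=
   (4 * ((4 * expR 1 * C) ^+ 2) ^+ k)%:E)%E.
Proof.
move=> k0; case: (leqP (4 * k) N) => kN.
- exact: moment_le_many.
- exact: moment_le_few.
Qed.

Lemma integral_expR_interaction_le (b := 4 * expR 1 * C) : b < 1 ->
  (\int[PN]_Z (expR `|\sum_i y i Z|)%:E <=
   (5 + 6 * (b / (1 - b ^+ 2)) ^+ 2)%:E)%E.
Proof.
move=> b1; have b0 : 0 <= b by rewrite !mulr_ge0// expR_ge0.
set p := b ^+ 2.
have p0 : 0 <= p by exact: sqr_ge0.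
have p1 : p < 1 by rewrite expr_lt1.
pose r Z := \sum_i y i Z.
have mr : measurable_fun setT r by exact: measurable_sum.
pose g K Z := (cosh_series (r Z) K)%:E.
have term0 Z k : 0 <= r Z ^+ (2 * k) / (2 * k)`!%:R.
  by rewrite divr_ge0// exprM exprn_ge0// sqr_ge0.
have mterm k : measurable_fun setT (fun Z => r Z ^+ (2 * k) / (2 * k)`!%:R).
  by apply: measurable_funM => //; exact: measurable_funX.
have mg K : measurable_fun setT (g K).
  apply/measurable_EFinP; apply: measurable_sum => k.
  exact: measurable_funM.
(* The series of exp r + exp(-r) has nonnegative terms, so monotone convergence applies although exp
   |r| is not yet known to be integrable. *)
apply: (@le_trans _ _ (\int[PN]_Z (limn (g ^~ Z)))%E).
  have limE Z : limn (g ^~ Z) = (expR (r Z) + expR (- r Z))%:E.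
    by apply/cvg_lim => //; apply: cvg_EFin; [exact: nearW|exact: cvg_cosh_series].
  apply: ge0_le_integral => //.
  - apply/measurable_EFinP; apply: measurableT_comp => //.
    exact: measurableT_comp.
  - under eq_fun do rewrite limE.
    apply/measurable_EFinP; apply: measurable_funD; apply: measurableT_comp => //.
    exact: measurableT_comp.
  - move=> Z _; rewrite limE lee_fin -/(r Z).
    have [r0|r0] := leP 0 (r Z).
      by rewrite ger0_norm// lerDl expR_ge0.
    by rewrite ltr0_norm// lerDr expR_ge0.
rewrite monotone_convergence//; last 2 first.
- by move=> K Z _; rewrite lee_fin sumr_ge0// => k _; rewrite mulr_ge0.
- move=> Z _; apply/nondecreasing_seqP => K; rewrite lee_fin /cosh_series.
  by rewrite big_ord_recr/= lerDl mulr_ge0.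
apply: lime_le.
  apply: ereal_nondecreasing_is_cvgn; apply/nondecreasing_seqP => K.
  apply: ge0_le_integral => //.
  - by move=> Z _; rewrite lee_fin sumr_ge0// => k _; rewrite mulr_ge0.
  - move=> Z _; rewrite lee_fin /cosh_series.
    by rewrite big_ord_recr/= lerDl mulr_ge0.
apply: nearW => K.
have gK : (\int[PN]_Z g K Z <= (\sum_(k < K) (if k == 0%N :> nat then 2 else 8 * p ^+ k))%:E)%E.
  rewrite /g /cosh_series; under eq_integral do rewrite -sumEFin.
  rewrite ge0_integral_sum//; last 2 first.
  - by move=> k; apply/measurable_EFinP; exact: measurable_funM.
  - by move=> k Z _; rewrite lee_fin mulr_ge0.
  rewrite -sumEFin; apply: lee_sum => k _.
  under eq_integral do rewrite EFinM.
  rewrite ge0_integralZl//; last 2 first.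
  - exact/measurable_EFinP.
  - by move=> Z _; rewrite lee_fin.
  case: eqP => [->|/eqP k0].
    rewrite muln0; under eq_integral do rewrite expr0 fact0 divr1.
    by rewrite integral_cst//= [X in (_ * (_ * X))%E](tuple_power_setT PT) !mule1.
  rewrite (_ : 8 * p ^+ k = 2 * (4 * p ^+ k)); last by ring.
  rewrite [leRHS]EFinM; apply: lee_wpmul2l; first by rewrite lee_fin.
  by apply: even_moment_le; rewrite lt0n.
apply: le_trans gK _; rewrite lee_fin.
have geo m : (\sum_(k < m) p ^+ k) * (1 - p) = 1 - p ^+ m.
  elim: m => [|m IH]; first by rewrite big_ord0 expr0 subrr mul0r.
  by rewrite big_ord_recr/= mulrDl IH exprSr; ring.
have p1' : 0 < 1 - p by rewrite subr_gt0.
(* The term k = 0 contributes 2, every other one 2 * 4 p^k. *)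
apply: (@le_trans _ _ (2 + 8 * (p / (1 - p)))).
  case: K => [|K].
    by rewrite big_ord0 addr_ge0// mulr_ge0// divr_ge0// ltW.
  rewrite big_ord_recl/= lerD2l -mulr_sumr ler_wpM2l// ler_pdivlMr//.
  under eq_bigr do rewrite exprS.
  by rewrite -mulr_sumr -mulrA geo ler_piMr// gerBl exprn_ge0.
(* The difference of the two sides has numerator 3 - 8p + 11p^2, positive because 11 times it equals
   (11p - 4)^2 + 17. *)
rewrite expr_div_n -/p -subr_ge0.
rewrite (_ : _ - _ = (3 - 8 * p + 11 * p ^+ 2) / (1 - p) ^+ 2).
  by rewrite divr_ge0 ?sqr_ge0//; have := sqr_ge0 (11 * p - 4); nra.
by field; rewrite gt_eqF.
Qed.

End moments.

(** * Lebesgue measure and test functions on phase space *)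

Section coordinate_boxes.
Context dT (T : measurableType dT) (R : realType) (I : finType) (crd : I -> T -> R).

(** The coordinates [crd] are abstract because the same boxes serve position space and phase space.
    They form a pi-system on which measures are compared and from which indicators are
    approximated. *)
Definition open_box (a b : I -> R) : set T :=
  [set z | forall i, a i < crd i z < b i].

Definition open_boxes : set (set T) := [set open_box p.1 p.2 | p in [set: (I -> R) * (I -> R)]].

Definition cube (n : nat) : set T := open_box (fun=> - n%:R) (fun=> n%:R).

Lemma setI_closed_open_boxes : setI_closed open_boxes.
Proof.
move=> _ _ [[a b] _ <-] [[a' b'] _ <-].
exists (fun i => Num.max (a i) (a' i), fun i => Num.min (b i) (b' i)) => //.
apply/seteqP; split => z /= H.
  by split=> i; have := H i; rewrite gt_max lt_min => /andP[/andP[? ?] /andP[? ?]];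
    apply/andP.
move=> i; rewrite gt_max lt_min.
by case: H => /(_ i)/andP[-> ->] /(_ i)/andP[-> ->].
Qed.

Lemma nd_cube : {homo cube : m n / (m <= n)%N >-> m `<=` n}.
Proof.
move=> m n mn z /= H i; have /andP[h1 h2] := H i.
have mn' : m%:R <= n%:R :> R by rewrite ler_nat.
by rewrite (lt_le_trans h2)// (le_lt_trans _ h1)// lerN2.
Qed.

Lemma bigcup_cube : \bigcup_n cube n = setT.
Proof.
rewrite -subTset => z _.
pose M := \sum_i `|crd i z|.
exists (Num.truncn M).+1 => // i.
have : `|crd i z| < (Num.truncn M).+1%:R.
  apply: le_lt_trans (truncnS_gt M).
  by rewrite /M (bigD1 i)//= lerDl sumr_ge0.
by rewrite ltr_norml.
Qed.

Hypothesis mcrd : forall i, measurable_fun setT (crd i).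

Lemma measurable_open_box a b : measurable (open_box a b).
Proof.
rewrite [X in measurable X](_ : _ =
    \big[setI/setT]_(i : I) (crd i @^-1` `]a i, b i[)).
  apply: bigsetI_measurable => i _.
  by rewrite -[X in measurable X]setTI; exact: mcrd.
rewrite -bigcap_seq; apply/seteqP; split=> z /= H i.
  by move=> _; rewrite /= in_itv/=; exact: H.
by have := H i (mem_index_enum i); rewrite /= in_itv.
Qed.

Hypothesis gen : forall G : set (set T), sigma_algebra setT G ->
  (forall i (B : set R), measurable B -> G (crd i @^-1` B)) -> measurable `<=` G.

Lemma measurable_open_boxes : measurable = <<s open_boxes >>.
Proof.
apply/seteqP; split; last first.
  apply: smallest_sub; first exact: sigma_algebra_measurable.
  by move=> _ [[a b] _ <-]; exact: measurable_open_box.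
apply: gen; first exact: smallest_sigma_algebra.
move=> i B mB.
pose H : set (set R) := [set B | <<s open_boxes >> (crd i @^-1` B)].
have [s0 sD sU] := smallest_sigma_algebra setT open_boxes.
have sH : sigma_algebra setT H.
  split => /=.
  - by rewrite /H/= preimage_set0.
  - by move=> A HA; rewrite /H/= setTD -preimage_setC -setTD; exact: sD.
  - by move=> A HA; rewrite /H/= preimage_bigcup; exact: sU.
suff : measurable `<=` H by apply.
rewrite [X in X `<=` _](RGenOpens.measurableE R).
apply: smallest_sub => //.
move=> _ [a [b ->]]; rewrite /H/=.
(* A slab in one coordinate is a union of boxes whose other sides grow to infinity. *)
rewrite (_ : _ @^-1` _ = \bigcup_n (open_box
    (fun j => if j == i then a else - n%:R) (fun j => if j == i then b else n%:R))).
  apply: sU => n; apply: sub_sigma_algebra.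
  by exists (fun j => if j == i then a else - n%:R, fun j => if j == i then b else n%:R).
apply/seteqP; split => z /=.
  rewrite in_itv/= => ab.
  have [n _ zn] : (\bigcup_n cube n) z by rewrite bigcup_cube.
  by exists n => // j; case: eqP => [->//|_]; exact: zn.
by move=> [n _ /(_ i)]; rewrite eqxx in_itv.
Qed.

End coordinate_boxes.

Section rV_boxes.
Context (R : realType) (d : nat).
Local Notation E := 'rV[R]_d.

Lemma rV_generated (G : set (set E)) : sigma_algebra setT G ->
  (forall i (B : set R), measurable B -> G (@rV_coord _ R d i @^-1` B)) ->
  measurable `<=` G.
Proof.
move=> sG GB; apply: smallest_sub => //.
rewrite -bigcup_seq; apply: bigcup_sub => i _ A [B mB <-].
by rewrite setTI; exact: GB.
Qed.

Let rvbox := @open_boxes _ E R 'I_d (@rV_coord _ R d).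

Lemma lebesgue_rV_open_box (a b : 'I_d -> R) :
  lebesgue_rV (open_box (@rV_coord _ R d) a b) = (\prod_(i < d) (Num.max 0 (b i - a i))%:E)%E.
Proof.
transitivity (lebesgue_rV [set x : E | forall i, [set` `]a i, b i[] (x ord0 i)]).
  congr lebesgue_rV; apply/seteqP; split => x /= H i; have := H i;
  by rewrite /= in_itv.
rewrite (@lebesgue_rV_box R d (fun i => [set` `]a i, b i[]))//; apply: eq_bigr => i _.
rewrite lebesgue_measure_itv/= lte_fin; case: ltP => ab.
  by rewrite -EFinB max_r// subr_ge0 ltW.
by rewrite max_l// subr_le0.
Qed.

(* [s = false] is the translation x + c, [s = true] is the reflection c - x. *)
Definition rV_reflect (s : bool) (c x : E) : E := c + (-1) ^+ s *: x.

Lemma measurable_rV_reflect s c : measurable_fun setT (rV_reflect s c).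
Proof.
apply/measurable_fun_rVP => i.
apply: (eq_measurable_fun (fun x : E => c ord0 i + (-1) ^+ s * rV_coord i x)).
  by move=> x _; rewrite /rV_coord /rV_reflect /= !mxE.
apply: measurable_funD => //; apply: measurable_funM => //.
exact: measurable_rV_coord.
Qed.

(** Measures that agree on boxes coincide. Translations serve the Taylor expansion, reflections the
    convolution, where x - y must avoid a null set for almost every y. *)
Lemma pushforward_rV_reflect s c (A : set E) : measurable A ->
  lebesgue_rV (rV_reflect s c @^-1` A) = lebesgue_rV A.
Proof.
move=> mA; apply/esym.
apply: (@measure_unique _ R _ rvbox (cube (@rV_coord _ R d)) _ _ _ _
  (@lebesgue_rV R d)
  (measure_function_pushforward__canonical__measure_function_Measure
     (@lebesgue_rV R d) (measurable_rV_reflect s c))) => //.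
- apply: measurable_open_boxes; first exact: measurable_rV_coord.
  exact: rV_generated.
- exact: setI_closed_open_boxes.
- by move=> n; exists (fun=> - n%:R, fun=> n%:R).
- exact: bigcup_cube.
- move=> _ [[a b] _ <-]; rewrite /= /pushforward.
  pose a' i := if s then c ord0 i - b i else a i - c ord0 i.
  pose b' i := if s then c ord0 i - a i else b i - c ord0 i.
  rewrite (_ : _ @^-1` _ = open_box (@rV_coord _ R d) a' b').
    rewrite !lebesgue_rV_open_box; apply: eq_bigr => i _; congr (Num.max 0 _)%:E.
    by rewrite /a' /b'; case: (s); ring.
  apply/seteqP; split => x /= H i; have := H i;
    rewrite /rV_reflect /rV_coord /a' /b' !mxE; case: (s) => /=;
    rewrite ?expr1 ?expr0; lra.
- by move=> n; rewrite [X in (X < _)%E]lebesgue_rV_open_box prodEFin ltry.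
Qed.

Lemma ge0_integral_rV_reflect s c (F : E -> \bar R) : measurable_fun setT F ->
  (forall x, (0 <= F x)%E) ->
  (\int[@lebesgue_rV R d]_x F (rV_reflect s c x) = \int[@lebesgue_rV R d]_x F x)%E.
Proof.
move=> mF F0.
have := @ge0_integral_pushforward _ _ _ _ R _ (measurable_rV_reflect s c)
  (@lebesgue_rV R d) setT F measurableT mF (fun x _ => F0 x).
rewrite preimage_setT => <-.
by apply: eq_measure_integral => [|mh A mA _]; [exact: measurable_rV_reflect|exact: pushforward_rV_reflect].
Qed.

End rV_boxes.

Section flat_functions.
Context (R : realType).
Implicit Types (p : {poly R}) (t u : R).

(* These profiles are closed under differentiation, see [flat_deriv], and at 0
   they vanish to infinite order. *)
Definition flat p t : R := if 0 < t then p.[t^-1] * expR (- t^-1) else 0.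

Lemma poly_expR_bounded p : exists M : R, forall u, 0 <= u -> `|p.[u]| * expR (- u) <= M.
Proof.
exists (\sum_(i < size p) `|p`_i| * i`!%:R) => u u0.
rewrite expRN ler_pdivrMr ?expR_gt0// horner_coef.
apply: le_trans (ler_norm_sum _ _ _) _; rewrite mulr_suml; apply: ler_sum => i _.
rewrite normrM -mulrA ler_wpM2l// normrX ger0_norm// mulrC.
rewrite -ler_pdivrMr ?ltr0n ?fact_gt0//.
case: (nat_of_ord i) => [|n].
  by rewrite expr0 fact0 divr1; have := expR_ge1Dx u; lra.
by have := expR_ge1Dxn n u0; lra.
Qed.

(** This is boundedness of the profile for p X^2 at u = 1 / t. Quadratic smallness is what gives the
    derivative 0 at t = 0. *)
Lemma flat_le_sqr p : exists M : R, forall t, `|flat p t| <= M * t ^+ 2.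
Proof.
have [M HM] := poly_expR_bounded (p * 'X^2); exists M => t.
have M0 : 0 <= M.
  apply: le_trans (HM 0 (lexx _)); by rewrite mulr_ge0// expR_ge0.
rewrite /flat; case: ifPn => t0; last by rewrite normr0 mulr_ge0// sqr_ge0.
have ti : 0 <= t^-1 by rewrite invr_ge0 ltW.
have h := HM _ ti; rewrite hornerM hornerXn normrM normrX (ger0_norm ti) in h.
rewrite normrM (ger0_norm (expR_ge0 _)); move: h.
by rewrite exprVn mulrAC ler_pdivrMr ?exprn_gt0.
Qed.

Lemma flat_bounded p : exists M : R, forall t, `|flat p t| <= M.
Proof.
have [M HM] := poly_expR_bounded p; exists M => t.
rewrite /flat; case: ifPn => t0.
  by rewrite normrM [`|expR _|]ger0_norm ?expR_ge0// HM// invr_ge0 ltW.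
by rewrite normr0; apply: le_trans (HM 0 (lexx _)); rewrite mulr_ge0// expR_ge0.
Qed.

(** With u = 1 / t, the chain rule turns p(u) exp(-u) into (p(u) - p'(u)) u^2 exp(-u). *)
Definition flat_deriv p : {poly R} := (p - p^`()) * 'X^2.

Lemma is_derive_flat p t : is_derive t 1 (flat p) (flat (flat_deriv p) t).
Proof.
have [t0|t0|<-] := ltgtP 0 t.
- have tn0 : t != 0 by rewrite gt_eqF.
  have inv : is_derive t 1 (fun s : R => s^-1) (- t ^- 2).
    apply: DeriveDef; first by apply: derivableV => //; exact: derivable_id.
    by rewrite (@deriveV _ _ id)// derive_id; rewrite /GRing.scale/= mulr1.
  apply: (@near_eq_is_derive R R R (fun s => p.[s^-1] * expR (- s^-1))).
    by near=> s; rewrite /flat ifT//; near: s; exact: lt_nbhsr.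
  have e1 : is_derive t 1 (fun s : R => p.[s^-1]) (p^`().[t^-1] * (- t ^- 2)).
    exact: (@is_derive1_comp _ (horner p) (fun s : R => s^-1)).
  have e2 : is_derive t 1 (fun s : R => expR (- s^-1)) (expR (- t^-1) * t ^- 2).
    have := @is_derive1_comp _ expR (fun s : R => - s^-1) t (expR (- t^-1)) (t ^- 2).
    by apply; rewrite -[X in is_derive _ _ _ X]opprK; apply: is_deriveN.
  apply: (is_derive_eq (is_deriveM e1 e2)).
  rewrite /flat t0 /flat_deriv hornerM hornerXn hornerD hornerN /GRing.scale/=.
  by rewrite exprVn; ring.
- apply: (@near_eq_is_derive R R R (cst 0)).
    near=> s; rewrite /flat ifF//; apply/negbTE; rewrite -leNgt ltW//.
    by near: s; exact: lt_nbhsl.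
  by rewrite /flat ltNge (ltW t0)/=; exact: is_derive_cst.
- have [M HM] := flat_le_sqr p.
  have flat0 q : flat q 0 = 0 by rewrite /flat ltxx.
  have M0 : 0 <= M by have := HM 1; rewrite expr1n mulr1; exact: le_trans.
  have lim0 : h^-1 *: (flat p (h *: 1 + 0) - flat p 0) @[h --> 0^'] --> (0 : R).
    apply: norm_cvg0.
    apply: (@squeeze_cvgr _ _ _ _ (cst 0) (fun h : R => M * `|h|)).
    - near=> h; rewrite /= normr_ge0/= flat0 subr0 addr0 normrM normfV.
      have h0 : h != 0 by near: h; exact: nbhs_dnbhs_neq.
      rewrite ler_pdivrMl ?normr_gt0// mulrCA -expr2 real_normK ?num_real//.
      by rewrite [_ *: _]mulr1; exact: HM.
    - exact: cvg_cst.
    - rewrite -[X in _ --> X](mulr0 M); apply: cvgMr.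
      rewrite -[X in _ --> X](@normr0 _ R); apply: cvg_norm.
      exact: cvg_within.
  rewrite flat0; apply: DeriveDef; first by apply/cvg_ex; exists 0.
  exact/cvg_lim.
Unshelve. all: by end_near. Qed.

Lemma continuous_flat p : continuous (flat p).
Proof.
move=> t; apply/differentiable_continuous/derivable1_diffP.
by have [] := is_derive_flat p t.
Qed.

Lemma flat1_ge0 t : 0 <= flat 1 t.
Proof. by rewrite /flat; case: ifP; rewrite ?hornerC ?mul1r ?expR_ge0. Qed.

Lemma flat1_le1 t : flat 1 t <= 1.
Proof.
rewrite /flat; case: ifP => // t0; rewrite hornerC mul1r expR_le1.
by rewrite oppr_le0 invr_ge0 ltW.
Qed.

Lemma flat1_le0 t : t <= 0 -> flat 1 t = 0.
Proof. by rewrite /flat leNgt => /negbTE ->. Qed.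

Lemma cvg_flat p (u : R^nat) :
  u @ \oo --> +oo -> (flat p \o u) @ \oo --> p.[0].
Proof.
move=> uoo.
have up : \forall n \near \oo, 0 < u n by move/cvgryPgt : uoo => /(_ 0).
have v0 : (u n)^-1 @[n --> \oo] --> (0 : R) by exact/gtr0_cvgV0.
have h : p.[(u n)^-1] * expR (- (u n)^-1) @[n --> \oo] --> p.[0].
  rewrite -[p.[0]]mulr1 -[X in _ * X]expR0 -[X in expR X]oppr0; apply: cvgM.
    by apply: continuous_cvg => //; exact: continuous_horner.
  by apply: continuous_cvg; [exact: continuous_expR|exact: cvgN].
apply: cvg_trans h; apply: near_eq_cvg; near=> n.
by rewrite /flat /= ifT//; near: n.
Unshelve. all: by end_near. Qed.

Lemma cvg_flat1 (u : R^nat) : u @ \oo --> +oo -> (flat 1 \o u) @ \oo --> (1 : R).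
Proof. by move=> /(cvg_flat (p := 1)); rewrite hornerC. Qed.

End flat_functions.

Section phase_coordinates.
Context (R : realType) (d : nat).
Local Notation V := (phase R d).
Local Notation I := ('I_d + 'I_d)%type.

Definition pcrd (i : I) (z : V) : R :=
  match i with inl j => z.1 ord0 j | inr j => z.2 ord0 j end.

Lemma measurable_pcrd i : measurable_fun setT (pcrd i).
Proof.
case: i => i.
  exact: (measurableT_comp (measurable_rV_coord i) measurable_fst).
exact: (measurableT_comp (measurable_rV_coord i) measurable_snd).
Qed.

Lemma phase_generated (G : set (set V)) : sigma_algebra setT G ->
  (forall i (B : set R), measurable B -> G (pcrd i @^-1` B)) ->
  measurable `<=` G.
Proof.
move=> sG GB; apply: smallest_sub => //.
have [G0 GD GU] := sG.
have H (pr : V -> 'rV[R]_d) : sigma_algebra setT [set A | G (pr @^-1` A)].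
  split => /=.
  - by rewrite preimage_set0.
  - by move=> A GA; rewrite setTD -preimage_setC -setTD; exact: GD.
  - by move=> A GA; rewrite preimage_bigcup; exact: GU.
move=> _ [[A mA <-]|[A mA <-]]; rewrite setTI.
- move: A mA; apply: (@rV_generated R d [set A | G (fst @^-1` A)] (H fst)) => i B mB /=.
  exact: (GB (inl i)).
- move: A mA; apply: (@rV_generated R d [set A | G (snd @^-1` A)] (H snd)) => i B mB /=.
  exact: (GB (inr i)).
Qed.

Lemma measurable_phase_open_boxes :
  @measurable _ V = <<s open_boxes pcrd >>.
Proof. exact: (measurable_open_boxes measurable_pcrd phase_generated). Qed.

Lemma pcrdD i z w : pcrd i (z + w) = pcrd i z + pcrd i w.
Proof. by case: i => i; rewrite /= mxE. Qed.

Lemma pcrdZ i c z : pcrd i (c *: z) = c * pcrd i z.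
Proof. by case: i => i; rewrite /= mxE. Qed.

Lemma continuous_pcrd i : continuous (pcrd i).
Proof.
case: i => i z; rewrite /pcrd.
- exact: (@continuous_comp _ _ _ fst (fun x : 'rV[R]_d => x ord0 i) z
    (@cvg_fst _ _ _ _ _) (@coord_continuous _ _ _ _ _ _)).
- exact: (@continuous_comp _ _ _ snd (fun x : 'rV[R]_d => x ord0 i) z
    (@cvg_snd _ _ _ _ _) (@coord_continuous _ _ _ _ _ _)).
Qed.

Lemma diff_pcrd_subproof i z :
  differentiable (pcrd i) z /\ ('d (pcrd i) z = pcrd i :> (V -> R)).
Proof.
have h : linear (pcrd i) by move=> c x y; rewrite pcrdD pcrdZ.
pose m := GRing.isLinear.Build _ _ _ _ (pcrd i) h.
pose f : {linear V -> R} := HB.pack (pcrd i) m.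
have fE : (f : V -> R) = pcrd i by [].
have cf : continuous f by exact: continuous_pcrd.
rewrite -fE; split; first exact: linear_differentiable.
exact: diff_lin.
Qed.

Lemma differentiable_pcrd i z : differentiable (pcrd i) z.
Proof. exact: (diff_pcrd_subproof i z).1. Qed.

Lemma diff_pcrd i z : 'd (pcrd i) z = pcrd i :> (V -> R).
Proof. exact: (diff_pcrd_subproof i z).2. Qed.

Definition closed_box (a b : I -> R) : set V := [set z | forall i, a i <= pcrd i z <= b i].

Lemma compact_closed_box a b : compact (closed_box a b).
Proof.
rewrite (_ : closed_box a b =
  [set x : 'rV[R]_d | forall i, `[a (inl i), b (inl i)]%classic (x ord0 i)] `*`
  [set x : 'rV[R]_d | forall i, `[a (inr i), b (inr i)]%classic (x ord0 i)]).
  apply: compact_setX.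
    by apply: (@rV_compact R d (fun i => `[a (inl i), b (inl i)]%classic)) => i;
      exact: segment_compact.
  by apply: (@rV_compact R d (fun i => `[a (inr i), b (inr i)]%classic)) => i;
    exact: segment_compact.
apply/seteqP; split => -[x v] /=.
  by move=> h; split=> i /=; rewrite in_itv/=; [exact: (h (inl i))|exact: (h (inr i))].
by move=> [h1 h2] [i|i] /=; [have := h1 i|have := h2 i]; rewrite /= in_itv.
Qed.

Lemma measurable_closed_box a b : measurable (closed_box a b).
Proof.
rewrite [X in measurable X](_ : _ =
    \big[setI/setT]_(i : I) (pcrd i @^-1` `[a i, b i])).
  apply: bigsetI_measurable => i _.
  by rewrite -[X in measurable X]setTI; exact: measurable_pcrd.
rewrite -bigcap_seq; apply/seteqP; split=> z /= H i.
  by move=> _; rewrite /= in_itv/=; exact: H.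
by have := H i (mem_index_enum i); rewrite /= in_itv.
Qed.

End phase_coordinates.

Section test_algebra.
Context (R : realType) (d : nat).
Local Notation V := (phase R d).
Local Notation I := ('I_d + 'I_d)%type.

(* An algebra of functions closed under directional derivatives, so that
   smoothness holds by induction and not by computing iterated derivatives. *)
Inductive test_alg : (V -> R) -> Prop :=
| test_cst c : test_alg (fun=> c)
| test_flat p (k c : R) i : test_alg (fun z => flat p (k * pcrd i z + c))
| test_add phi psi : test_alg phi -> test_alg psi -> test_alg (fun z => phi z + psi z)
| test_mul phi psi : test_alg phi -> test_alg psi -> test_alg (fun z => phi z * psi z).

Lemma test_algZ c phi : test_alg phi -> test_alg (fun z => c * phi z).
Proof. by apply: test_mul; exact: test_cst. Qed.

Lemma test_alg_prod (J : Type) (s : seq J) (phi : J -> V -> R) :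
  (forall j, test_alg (phi j)) -> test_alg (fun z => \prod_(j <- s) phi j z).
Proof.
move=> tphi; elim: s => [|j s IH].
  by under eq_fun do rewrite big_nil; exact: test_cst.
by under eq_fun do rewrite big_cons; exact: test_mul.
Qed.

Lemma test_alg_translate phi w : test_alg phi -> test_alg (fun z => phi (z + w)).
Proof.
elim=> [c|p k c i|f g _ IHf _ IHg|f g _ IHf _ IHg].
- exact: test_cst.
- rewrite (_ : (fun z => _) = (fun z => flat p (k * pcrd i z + (k * pcrd i w + c)))).
    exact: test_flat.
  by apply/funext => z; rewrite pcrdD mulrDr addrA.
- exact: test_add.
- exact: test_mul.
Qed.

Lemma measurable_test_alg phi : test_alg phi -> measurable_fun setT phi.
Proof.
elim=> [c|p k c i|f g _ IHf _ IHg|f g _ IHf _ IHg].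
- exact: measurable_cst.
- have m1 : measurable_fun setT (fun z : V => k * pcrd i z + c).
    apply: measurable_funD => //; apply: measurable_funM => //.
    exact: measurable_pcrd.
  exact: (measurableT_comp (continuous_measurable_fun (@continuous_flat R p)) m1).
- exact: measurable_funD.
- exact: measurable_funM.
Qed.

Lemma bounded_test_alg phi a b : test_alg phi ->
  exists2 M : R, 0 <= M & forall z, closed_box a b z -> `|phi z| <= M.
Proof.
elim=> [c|p k c i|f g _ [M M0 HM] _ [N N0 HN]|f g _ [M M0 HM] _ [N N0 HN]].
- by exists `|c|.
- have [M HM] := flat_bounded p; exists M => [|z _]; last exact: HM.
  exact: le_trans (HM 0).
- exists (M + N) => [|z az]; first exact: addr_ge0.
  by apply: le_trans (ler_normD _ _) _; rewrite lerD ?HM ?HN.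
- exists (M * N) => [|z az]; first exact: mulr_ge0.
  by rewrite normrM ler_pM ?HM ?HN.
Qed.

Lemma test_alg_diff phi : test_alg phi ->
  (forall z, differentiable (phi : V -> R^o) z) /\
  (forall e, test_alg (fun z => 'D_e (phi : V -> R^o) z)).
Proof.
elim=> [c|p k c i|f g tf [df tDf] tg [dg tDg]|f g tf [df tDf] tg [dg tDg]].
- split=> [z|e]; first exact: differentiable_cst.
  rewrite [X in test_alg X](_ : _ = (fun=> 0)); first exact: test_cst.
  by apply/funext => z; exact: derive_cst.
- pose ell (z : V) : R := k * pcrd i z + c.
  have dell z : differentiable ell z.
    apply: differentiableD; last exact: differentiable_cst.
    apply: differentiableM; first exact: differentiable_cst.
    exact: differentiable_pcrd.
  have dp t : differentiable (flat p) t.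
    by apply/derivable1_diffP; have [] := is_derive_flat p t.
  have dphi z : differentiable (flat p \o ell) z by exact: differentiable_comp.
  split=> // e.
  rewrite [X in test_alg X](_ : _ =
      (fun z => (k * pcrd i e) * flat (flat_deriv p) (k * pcrd i z + c))).
    by apply: test_algZ; exact: test_flat.
  apply/funext => z; rewrite (_ : (fun z : V => _) = flat p \o ell)//.
  rewrite deriveE// diff_comp//= diff1E//= derive1E.
  have [_ ->] := is_derive_flat p (ell z).
  congr (_ * _); rewrite -deriveE// /ell.
  have dpc : derivable (pcrd i) z e by apply: diff_derivable; exact: differentiable_pcrd.
  rewrite deriveD//; last first.
    by apply: derivableM => //; exact: derivable_cst.
  rewrite derive_cst addr0 deriveM// derive_cst scaler0 addr0.
  by rewrite deriveE ?diff_pcrd//; exact: differentiable_pcrd.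
- split=> [z|e]; first exact: differentiableD.
  rewrite [X in test_alg X](_ : _ = (fun z => 'D_e (f : V -> R^o) z + 'D_e (g : V -> R^o) z)).
    exact: test_add.
  by apply/funext => z; rewrite deriveD//; exact: diff_derivable.
- split=> [z|e]; first exact: differentiableM.
  rewrite [X in test_alg X](_ : _ =
      (fun z => f z * 'D_e (g : V -> R^o) z + g z * 'D_e (f : V -> R^o) z)).
    by apply: test_add; apply: test_mul.
  by apply/funext => z; rewrite deriveM//; exact: diff_derivable.
Qed.

Lemma smooth_test_alg phi : test_alg phi -> smooth (phi : V -> R^o).
Proof.
move=> tphi s z.
have : test_alg (foldr (fun e (g : V -> R^o) => 'D_e g) (phi : V -> R^o) s).
  by elim: s => //= e s /test_alg_diff[_]; exact.
by move=> /test_alg_diff[].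
Qed.

(** The box is kept explicit so that translates and successive approximations share one compact set,
    namely a closed box containing their supports. *)
Definition test_in (a b : I -> R) (phi : V -> R) : Prop :=
  test_alg phi /\ forall z, ~ open_box (@pcrd R d) a b z -> phi z = 0.

Lemma test_in_subclosed a b phi : test_in a b phi ->
  forall z, ~ closed_box a b z -> phi z = 0.
Proof.
move=> [_ h] z az; apply: h; apply: contra_not az => h i.
by have /andP[? ?] := h i; rewrite !ltW.
Qed.

Lemma test_function_in a b phi : test_in a b phi -> test_function (phi : V -> R^o).
Proof.
move=> tphi; split; first exact: smooth_test_alg tphi.1.
have cB : compact (closed_box a b) by exact: compact_closed_box.
apply: (subclosed_compact _ cB); first exact: closed_closure.
have clB : closed (closed_box a b).
  by apply: compact_closed cB; exact: norm_hausdorff.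
rewrite [X in _ `<=` X](closure_id (closed_box a b)).1//.
apply: closureS => z /= phiz.
by apply: contrapT => /(test_in_subclosed tphi); exact/eqP.
Qed.

Lemma test_in_derive0 a b phi e z : test_in a b phi -> ~ closed_box a b z ->
  'D_e (phi : V -> R^o) z = 0.
Proof.
move=> tphi az.
have cB : compact (closed_box a b) by exact: compact_closed_box.
have clB : closed (closed_box a b).
  by apply: compact_closed cB; exact: norm_hausdorff.
rewrite -(derive_cst (0 : R^o) z e); apply: near_eq_derive.
have : nbhs z (~` closed_box a b) by apply: open_nbhs_nbhs; split=> //; exact: closed_openC.
by apply: filterS => z' /(test_in_subclosed tphi).
Qed.

End test_algebra.

Section box_bump.
Context (R : realType) (d : nat).
Local Notation V := (phase R d).
Local Notation I := ('I_d + 'I_d)%type.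
Implicit Types (k a b : I -> R) (z : V).

(** [k] is a steepness. With fixed ends and large [k] the factor tends to the indicator of the
    interval; with [k = 1] and receding ends it tends to 1 with small derivatives. *)
Definition bump_factor k a b i z : R :=
  flat 1 (k i * (pcrd i z - a i)) * flat 1 (k i * (b i - pcrd i z)).

Definition box_bump k a b z : R := \prod_(i : I) bump_factor k a b i z.

Lemma test_alg_bump_factor k a b i : test_alg (bump_factor k a b i).
Proof.
apply: test_mul.
- rewrite [X in test_alg X](_ : _ = (fun z => flat 1 (k i * pcrd i z + - (k i * a i)))).
    exact: test_flat.
  by apply/funext => z; congr flat; ring.
- rewrite [X in test_alg X](_ : _ = (fun z => flat 1 (- k i * pcrd i z + (k i * b i)))).
    exact: test_flat.
  by apply/funext => z; congr flat; ring.
Qed.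

Lemma bump_factor_eq0 k a b i z : 0 < k i ->
  ~~ (a i < pcrd i z < b i) -> bump_factor k a b i z = 0.
Proof.
rewrite /bump_factor negb_and -!leNgt => k0 /orP[zi|zi].
  by rewrite flat1_le0 ?mul0r// mulr_ge0_le0// ?subr_le0// ltW.
by rewrite [X in _ * X]flat1_le0 ?mulr0// mulr_ge0_le0// ?subr_le0// ltW.
Qed.

Lemma bump_factor_itv k a b i z : 0 <= bump_factor k a b i z <= 1.
Proof.
by rewrite mulr_ge0 ?flat1_ge0//= mulr_ile1 ?flat1_ge0 ?flat1_le1.
Qed.

Lemma bump_itv k a b z : 0 <= box_bump k a b z <= 1.
Proof.
rewrite prodr_ge0/=; last by move=> i _; case/andP: (bump_factor_itv k a b i z).
rewrite -[leRHS](@big1_eq _ 1 *%R I (index_enum I) xpredT).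
by apply: ler_prod => i _; exact: bump_factor_itv.
Qed.

Lemma test_in_bump k a b : (forall i, 0 < k i) -> test_in a b (box_bump k a b).
Proof.
move=> k0; split; first by apply: test_alg_prod => i; exact: test_alg_bump_factor.
move=> z /existsNP[i /negP zi].
by rewrite /box_bump (bigD1 i)//= bump_factor_eq0// mul0r.
Qed.

Lemma cvg_bump (k a b : nat -> I -> R) z :
  (forall i, k n i * (pcrd i z - a n i) @[n --> \oo] --> +oo) ->
  (forall i, k n i * (b n i - pcrd i z) @[n --> \oo] --> +oo) ->
  box_bump (k n) (a n) (b n) z @[n --> \oo] --> (1 : R).
Proof.
move=> ha hb; rewrite /box_bump; elim: (index_enum _) => [|i s IH].
  by under eq_fun do rewrite big_nil; exact: cvg_cst.
under eq_fun do rewrite big_cons.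
have h := cvgM (cvgM (cvg_flat1 (ha i)) (cvg_flat1 (hb i))) IH.
rewrite !mulr1 in h; exact: h.
Qed.

Lemma cvg_bump_box a b z :
  box_bump (fun=> n.+1%:R) a b z @[n --> \oo] --> (\1_(open_box (@pcrd R d) a b) z : R).
Proof.
rewrite indicE; case: (asboolP (open_box (@pcrd R d) a b z)) => zab; last first.
  rewrite memNset//=.
  rewrite (_ : (fun n => _) = cst 0); first exact: cvg_cst.
  apply/funext => n /=.
  by have [_] := @test_in_bump (fun=> n.+1%:R) a b (fun=> ltr0Sn _ _); exact.
rewrite mem_set//=.
have h (x : R) : 0 < x -> n.+1%:R * x @[n --> \oo] --> +oo.
  move=> x0; apply/cvgryPge => A; near=> n; rewrite -ler_pdivrMr//.
  apply: (@le_trans _ _ n%:R); last by rewrite ler_nat.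
  by near: n; exact: nbhs_infty_ger.
apply: (@cvg_bump (fun n _ => n.+1%:R) (fun=> a) (fun=> b)) => i; apply: h;
  by have /andP[? ?] := zab i; rewrite subr_gt0.
Unshelve. all: by end_near. Qed.

End box_bump.

(** * Approximation of indicators by test functions in weighted L^1 *)

Section density.
Context (R : realType) (d : nat).
Local Notation V := (phase R d).
Local Notation lebV := (prod_measure (@lebesgue_rV R d) (@lebesgue_rV R d)).
Local Notation I := ('I_d + 'I_d)%type.
Variables (W : V -> R) (N : nat).
Hypotheses (iW : lebV.-integrable setT (EFin \o W)) (W0 : forall z, 0 <= W z).

Let mW : measurable_fun setT W.
Proof. by have /integrableP[/measurable_EFinP] := iW. Qed.

Let Q : set V := cube (@pcrd R d) N.

Let mQ : measurable Q.
Proof. exact: (measurable_open_box (@measurable_pcrd R d)). Qed.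

Let dist (u v : V -> R) : \bar R := (\int[lebV]_z (W z * `|u z - v z|)%:E)%E.

Let mdist (u v : V -> R) : measurable_fun setT u -> measurable_fun setT v ->
  measurable_fun setT (fun z => (W z * `|u z - v z|)%:E).
Proof.
move=> mu mv; apply/measurable_EFinP; apply: measurable_funM => //.
by apply: measurableT_comp => //; exact: measurable_funB.
Qed.

Let dist_triangle (u v w : V -> R) : measurable_fun setT u -> measurable_fun setT v ->
  measurable_fun setT w -> (dist u w <= dist u v + dist v w)%E.
Proof.
move=> mu mv mw; rewrite /dist -ge0_integralD//; last 4 first.
- by move=> z _; rewrite lee_fin mulr_ge0.
- exact: mdist.
- by move=> z _; rewrite lee_fin mulr_ge0.
- exact: mdist.
apply: ge0_le_integral => //.
- by move=> z _; rewrite lee_fin mulr_ge0.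
- exact: mdist.
- by apply: emeasurable_funD; exact: mdist.
- move=> z _; rewrite -EFinD lee_fin -mulrDr ler_wpM2l//.
  by apply: le_trans (ler_normD _ _); rewrite addrA subrK.
Qed.

Let dist_approx (u_ : nat -> V -> R) (u : V -> R) (c : R) :
  (forall n, measurable_fun setT (u_ n)) ->
  (forall z, u_ n z @[n --> \oo] --> u z) -> (forall n z, `|u_ n z| <= c) ->
  forall e, 0 < e -> exists n, (dist u (u_ n) <= e%:E)%E.
Proof.
move=> mu_ cu uc e e0.
have mu : measurable_fun setT u.
  by apply: (measurable_fun_cvg mu_) => z _; exact: cu.
have uc' z : `|u z| <= c.
  have h : `|u_ n z| @[n --> \oo] --> `|u z| by exact: cvg_norm.
  apply: (cvgr_to_le h).
  by apply: nearW => n; exact: uc.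
have [] := @dominated_convergence _ _ _ lebV setT measurableT
  (fun n z => (W z * `|u z - u_ n z|)%:E) (cst 0%E) (fun z => (W z * (c + c))%:E).
- by move=> n; exact: mdist.
- exact: measurable_cst.
- apply: aeW => z _; apply: cvg_EFin; first exact: nearW.
  have h := cvgM (cvg_cst (W z)) (cvg_norm (cvgB (cvg_cst (u z)) (cu z))).
  rewrite subrr normr0 mulr0 in h; exact: h.
- under eq_fun do rewrite mulrC EFinM.
  exact: integrableZl.
- apply: aeW => z n _; rewrite lee_fin ger0_norm ?mulr_ge0// ler_wpM2l//.
  by apply: le_trans (ler_normB _ _) _; rewrite lerD.
move=> _ _; rewrite integral0 => h.
have := h; move=> /fine_cvgP[h1 /cvgrPdist_le/(_ _ e0) h2].
have [n [hn1 hn2]] : exists n, dist u (u_ n) \is a fin_num /\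
    `|0 - fine (dist u (u_ n))| <= e.
  by have [n] := filter_ex (filterI h1 h2); exists n.
exists n; rewrite -(fineK hn1) lee_fin.
by apply: le_trans hn2; rewrite sub0r normrN ler_norm.
Qed.

Let good (A : set V) := forall e, 0 < e -> exists2 phi,
  test_in (fun=> - N%:R) (fun=> N%:R) phi & (dist \1_(A `&` Q) phi <= e%:E)%E.

Let mtest (phi : V -> R) (a b : I -> R) : test_in a b phi -> measurable_fun setT phi.
Proof. by move=> [/measurable_test_alg]. Qed.

Let good_box a b : good (open_box (@pcrd R d) a b).
Proof.
move=> e e0.
have /= [p' _ E] : open_boxes (@pcrd R d) (open_box (@pcrd R d) a b `&` Q).
  apply: setI_closed_open_boxes; first by exists (a, b).
  by exists (fun=> - N%:R, fun=> N%:R).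
rewrite -E.
pose u_ n := box_bump (fun=> n.+1%:R) p'.1 p'.2.
have tin n : test_in p'.1 p'.2 (u_ n) by exact: test_in_bump.
have u1 n z : `|u_ n z| <= 1.
  by have /andP[h1 h2] := bump_itv (fun=> n.+1%:R) p'.1 p'.2 z; rewrite ger0_norm.
have [n hn] := @dist_approx u_ (\1_(open_box (@pcrd R d) p'.1 p'.2)) 1
  (fun n => mtest (tin n)) (@cvg_bump_box _ _ _ _) u1 e e0.
exists (u_ n) => //; split; first exact: (tin n).1.
move=> z zQ; apply: (tin n).2; rewrite E; apply: contra_not zQ; by case.
Qed.

Let test_in_lin a b (phi psi : V -> R) c : test_in a b phi -> test_in a b psi ->
  test_in a b (fun z => phi z + c * psi z).
Proof.
move=> [t1 h1] [t2 h2]; split; first by apply: test_add => //; exact: test_algZ.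
by move=> z az; rewrite h1// h2// mulr0 addr0.
Qed.

Let good_lin (A B C : set V) c : measurable A -> measurable B -> measurable C ->
  `|c| <= 1 ->
  (forall z, \1_(A `&` Q) z = \1_(B `&` Q) z + c * \1_(C `&` Q) z :> R) ->
  good B -> good C -> good A.
Proof.
move=> mA mB mC c1 E gB gC e e0; have e20 : 0 < e / 2 by rewrite divr_gt0.
have [p1 t1 d1] := gB _ e20; have [p2 t2 d2] := gC _ e20.
exists (fun z => p1 z + c * p2 z); first exact: test_in_lin.
have mI (D : set V) : measurable D -> measurable_fun setT (\1_(D `&` Q) : V -> R).
  by move=> mD; apply: measurable_indic; exact: measurableI.
rewrite [e]splitr EFinD; apply: le_trans (leeD d1 d2).
rewrite /dist -ge0_integralD//; last 4 first.
- by move=> z _; rewrite lee_fin mulr_ge0.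
- by apply: mdist; [exact: mI|exact: mtest t1].
- by move=> z _; rewrite lee_fin mulr_ge0.
- by apply: mdist; [exact: mI|exact: mtest t2].
apply: ge0_le_integral => //.
- by move=> z _; rewrite lee_fin mulr_ge0.
- by apply: mdist; [exact: mI|exact: mtest (test_in_lin c t1 t2)].
- by apply: emeasurable_funD; apply: mdist; [exact: mI|exact: mtest t1|exact: mI|exact: mtest t2].
- move=> z _; rewrite -EFinD lee_fin -mulrDr ler_wpM2l// E opprD addrACA -mulrBr.
  apply: le_trans (ler_normD _ _) _; rewrite lerD2l normrM.
  by rewrite ler_piMl.
Qed.

Let good_bigcup (F : (set V)^nat) : (forall n, measurable (F n)) ->
  {homo F : m n / (m <= n)%N >-> m `<=` n} ->
  (forall n, good (F n)) -> good (\bigcup_n F n).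
Proof.
move=> mF ndF gF e e0; have e20 : 0 < e / 2 by rewrite divr_gt0.
have mI (D : set V) : measurable D -> measurable_fun setT (\1_(D `&` Q) : V -> R).
  by move=> mD; apply: measurable_indic; exact: measurableI.
have cF z : \1_(F n `&` Q) z @[n --> \oo] --> (\1_((\bigcup_n F n) `&` Q) z : R).
  case: (pselect (((\bigcup_n F n) `&` Q) z)) => [[[n _ Fnz] Qz]|h].
    rewrite [X in _ --> X](_ : _ = 1); last by rewrite indicE mem_set//; split => //; exists n.
    apply: cvg_near_cst; exists n => // m /= nm; rewrite indicE mem_set//; split => //.
    exact: ndF nm _ Fnz.
  rewrite [X in _ --> X](_ : _ = 0); last by rewrite indicE memNset.
  apply: cvg_near_cst; apply: nearW => n; rewrite indicE memNset//.
  by move=> [Fnz Qz]; apply: h; split => //; exists n.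
have b1 n z : `|\1_(F n `&` Q) z : R| <= 1.
  by rewrite indicE; case: (_ \in _); rewrite ?normr1 ?normr0.
have [n dn] := @dist_approx (fun n => \1_(F n `&` Q)) _ 1 (fun n => mI _ (mF n)) cF
  b1 _ e20.
have [p tp dp] := gF n _ e20.
exists p => //; rewrite [e]splitr EFinD; apply: le_trans (leeD dn dp).
apply: dist_triangle; [|exact: mI|exact: mtest tp].
by apply: mI; exact: bigcupT_measurable.
Qed.

(** Boxes are reached by steep bumps, all measurable sets by a pi-lambda argument. The weight [W]
    will be the sum of several functions, so that a single test function approximates well against
    all of them at once. *)
Lemma test_in_dense (A : set V) : measurable A -> forall e : R, 0 < e ->
  exists2 phi, test_in (fun=> - N%:R) (fun=> N%:R) phi &
    (\int[lebV]_z (W z * `|\1_(A `&` cube (@pcrd R d) N) z - phi z|)%:E <= e%:E)%E.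
Proof.
move=> mA; suff : good A by []; have : <<s open_boxes (@pcrd R d) >> A by rewrite -measurable_phase_open_boxes.
have goodT : good setT.
  by rewrite (_ : good setT = good Q); [exact: good_box|rewrite /good setTI setIid].
have goodC B : measurable B -> good B -> good (~` B).
  move=> mB; apply: (good_lin (c := -1)) goodT => //; first exact: measurableC.
    by rewrite normrN normr1.
  move=> z; rewrite !indicE !in_setI in_setT in_setC.
  by case: (z \in B); case: (z \in Q); rewrite ?mulN1r ?subr0 ?subrr.
apply: dynkin_induction => //.
- exact: measurable_phase_open_boxes.
- exact: setI_closed_open_boxes.
- by move=> _ [[a b] _ <-]; exact: good_box.
move=> F mF tF gF.
rewrite -bigcup_bigsetU_bigcup; apply: good_bigcup.
- by move=> n; apply: bigsetU_measurable => i _; exact: mF.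
- by move=> m n mn; exact: subset_bigsetU.
elim=> [|n IH].
  by rewrite big_ord1.
rewrite big_ord_recr/=; apply: (good_lin (c := 1)) IH (gF n.+1) => //.
- by apply: measurableU => //; apply: bigsetU_measurable => i _; exact: mF.
- by apply: bigsetU_measurable => i _; exact: mF.
- by rewrite normr1.
move=> z; rewrite !indicE !in_setI in_setU mul1r.
have h : (z \in \big[setU/set0]_(i < n.+1) F i) -> (z \in F n.+1) -> False.
  rewrite !inE => + Fnz; rewrite -bigcup_mkord => -[m /= mn Fmz].
  have := tF m n.+1 Logic.I Logic.I (ex_intro _ z (conj Fmz Fnz)) => mnE.
  by rewrite mnE ltnn in mn.
case: (z \in \big[setU/set0]_(i < n.+1) F i) h; case: (z \in F n.+1); case: (z \in Q) => //=;
  rewrite ?addr0 ?add0r// => h; by have := h isT isT.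
Qed.

End density.

Section local_integrability.
Context (R : realType) (d : nat).
Local Notation V := (phase R d).
Local Notation lebV := (prod_measure (@lebesgue_rV R d) (@lebesgue_rV R d)).
Local Notation I := ('I_d + 'I_d)%type.

Lemma Lploc1_integrable (u : V -> R) (a b : I -> R) : Lploc 1 u ->
  lebV.-integrable setT (EFin \o (u \* \1_(closed_box a b))).
Proof.
by move=> /(_ _ (@compact_closed_box R d a b)) /Lfun1_integrable.
Qed.

(** Restrictions to growing closed boxes are measurable by local integrability and converge
    pointwise. *)
Lemma measurable_Lploc1 (u : V -> R) : Lploc 1 u -> measurable_fun setT u.
Proof.
move=> hu.
pose u_ n := u \* \1_(closed_box (fun=> - n%:R) (fun=> n%:R) : set V).
apply: (@measurable_fun_cvg _ _ _ _ u_ u) => [n|z _].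
  by have /integrableP[/measurable_EFinP] := Lploc1_integrable (fun=> - n%:R) (fun=> n%:R) hu.
have [N _ HN] : (\bigcup_n cube (@pcrd R d) n) z by rewrite bigcup_cube.
apply: cvg_near_cst; exists N => // n /= Nn.
rewrite /u_ /= indicE mem_set ?mulr1// => i.
have /andP[h1 h2] := nd_cube Nn HN i.
by rewrite !ltW.
Qed.

Lemma Lplocy_bounded (u : V -> R) (a b : I -> R) : Lploc +oo u ->
  exists2 C : R, 0 <= C & {ae lebV, forall z, closed_box a b z -> `|u z| <= C}.
Proof.
move=> /(_ _ (@compact_closed_box R d a b)).
rewrite inE => /andP[_]; rewrite inE /= /finite_norm unlock /=.
(* On a space of measure 0 the L^oo norm is 0 by convention and says nothing about the function, but
   every bound then holds almost everywhere. *)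
case: ifPn => [muT|muT] h; last first.
  exists 0 => //; exists setT; split => //.
  by apply/eqP; rewrite eq_le measure_ge0 andbT leNgt.
have [C HC] := ess_supr_bounded h.
exists `|C| => //; apply: filterS HC => z /= Cz cz.
by move: Cz; rewrite indicE mem_set// mulr1 => /le_trans; apply; exact: ler_norm.
Qed.

Lemma test_in_translate a b (phi : V -> R) w : test_in a b phi ->
  test_in (fun i => a i - pcrd i w) (fun i => b i - pcrd i w) (fun z => phi (z + w)).
Proof.
move=> [t h]; split; first exact: test_alg_translate.
move=> z zab; apply: h; apply: contra_not zab => h i.
by have /andP[h1 h2] := h i; rewrite ltrBlDr ltrBrDr -pcrdD h1.
Qed.

Lemma test_in_widen a b a' b' (phi : V -> R) : (forall i, a' i <= a i) ->
  (forall i, b i <= b' i) -> test_in a b phi -> test_in a' b' phi.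
Proof.
move=> aa bb [t h]; split=> // z zab; apply: h; apply: contra_not zab => h i.
have /andP[h1 h2] := h i.
by rewrite (le_lt_trans (aa i))// (lt_le_trans h2).
Qed.

Lemma test_in_bounded a b (phi : V -> R) : test_in a b phi ->
  exists2 M : R, 0 <= M & forall z, `|phi z| <= M.
Proof.
move=> tphi; have [M M0 HM] := bounded_test_alg a b tphi.1; exists M => // z.
have [zab|zab] := pselect (closed_box a b z); first exact: HM.
by rewrite (test_in_subclosed tphi)// normr0.
Qed.

Lemma integrable_mul_bounded (u psi : V -> R) (a b : I -> R) (M : R) :
  lebV.-integrable setT (EFin \o (u \* \1_(closed_box a b))) ->
  measurable_fun setT psi -> (forall z, `|psi z| <= M) ->
  (forall z, ~ closed_box a b z -> psi z = 0) ->
  lebV.-integrable setT (EFin \o (u \* psi)).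
Proof.
move=> hu mpsi HM h0.
rewrite (_ : _ \o _ =
    fun z => ((EFin \o (u \* \1_(closed_box a b))%R) z * (EFin \o psi) z)%E).
  apply: integrableMl => //.
  by exists M; split; [exact: num_real|move=> x Mx z _ /=; rewrite (le_trans (HM z))// ltW].
apply/funext => z /=; rewrite -EFinM indicE.
have [zab|zab] := pselect (closed_box a b z); first by rewrite mem_set// mulr1.
by rewrite h0// !mulr0.
Qed.

Lemma integrable_mul_test (u : V -> R) a b (phi : V -> R) : Lploc 1 u ->
  test_in a b phi -> lebV.-integrable setT (EFin \o (u \* phi)).
Proof.
move=> hu tphi; have [M M0 HM] := test_in_bounded tphi.
apply: (integrable_mul_bounded (Lploc1_integrable a b hu) _ HM (test_in_subclosed tphi)).
exact: measurable_test_alg tphi.1.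
Qed.

Lemma integrable_mul_derive (u : V -> R) a b (phi : V -> R) (e : V) : Lploc 1 u ->
  test_in a b phi ->
  lebV.-integrable setT (EFin \o (u \* (fun z => 'D_e (phi : V -> R^o) z))).
Proof.
move=> hu tphi; have Dphi := (test_alg_diff tphi.1).2 e.
have [M M0 HM] := bounded_test_alg a b Dphi.
apply: (@integrable_mul_bounded _ _ a b M (Lploc1_integrable a b hu)); first exact: measurable_test_alg.
  move=> z; have [zab|zab] := pselect (closed_box a b z); first exact: HM.
  by rewrite (test_in_derive0 _ tphi)// normr0.
by move=> z; exact: test_in_derive0.
Qed.

Lemma lebV_closed_box_lty (a b : I -> R) : (lebV (closed_box a b) < +oo)%E.
Proof.
pose A pr := [set x : 'rV[R]_d | forall i, [set` `[a (pr i), b (pr i)]] (x ord0 i)].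
have mA pr : measurable (A pr).
  rewrite [X in measurable X](_ : _ =
      \big[setI/setT]_(i < d) (@rV_coord _ R d i @^-1` [set` `[a (pr i), b (pr i)]])).
    apply: bigsetI_measurable => i _.
    by rewrite -[X in measurable X]setTI; exact: measurable_rV_coord.
  rewrite -bigcap_seq; apply/seteqP; split=> x /= H i; first by move=> _; exact: H.
  exact: (H i (mem_index_enum i)).
have Aoo pr : (lebesgue_rV (A pr) < +oo)%E.
  rewrite (@lebesgue_rV_box R d (fun i => [set` `[a (pr i), b (pr i)]]))//.
  apply: (proj2 (andP (_ : (0 <= _ < +oo)%E))).
  apply: (big_ind (fun x : \bar R => is_true (0 <= x < +oo)%E)) => [|x y|i _].
  - by rewrite lee01 ltry.
  - by move=> /andP[x0 xoo] /andP[y0 yoo]; rewrite mule_ge0//= lte_mul_pinfty// ge0_fin_numE.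
  - rewrite measure_ge0/= lebesgue_measure_itv/=; case: ifP => _; last exact: ltry.
    by rewrite -EFinD ltry.
rewrite (_ : closed_box a b = A inl `*` A inr).
  rewrite /prod_measure product_measure1E//; apply: lte_mul_pinfty.
  - exact: measure_ge0.
  - by rewrite ge0_fin_numE ?measure_ge0 ?Aoo.
  - exact: Aoo.
apply/seteqP; split => -[x v] /=.
  by move=> h; split=> i /=; rewrite in_itv/=; [exact: (h (inl i))|exact: (h (inr i))].
by move=> [h1 h2] [i|i] /=; [have := h1 i|have := h2 i]; rewrite /= in_itv.
Qed.

Lemma integrable_indic_closed_box (a b : I -> R) :
  lebV.-integrable setT (EFin \o (cst 1 \* \1_(closed_box a b))).
Proof.
rewrite (_ : _ \o _ = EFin \o \1_(closed_box a b)); last first.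
  by apply/funext => z /=; rewrite mul1r.
apply/integrableP; split.
  by apply/measurable_EFinP; apply: measurable_indic; exact: measurable_closed_box.
under eq_integral do rewrite /= ger0_norm//.
rewrite integral_indic//; last exact: measurable_closed_box.
by rewrite setIT; exact: lebV_closed_box_lty.
Qed.

End local_integrability.

Section translated_pairing.
Context (R : realType) (d : nat).
Local Notation V := (phase R d).
Local Notation lebV := (prod_measure (@lebesgue_rV R d) (@lebesgue_rV R d)).
Local Notation I := ('I_d + 'I_d)%type.

(* The derivative in s of [pairing u phi e s] is [pairing g phi e s] when g is the
   weak derivative of u along e: Taylor's formula in s needs no regularity of u
   beyond its weak derivatives. *)
Definition pairing (u phi : V -> R) (e : V) (s : R) : R :=
  \int[lebV]_z (u z * phi (z - s *: e)).

Lemma test_in_line a b (phi : V -> R) (e : V) (s r : R) : test_in a b phi -> `|s| <= r ->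
  test_in (fun i => a i - r * `|pcrd i e|) (fun i => b i + r * `|pcrd i e|)
    (fun z => phi (z - s *: e)).
Proof.
move=> tphi sr.
have h i : `|s * pcrd i e| <= r * `|pcrd i e| by rewrite normrM ler_wpM2r.
have pN i : pcrd i (- (s *: e)) = - (s * pcrd i e).
  by rewrite -scaleNr pcrdZ mulNr.
apply: test_in_widen (test_in_translate (- (s *: e)) tphi) => i; rewrite pN opprK;
  have := h i; rewrite ler_norml => /andP[]; lra.
Qed.

Lemma is_derive_line (phi : V -> R) (e z : V) (s : R) : test_alg phi ->
  is_derive s 1 (fun s : R => phi (z - s *: e)) (- 'D_e (phi : V -> R^o) (z - s *: e)).
Proof.
move=> /test_alg_diff[dphi _].
have dz := dphi (z - s *: e).
have E : (fun h : R => h^-1 *: (phi (z - (h *: 1 + s) *: e) - phi (z - s *: e))) =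
         (fun h => h^-1 *: (phi (h *: (- e) + (z - s *: e)) - phi (z - s *: e))).
  apply/funext => h; congr (_ *: (phi _ - _)).
  by rewrite [h *: 1]mulr1 scalerDl scalerN opprD addrCA addrA.
have D : derivable (phi : V -> R^o) (z - s *: e) (- e) by exact: diff_derivable.
have DN : 'D_(- e) (phi : V -> R^o) (z - s *: e) = - 'D_e (phi : V -> R^o) (z - s *: e).
  by rewrite !deriveE// linearN.
split; first by rewrite /derivable E.
by rewrite /derive E -DN.
Qed.

Lemma derive_translate (phi : V -> R^o) (e z w : V) :
  'D_e (fun z : V => phi (z + w)) z = 'D_e phi (z + w).
Proof.
rewrite /derive; set F := fun h : R => _; set F' := fun h : R => _.
by have -> : F = F' by apply/funext => h; rewrite /F /F' /= addrA.
Qed.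

(** Differentiation under the integral puts the derivative on [phi], and the weak derivative moves
    it to [u]; the two signs cancel. For |s - s0| < 1 all translates live in one enlarged box, which
    supplies the dominating function. *)
Lemma is_derive_pairing (u g : V -> R) (e : V) (a b : I -> R) (phi : V -> R) (s0 : R) :
  weak_derivative e u g -> test_in a b phi ->
  is_derive s0 1 (pairing u phi e) (pairing g phi e s0).
Proof.
move=> [hu hg hug] tphi.
pose F (s : R) (z : V) : R := u z * phi (z - s *: e).
pose r := `|s0| + 1.
pose a' i := a i - r * `|pcrd i e|; pose b' i := b i + r * `|pcrd i e|.
have sr s : s \in `]s0 - 1, s0 + 1[ -> `|s| <= r.
  rewrite in_itv/= => /andP[h1 h2]; rewrite /r.
  have : `|s - s0| <= 1 by rewrite ler_norml; lra.
  by have := ler_normD (s - s0) s0; rewrite subrK; lra.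
have tline s : s \in `]s0 - 1, s0 + 1[ -> test_in a' b' (fun z => phi (z - s *: e)).
  by move=> /sr; exact: test_in_line.
have s0I : s0 \in `]s0 - 1, s0 + 1[ by rewrite in_itv/=; lra.
have Dphi := (test_alg_diff tphi.1).2 e.
have [M M0 HM] := bounded_test_alg a b Dphi.
have dF (s : R) (z : V) : is_derive s 1 (F ^~ z) (u z * - 'D_e (phi : V -> R^o) (z - s *: e)).
  have := is_deriveZ (u z) (is_derive_line e z s tphi.1).
  exact.
have F1 : forall s, s \in `]s0 - 1, s0 + 1[ -> lebV.-integrable setT (EFin \o F s).
  by move=> s /tline; exact: integrable_mul_test.
pose Gb (z : V) : R := `|u z * \1_(closed_box a' b') z| * M.
have d1 (s : R) (z : V) : partial1of2 F s z = u z * - 'D_e (phi : V -> R^o) (z - s *: e).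
  by rewrite partial1of2E; have [_ ->] := dF s z.
have G0 z : 0 <= Gb z by rewrite mulr_ge0.
have iG : lebV.-integrable setT (EFin \o Gb).
  rewrite (_ : _ \o _ = (fun z => M%:E * `|(EFin \o (u \* \1_(closed_box a' b'))%R) z|))%E.
    by apply: integrableZl => //; apply: integrable_abse; exact: Lploc1_integrable.
  by apply/funext => z; rewrite /Gb /= mulrC EFinM.
have HG (s : R) (z : V) : s \in `]s0 - 1, s0 + 1[ -> setT z -> `|partial1of2 F s z| <= Gb z.
  move=> sI _; rewrite d1 /Gb mulrN normrN normrM.
  have [zab|zab] := pselect (closed_box a' b' z); last first.
    suff -> : 'D_e (phi : V -> R^o) (z - s *: e) = 0 by rewrite normr0 mulr0 mulr_ge0.
    apply: (test_in_derive0 _ tphi); apply: contra_not zab => h i.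
    have /andP[h1 h2] := h i.
    have hs : `|s * pcrd i e| <= r * `|pcrd i e| by rewrite normrM ler_wpM2r// sr.
    move: hs h1 h2; rewrite pcrdD -scaleNr pcrdZ mulNr ler_norml /a' /b' => /andP[]; lra.
  rewrite indicE mem_set// mulr1 ler_wpM2l//.
  have [zs|zs] := pselect (closed_box a b (z - s *: e)); first exact: HM.
  by rewrite (test_in_derive0 _ tphi)// normr0.
have dd : forall (s : R) (z : V), (`]s0 - 1, s0 + 1[%classic : set R) s -> setT z ->
    derivable (F ^~ z) s 1.
  by move=> s z _ _; have [] := dF s z.
have key := @derivable_under_integral R _ V lebV F setT measurableT s0 (s0 - 1) (s0 + 1) s0I
  F1 dd Gb G0 iG HG.
have val := @differentiation_under_integral R _ V lebV F setT measurableT s0 (s0 - 1) (s0 + 1) s0I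
  F1 dd Gb G0 iG HG.
apply: DeriveDef; first exact: key.
rewrite -derive1E.
rewrite [LHS]val.
have tf := test_function_in (tline _ s0I).
have := hug _ tf => h.
transitivity (- \int[lebV]_z (u z * 'D_e (fun z => phi (z - s0 *: e) : R^o) z)).
  rewrite -mulN1r -RintegralZl//; last exact: (integrable_mul_derive e hu (tline _ s0I)).
  by apply: eq_Rintegral => z _; rewrite [LHS]d1 derive_translate mulrN mulN1r.
by rewrite h opprK.
Qed.

End translated_pairing.

(** * Vanishing of the gradient on the zero set of the density *)

Section taylor.
Context (R : realType).

Lemma mvt0 (F F1 : R -> R) (h : R) : (forall s : R, is_derive s 1 F (F1 s)) ->
  exists2 c, `|c| <= `|h| & F h - F 0 = F1 c * h.
Proof.
move=> dF.
have cF : continuous F.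
  move=> s; apply/differentiable_continuous/derivable1_diffP.
  by have [] := dF s.
have [h0|h0|<-] := ltgtP 0 h; last by exists 0; rewrite ?subrr ?mulr0.
- have [|c] := @MVT R F F1 0 h h0 (fun s _ => dF s).
    exact: continuous_subspaceT.
  rewrite in_itv/= => /andP[c0 ch] ->; exists c; last by rewrite subr0.
  by rewrite !ger0_norm ?ltW// (lt_trans c0).
- have [|c] := @MVT R F F1 h 0 h0 (fun s _ => dF s).
    exact: continuous_subspaceT.
  rewrite in_itv/= => /andP[c0 ch] E; exists c; last by rewrite -opprB E; ring.
  by rewrite !ltr0_norm// lerN2 ltW.
Qed.

(** The mean value theorem is applied twice; the constant A in place of A / 2 is harmless here. *)
Lemma taylor1_le (F F1 F2 : R -> R) (A : R) : (forall s : R, is_derive s 1 F (F1 s)) ->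
  (forall s : R, is_derive s 1 F1 (F2 s)) -> (forall s, `|s| <= 1 -> `|F2 s| <= A) ->
  forall h, `|h| <= 1 -> `|F h - F 0 - h * F1 0| <= A * h ^+ 2.
Proof.
move=> d1 d2 F2A h h1.
have [c ch ->] := mvt0 h d1.
have [c' cc E] := mvt0 c d2.
rewrite [h * _]mulrC -mulrBl E !normrM -mulrA -[h ^+ 2]real_normK ?num_real// expr2.
apply: ler_pM => //; first by apply: F2A; rewrite (le_trans cc)// (le_trans ch).
by rewrite ler_wpM2r.
Qed.

End taylor.

Section translation.
Context (R : realType) (d : nat).
Local Notation V := (phase R d).
Local Notation lebV := (prod_measure (@lebesgue_rV R d) (@lebesgue_rV R d)).

Lemma measurable_translate (w : V) : measurable_fun setT (fun z : V => z + w).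
Proof.
apply/measurable_fun_pair.
- apply: (eq_measurable_fun (rV_reflect false w.1 \o fst)).
    by move=> z _; rewrite /rV_reflect /= scale1r addrC.
  exact: (measurableT_comp (measurable_rV_reflect _ _) measurable_fst).
- apply: (eq_measurable_fun (rV_reflect false w.2 \o snd)).
    by move=> z _; rewrite /rV_reflect /= scale1r addrC.
  exact: (measurableT_comp (measurable_rV_reflect _ _) measurable_snd).
Qed.

Lemma ge0_integral_translate (w : V) (H : V -> \bar R) : measurable_fun setT H ->
  (forall z, (0 <= H z)%E) ->
  (\int[lebV]_z H (z + w)%R = \int[lebV]_z H z)%E.
Proof.
move=> mH H0.
have rE c x : x + c = rV_reflect false c x :> 'rV[R]_d by rewrite /rV_reflect scale1r addrC.
have mHw := measurableT_comp mH (measurable_translate w).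
rewrite (@fubini_tonelli1 _ _ _ _ R (@lebesgue_rV R d) (@lebesgue_rV R d) _ mHw)//.
rewrite (@fubini_tonelli1 _ _ _ _ R (@lebesgue_rV R d) (@lebesgue_rV R d) _ mH)//.
pose F x := (\int[@lebesgue_rV R d]_v H (x, v))%E.
transitivity (\int[@lebesgue_rV R d]_x F (rV_reflect false w.1 x))%E.
  apply: eq_integral => x _; rewrite /F.
  rewrite -(@ge0_integral_rV_reflect R d false w.2 (fun v => H (rV_reflect false w.1 x, v)))//.
    by apply: eq_integral => v _; rewrite /= -!rE.
  exact: (measurableT_comp mH (measurable_pair1 _)).
rewrite ge0_integral_rV_reflect//; last by move=> x; exact: integral_ge0.
exact: (@measurable_fun_fubini_tonelli_F _ _ _ _ R (@lebesgue_rV R d) H).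
by move=> x; exact: H0.
Qed.

Lemma integral_translate (w : V) (H : V -> \bar R) : measurable_fun setT H ->
  (\int[lebV]_z H (z + w)%R = \int[lebV]_z H z)%E.
Proof.
move=> mH; rewrite integralE [RHS]integralE; congr (_ - _)%E.
- rewrite -[RHS](ge0_integral_translate w)//; last exact: measurable_funepos.
  by apply: eq_integral => z _; rewrite !funeposE.
- rewrite -[RHS](ge0_integral_translate w)//; last exact: measurable_funeneg.
  by apply: eq_integral => z _; rewrite !funenegE.
Qed.

Lemma integrable_translate (w : V) (H : V -> \bar R) :
  lebV.-integrable setT H -> lebV.-integrable setT (fun z => H (z + w)).
Proof.
move=> /integrableP[mH Hoo]; apply/integrableP; split.
  exact: (measurableT_comp mH (measurable_translate w)).
rewrite (ge0_integral_translate w (H := fun z => `|H z|%E))//.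
exact: measurableT_comp.
Qed.

End translation.

Section weak_taylor.
Context (R : realType) (d : nat).
Local Notation V := (phase R d).
Local Notation lebV := (prod_measure (@lebesgue_rV R d) (@lebesgue_rV R d)).
Local Notation I := ('I_d + 'I_d)%type.
Local Notation test_cube N := (test_in (fun=> - N%:R) (fun=> N%:R)).

Lemma integrable_test (a b : I -> R) (phi : V -> R) : test_in a b phi ->
  lebV.-integrable setT (EFin \o phi).
Proof.
move=> tphi; have [M M0 HM] := test_in_bounded tphi.
rewrite (_ : EFin \o phi = EFin \o (cst 1 \* phi)); last first.
  by apply/funext => z; rewrite /= mul1r.
apply: (integrable_mul_bounded (integrable_indic_closed_box a b) _ HM (test_in_subclosed tphi)).
exact: measurable_test_alg tphi.1.
Qed.

(** Translates of [phi] keep their L^1 norm and stay in the cube of half-side N + 1, where [m] is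
    essentially bounded. The L^1 norm remains controlled when [phi] approaches an indicator, which
    norms of derivatives would not. *)
Lemma pairing_le (m : V -> R) (e : V) N : Lploc 1 m -> Lploc +oo m ->
  (forall i, `|pcrd i e| <= 1) -> exists2 C : R, 0 <= C & forall phi s,
    test_cube N phi -> `|s| <= 1 ->
    `|pairing m phi e s| <= C * \int[lebV]_z `|phi z|.
Proof.
move=> hm hmy e1.
have [C C0 HC] := @Lplocy_bounded R d m (fun=> - N.+1%:R) (fun=> N.+1%:R) hmy.
exists C => // phi s tphi s1.
have tphis := test_in_line e tphi s1.
have iphi := integrable_test tphi.
have imphi := integrable_mul_test hm tphis.
have mphi := measurable_test_alg tphi.1.
have mphis := measurable_test_alg tphis.1.
rewrite -lee_fin.
have -> : (C * \int[lebV]_z `|phi z|)%:E = (C%:E * \int[lebV]_z `|phi z|%:E)%E.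
  rewrite EFinM fineK//; apply: integrable_fin_num => //.
  exact: (integrable_abse iphi).
apply: (@le_trans _ _ (\int[lebV]_z `|(m z * phi (z - s *: e))%:E|)%E).
  rewrite -[X in (X <= _)%E]/(`| (\int[lebV]_z (m z * phi (z - s *: e)))%:E |)%E.
  rewrite fineK; last exact: integrable_fin_num.
  by apply: le_abse_integral => //; case/integrableP : imphi.
have mabs : measurable_fun setT (fun z => `|phi z|%:E).
  by apply/measurable_EFinP; exact: measurableT_comp.
have mabss : measurable_fun setT (fun z : V => `|phi (z - s *: e)|%:E).
  by apply/measurable_EFinP; exact: measurableT_comp.
rewrite -(@ge0_integral_translate R d (- (s *: e)) (fun z => `|phi z|%:E))//.
rewrite -ge0_integralZl//.
apply: ae_ge0_le_integral => //.
- by apply: measurableT_comp => //; case/integrableP : imphi.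
- by move=> z _; rewrite lee_fin mulr_ge0.
- exact: emeasurable_funM.
apply: filterS HC => z Hz _; rewrite -EFinM lee_fin normrM.
have [zB|zB] := pselect (closed_box (fun=> - N.+1%:R) (fun=> N.+1%:R) z).
  by rewrite ler_wpM2r// Hz.
suff -> : phi (z - s *: e) = 0 by rewrite normr0 !mulr0.
apply: (test_in_subclosed tphis); apply: contra_not zB => h i.
have /andP[h1 h2] := h i; have := e1 i; rewrite -natr1; lra.
Qed.

Lemma weak_taylor (f g m : V -> R) (e : V) N :
  weak_derivative e f g -> weak_derivative e g m -> Lploc +oo m ->
  (forall i, `|pcrd i e| <= 1) -> exists2 C : R, 0 <= C & forall phi h,
    test_cube N phi -> `|h| <= 1 ->
    `|pairing f phi e h - pairing f phi e 0 - h * pairing g phi e 0|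
      <= C * \int[lebV]_z `|phi z| * h ^+ 2.
Proof.
move=> fg gm my e1; have [_ hm _] := gm.
have [C C0 HC] := pairing_le N hm my e1; exists C => // phi h tphi h1.
have d1 (s : R) : is_derive s 1 (pairing f phi e) (pairing g phi e s).
  exact: is_derive_pairing fg tphi.
have d2 (s : R) : is_derive s 1 (pairing g phi e) (pairing m phi e s).
  exact: is_derive_pairing gm tphi.
have d3 (s : R) : `|s| <= 1 -> `|pairing m phi e s| <= C * \int[lebV]_z `|phi z|.
  exact: HC.
exact: (taylor1_le d1 d2 d3 h1).
Qed.

End weak_taylor.

Lemma Rintegral_close d (T : measurableType d) (R : realType)
    (mu : {measure set T -> \bar R}) (F G : T -> R) (H : T -> \bar R) (e : R) :
  mu.-integrable setT (EFin \o F) -> mu.-integrable setT (EFin \o G) ->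
  measurable_fun setT H -> (forall x, (`|F x - G x|%:E <= H x)%E) ->
  (\int[mu]_x H x <= e%:E)%E -> `|\int[mu]_x F x - \int[mu]_x G x| <= e.
Proof.
move=> iF iG mH FGH He; rewrite -RintegralB// -lee_fin.
have iB : mu.-integrable setT (EFin \o (F \- G)).
  rewrite (_ : _ \o _ = (EFin \o F) \- (EFin \o G))%E; first exact: integrableB.
  by apply/funext.
have mB : measurable_fun setT (EFin \o (F \- G)) by case/integrableP : iB.
apply: le_trans He.
apply: (@le_trans _ _ (\int[mu]_x `|(EFin \o (F \- G)%R) x|)%E); last first.
  apply: ge0_le_integral => //; first exact: measurableT_comp.
  by move=> x _; exact: FGH.
have := le_abse_integral mu measurableT mB.
by rewrite -(fineK (integrable_fin_num measurableT iB)).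
Qed.

Section zero_set.
Context (R : realType) (d : nat).
Local Notation V := (phase R d).
Local Notation lebV := (prod_measure (@lebesgue_rV R d) (@lebesgue_rV R d)).
Local Notation test_cube N := (test_in (fun=> - N%:R) (fun=> N%:R)).
Local Notation Q N := (cube (@pcrd R d) N).
Local Notation cbox N := (closed_box (fun=> - N%:R) (fun=> N%:R)).

Let mQ N : measurable (Q N : set V).
Proof. exact: (measurable_open_box (@measurable_pcrd R d)). Qed.

Let sub_cbox N : Q N `<=` cbox N.
Proof. by move=> z h i; have /andP[? ?] := h i; rewrite !ltW. Qed.

Lemma integrable_mul_indic (u : V -> R) (A : set V) N : measurable A -> 
  lebV.-integrable setT (EFin \o (u \* \1_(cbox N))) ->
  lebV.-integrable setT (EFin \o (u \* \1_(A `&` Q N))).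
Proof.
move=> mA iu; apply: (integrable_mul_bounded (M := 1) iu).
- by apply: measurable_indic; exact: measurableI.
- by move=> z; rewrite indicE; case: (_ \in _); rewrite ?normr1 ?normr0.
- by move=> z h; rewrite indicE memNset// => -[_ /sub_cbox].
Qed.

Lemma integral_mul_indic_close (u W phi : V -> R) (A : set V) N (e : R) :
  lebV.-integrable setT (EFin \o (u \* \1_(cbox N))) -> 
  measurable_fun setT W -> measurable A -> test_cube N phi ->
  (forall z, cbox N z -> `|u z| <= W z) ->
  (\int[lebV]_z (W z * `|\1_(A `&` Q N) z - phi z|)%:E <= e%:E)%E ->
  `|\int[lebV]_z (u z * phi z) - \int[lebV]_z (u z * \1_(A `&` Q N) z)| <= e.
Proof.
move=> iu mW mA tphi uW He.
have mphi := measurable_test_alg tphi.1.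
have [M M0 HM] := test_in_bounded tphi.
have iup := integrable_mul_bounded iu mphi HM (test_in_subclosed tphi).
have iuA := integrable_mul_indic mA iu.
have mI : measurable_fun setT (\1_(A `&` Q N) : V -> R).
  by apply: measurable_indic; exact: measurableI.
apply: (Rintegral_close iup iuA _ _ He).
  apply/measurable_EFinP; apply: measurable_funM => //.
  by apply: measurableT_comp => //; exact: measurable_funB.
move=> z; rewrite lee_fin -mulrBr normrM [X in _ * X <= _]distrC.
have [zN|zN] := pselect (cbox N z); first by rewrite ler_wpM2r// uW.
rewrite (test_in_subclosed tphi zN) indicE memNset ?subrr ?normr0 ?mulr0//.
by move=> [_ /sub_cbox].
Qed.

Section fixed_direction.
Variables (f g m : V -> R) (e : V).
Hypotheses (f0 : forall z, 0 <= f z) (fg : weak_derivative e f g)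
  (gm : weak_derivative e g m) (my : Lploc +oo m) (e1 : forall i, `|pcrd i e| <= 1).

Lemma integrable_shift (h : R) N : `|h| <= 1 ->
  lebV.-integrable setT (EFin \o ((fun z => f (z + h *: e)) \* \1_(cbox N))).
Proof.
move=> h1; have [hf _ _] := fg.
have i1 := integrable_translate (h *: e)
  (Lploc1_integrable (fun=> - N.+1%:R) (fun=> N.+1%:R) hf).
have mf := measurableT_comp (measurable_Lploc1 hf) (measurable_translate (h *: e)).
apply: (le_integrable _ _ _ i1) => //.
  apply/measurable_EFinP; apply: measurable_funM => //.
  by apply: measurable_indic; exact: measurable_closed_box.
move=> z _; rewrite /= lee_fin !normrM ler_wpM2l// !indicE.
have [zN|zN] := pselect (cbox N z); last by rewrite [z \in _]memNset// normr0.
have zN1 : cbox N.+1 (z + h *: e).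
  move=> i; rewrite pcrdD pcrdZ; have /andP[z1 z2] := zN i.
  have : `|h * pcrd i e| <= 1 by rewrite normrM mulr_ile1.
  by rewrite ler_norml -natr1 => /andP[h2 h3]; apply/andP; split; lra.
by rewrite (mem_set zN) (mem_set zN1).
Qed.

(* f(z + h e) >= 0 = f(z) on A, so the Taylor expansion of f tested against
   phi close to the indicator of A has a nonnegative right-hand side up to the
   error of the approximation. *)
Lemma zero_set_taylor (A : set V) N : measurable A -> (forall z, A z -> f z = 0) ->
  exists D : R, forall h, `|h| <= 1 ->
    0 <= h * \int[lebV]_z (g z * \1_(A `&` Q N) z) + D * h ^+ 2.
Proof.
move=> mA Af; have [hf hg _] := fg.
have [C C0 HC] := weak_taylor N fg gm my e1.
pose lam := \int[lebV]_z ((cst 1 : V -> R) z * \1_(A `&` Q N) z).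
exists (C * lam) => h h1; apply/ler_addgt0Pr => eps eps0.
(* The approximation error occurs once each for f, g and the translate of f, and C times for the
   integral of |phi|. *)
pose ep := eps / (3 + C).
have c3 : 0 < 3 + C by lra.
have ep0 : 0 < ep by rewrite divr_gt0.
(* One weight dominates all four integrands, the summand 1 being for the integral of |phi|. It
   depends on [h], which is fixed before [phi] is chosen. *)
pose W0 z := `|f z| + `|g z| + `|f (z + h *: e)| + 1.
pose W z := W0 z * \1_(cbox N) z.
have mc : measurable (cbox N : set V) by exact: measurable_closed_box.
have if_ := Lploc1_integrable (fun=> - N%:R) (fun=> N%:R) hf.
have ig_ := Lploc1_integrable (fun=> - N%:R) (fun=> N%:R) hg.
have ih_ := integrable_shift N h1.
have i1_ := @integrable_indic_closed_box R d (fun=> - N%:R) (fun=> N%:R).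
have iW : lebV.-integrable setT (EFin \o W).
  have := integrableD measurableT (integrableD measurableT (integrableD measurableT
    (integrable_abse if_) (integrable_abse ig_)) (integrable_abse ih_)) (integrable_abse i1_).
  congr (integrable _ _ _); apply/funext => z; rewrite /W /W0 /= -!EFinD !normrM normr1.
  by congr EFin; rewrite [`|\1__ z|]ger0_norm//; ring.
have W00 z : 0 <= W0 z by rewrite /W0 !addr_ge0.
have Wp z : 0 <= W z by rewrite /W mulr_ge0.
have mW : measurable_fun setT W by case/integrableP : iW => /measurable_EFinP.
have [phi tphi Hphi] := test_in_dense N iW Wp mA ep0.
have WE z : cbox N z -> W z = W0 z by move=> zN; rewrite /W indicE mem_set// mulr1.
have hW u : lebV.-integrable setT (EFin \o (u \* \1_(cbox N))) ->
    (forall z, `|u z| <= W0 z) ->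
    `|\int[lebV]_z (u z * phi z) - \int[lebV]_z (u z * \1_(A `&` Q N) z)| <= ep.
  by move=> iu uW; apply: (integral_mul_indic_close iu mW mA tphi _ Hphi) => z zN; rewrite WE.
have Hf : `|\int[lebV]_z (f z * phi z) - \int[lebV]_z (f z * \1_(A `&` Q N) z)| <= ep.
  by apply: hW => // z; rewrite /W0 -!addrA lerDl !addr_ge0.
have Hg : `|\int[lebV]_z (g z * phi z) - \int[lebV]_z (g z * \1_(A `&` Q N) z)| <= ep.
  by apply: hW => // z; rewrite /W0 -!addrA addrCA lerDl !addr_ge0.
pose fh z := f (z + h *: e).
have Hh : `|\int[lebV]_z (fh z * phi z) - \int[lebV]_z (fh z * \1_(A `&` Q N) z)| <= ep.
  by apply: (hW fh) => // z; rewrite /W0 /fh -addrA addrCA lerDl !addr_ge0.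
have mphi := measurable_test_alg tphi.1.
have mIA : measurable_fun setT (\1_(A `&` Q N) : V -> R).
  by apply: measurable_indic; exact: measurableI.
have Habs : `|\int[lebV]_z `|phi z| - lam| <= ep.
  apply: (Rintegral_close _ (integrable_mul_indic mA i1_) _ _ Hphi).
  - exact: (integrable_abse (integrable_test tphi)).
  - apply/measurable_EFinP; apply: measurable_funM => //.
    by apply: measurableT_comp => //; exact: measurable_funB.
  - move=> z; rewrite lee_fin [X in `|_ - X|]mul1r.
    have [zN|zN] := pselect (cbox N z); last first.
      rewrite (test_in_subclosed tphi zN) indicE memNset; last by move=> [_ /sub_cbox].
      by rewrite /= normr0 subr0 normr0 mulr0.
    rewrite WE// -[X in X <= _]mul1r ler_pM//; first by rewrite /W0 lerDr !addr_ge0.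
    rewrite -[X in `| _ - X|]ger0_norm// distrC.
    exact: ler_dist_dist.
have fA0 : \int[lebV]_z (f z * \1_(A `&` Q N) z) = 0.
  rewrite (_ : (fun z => _) = cst 0); first by rewrite Rintegral_cst// mul0r.
  apply/funext => z; rewrite indicE; have [zA|zA] := pselect ((A `&` Q N) z).
    by rewrite Af ?mul0r//; case: zA.
  by rewrite memNset// mulr0.
have fhA0 : 0 <= \int[lebV]_z (fh z * \1_(A `&` Q N) z).
  by apply: Rintegral_ge0 => z _; rewrite mulr_ge0// f0.
have pg0 : pairing g phi e 0 = \int[lebV]_z (g z * phi z).
  by apply: eq_Rintegral => z _; rewrite scale0r subr0.
have pf0 : pairing f phi e 0 = \int[lebV]_z (f z * phi z).
  by apply: eq_Rintegral => z _; rewrite scale0r subr0.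
have pfh : pairing f phi e h = \int[lebV]_z (fh z * phi z).
  rewrite /pairing /Rintegral; congr fine.
  rewrite -(@integral_translate R d (h *: e)); last first.
    apply/measurable_EFinP; apply: measurable_funM; first exact: measurable_Lploc1.
    exact: (measurableT_comp mphi (measurable_translate (- (h *: e)))).
  by apply: eq_integral => z _; rewrite /= addrK.
have := HC phi h tphi h1; rewrite pg0 pf0 pfh.
set a := \int[lebV]_z (f z * phi z) in Hf *.
set b := \int[lebV]_z (g z * phi z) in Hg *.
set c := \int[lebV]_z (fh z * phi z) in Hh *.
set l := \int[lebV]_z `|phi z| in Habs *.
set ga := \int[lebV]_z (g z * \1_(A `&` Q N) z) in Hg *.
set fa := \int[lebV]_z (fh z * \1_(A `&` Q N) z) in Hh fhA0 *.
rewrite fA0 subr0 in Hf.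
clear - h1 C0 c3 eps0 ep0 Hf Hg Hh Habs fhA0.
move=> HT.
have epE : ep * (3 + C) = eps by rewrite /ep divfK// gt_eqF.
clearbody lam a b c l ga fa ep.
have h20 : 0 <= h ^+ 2 by exact: sqr_ge0.
have h21 : h ^+ 2 <= 1 by rewrite -real_normK ?num_real// exprn_ile1.
have hb : h * b <= h * ga + ep.
  rewrite -lerBlDl -mulrBr (le_trans (ler_norm _))// normrM -[leRHS]mul1r ler_pM//.
have hl : C * l * h ^+ 2 <= C * lam * h ^+ 2 + C * ep.
  have l1 : l <= lam + ep by move: Habs; rewrite ler_norml => /andP[]; lra.
  have : C * (l * h ^+ 2) <= C * (lam * h ^+ 2 + ep).
    rewrite ler_wpM2l//; apply: (@le_trans _ _ ((lam + ep) * h ^+ 2)); first by rewrite ler_wpM2r.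
    by rewrite mulrDl lerD2l -[leRHS]mulr1 ler_wpM2l// ltW.
  by rewrite mulrDr !mulrA.
move: Hf Hh HT; rewrite !ler_norml => /andP[Hf1 Hf2] /andP[Hh1 Hh2] /andP[HT1 HT2].
have -> : eps = 3 * ep + C * ep by rewrite -epE; ring.
lra.
Qed.

(** Taking h = t and h = -t with small t > 0 and dividing by t confines the integral to
    [-D t, D t]. *)
Let integral_zero_set (A : set V) N : measurable A -> (forall z, A z -> f z = 0) ->
  \int[lebV]_z (g z * \1_(A `&` Q N) z) = 0.
Proof.
move=> mA Af; have [D HD] := zero_set_taylor N mA Af.
set ga := \int[lebV]_z _ in HD *; clearbody ga.
apply/eqP; rewrite -normr_le0; apply/ler_addgt0Pr => eps eps0; rewrite add0r.
pose t := Num.min 1 (eps / (`|D| + 1)).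
have D1 : 0 < `|D| + 1 by rewrite ltr_wpDl.
have t0 : 0 < t by rewrite lt_min ltr01 divr_gt0.
have t1 : t <= 1 by rewrite ge_min lexx.
have tD : D * t <= eps.
  apply: (@le_trans _ _ ((`|D| + 1) * t)).
    by rewrite ler_wpM2r ?(ltW t0)// ler_wpDr// ler_norm.
  rewrite mulrC -ler_pdivlMr//.
  by rewrite ge_min lexx orbT.
have h1 := HD t; have h2 := HD (- t); rewrite normrN gtr0_norm// in h1 h2.
have {}h1 := h1 t1; have {}h2 := h2 t1; rewrite sqrrN in h2.
have E x : t * x + D * t ^+ 2 = t * (x + D * t) by ring.
rewrite mulNr -mulrN E pmulr_rge0// in h2; rewrite E pmulr_rge0// in h1.
by rewrite ler_norml; lra.
Qed.

(** The integral of [g] vanishes over every measurable part of the zero set in each cube, so [g] is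
    0 almost everywhere there; countably many cubes cover the space. *)
Lemma weak_derivative_eq0 : {ae lebV, forall z, f z = 0 -> g z = 0}.
Proof.
have [hf hg _] := fg.
have mf := measurable_Lploc1 hf.
pose Zf := f @^-1` [set 0].
have mZf : measurable Zf by rewrite -[Zf]setTI; exact: mf.
have H N : ae_eq lebV setT (EFin \o (g \* \1_(Zf `&` Q N))) (cst 0%E).
  apply: integral_ae_eq => //.
    apply: integrable_mul_indic => //; exact: Lploc1_integrable.
  move=> E _ mE; rewrite integral0 integral_mkcond.
  have mEZ : measurable (E `&` Zf) by exact: measurableI.
  have fE z : (E `&` Zf) z -> f z = 0 by case.
  have gE := integral_zero_set N mEZ fE.
  have iE : lebV.-integrable setT (EFin \o (g \* \1_(E `&` Zf `&` Q N))).
    by apply: integrable_mul_indic => //; exact: Lploc1_integrable.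
  rewrite -[0%E]/(0%R)%:E -gE /Rintegral fineK; last exact: (integrable_fin_num measurableT iE).
  apply: eq_integral => z _; rewrite patchE /= !indicE -setIA !in_setI.
  by case: (z \in E); rewrite /= ?mulr0.
have := ae_foralln H; apply: filterS => z Hz fz0.
have [N _ QNz] : (\bigcup_n Q n) z by rewrite bigcup_cube.
have := Hz N Logic.I; rewrite /= indicE mem_set; last by split.
by rewrite mulr1 => -[].
Qed.

End fixed_direction.
End zero_set.

(** * Integration by parts in velocity *)

Section phase_volume.
Context (R : realType) (d : nat) (Omega : domain).
Local Notation X := 'rV[R]_d.
Local Notation V := (phase R d).
Local Notation leb := (@lebesgue_rV R d).
Local Notation lebV := (prod_measure leb leb).
Local Notation vol := (@vol R d Omega).
Local Notation volV := (phase_vol R d Omega).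

Lemma measurable_cell_phase : measurable (cell Omega `*` setT : set V).
Proof. by apply: measurableX => //; exact: measurable_cell. Qed.

Lemma phase_volE (A : set V) : measurable A ->
  volV A = lebV (A `&` (cell Omega `*` setT)).
Proof.
move=> mA; rewrite /phase_vol.
apply: (@product_measure_unique _ _ _ _ R vol leb
  (mrestr lebV measurable_cell_phase)) => // B C mB mC.
rewrite /= /mrestr -setXI setIT.
rewrite /prod_measure product_measure1E//.
by apply: measurableI => //; exact: measurable_cell.
Qed.

Lemma integral_phase_vol (F : V -> \bar R) : (forall z, ~ cell Omega z.1 -> F z = 0%E) ->
  (\int[volV]_z F z = \int[lebV]_z F z)%E.
Proof.
move=> F0.
have FE : F \_ (cell Omega `*` setT) = F.
  apply/funext => z; rewrite patchE; case: ifPn => // /negP zC.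
  by rewrite F0// => zc; apply: zC; rewrite inE.
rewrite -FE -!integral_mkcond; apply: eq_measure_integral => A mA AC.
by apply: (etrans (phase_volE mA)); rewrite (setIidl AC).
Qed.

Lemma phase_vol_ae (P : V -> Prop) : {ae lebV, forall z, P z} -> {ae volV, forall z, P z}.
Proof.
move=> [N [mN N0 PN]]; exists N; split=> //; rewrite phase_volE//.
apply: (@subset_measure0 _ _ _ lebV _ N) => //.
by apply: measurableI => //; exact: measurable_cell_phase.
Qed.

End phase_volume.

Section bump_derivative.
Context (R : realType) (d : nat).
Local Notation V := (phase R d).
Local Notation I := ('I_d + 'I_d)%type.
Variables (k a b : I -> R) (j : 'I_d).

Let q := flat_deriv (1 : {poly R}).

Lemma derive_bump_vdir (z : V) : k (inr j) = 1 ->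
  'D_(vdir R j) (box_bump k a b : V -> R^o) z =
  (\prod_(i | i != inr j) bump_factor k a b i z) *
    (flat q (z.2 ord0 j - a (inr j)) * flat 1 (b (inr j) - z.2 ord0 j) -
     flat 1 (z.2 ord0 j - a (inr j)) * flat q (b (inr j) - z.2 ord0 j)).
Proof.
move=> k1; set c := \prod_(i | _) _; set v := z.2 ord0 j.
set A := a (inr j); set B := b (inr j).
pose psi (t : R) : R := c * (flat 1 (t - A) * flat 1 (B - t)).
have pE h : box_bump k a b (h *: vdir R j + z) = psi (h *: 1 + v).
  rewrite /box_bump (bigD1 (inr j))//= mulrC; congr (_ * _).
    apply: eq_bigr => -[i|i] /= ij; rewrite /bump_factor /= !mxE ?mulr0 ?add0r//.
    by rewrite eqxx/= (_ : i == j = false) ?mulr0 ?add0r//; apply/negbTE.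
  by rewrite /bump_factor k1 !mul1r/= !mxE !eqxx/= /v.
have pE0 : box_bump k a b z = psi v.
  by have := pE 0; rewrite !scale0r !add0r.
transitivity ('D_1 (psi : R -> R^o) v).
  rewrite /derive; set F := (fun h => _); set F' := (fun h => _).
  by have -> : F = F' by apply/funext => h; rewrite /F /F' /= pE pE0.
have d1 : is_derive v 1 (fun t : R => flat 1 (t - A)) (flat q (v - A)).
  have h : is_derive v 1 (fun t : R => t - A) (1 - 0) := is_deriveB (is_derive_id v 1) (is_derive_cst A v 1).
  have dp := is_derive_flat 1 (v - A).
  apply: (is_derive_eq (@is_derive1_comp R (flat 1) (fun t => t - A) v _ _ dp h)).
  by rewrite subr0 mulr1.
have d2 : is_derive v 1 (fun t : R => flat 1 (B - t)) (- flat q (B - v)).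
  have h : is_derive v 1 (fun t : R => B - t) (0 - 1) := is_deriveB (is_derive_cst B v 1) (is_derive_id v 1).
  have dp := is_derive_flat 1 (B - v).
  apply: (is_derive_eq (@is_derive1_comp R (flat 1) (fun t => B - t) v _ _ dp h)).
  by rewrite sub0r mulrN1.
have [_ ->] : is_derive v 1 (psi : R -> R^o) (c *: (flat 1 (v - A) *: - flat q (B - v) + flat 1 (B - v) *: flat q (v - A))).
  have h1 := is_deriveM d1 d2.
  by have := is_deriveZ c h1.
by rewrite /GRing.scale /=; ring.
Qed.

End bump_derivative.

Lemma integral_mul_bounded_cvg dT (T : measurableType dT) (R : realType)
    (mu : {measure set T -> \bar R}) (u : T -> R) (psi_ : nat -> T -> R)
    (psi : T -> R) (M : R) : mu.-integrable setT (EFin \o u) ->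
  (forall n, measurable_fun setT (psi_ n)) -> (forall n x, `|psi_ n x| <= M) ->
  (forall x, psi_ n x @[n --> \oo] --> psi x) ->
  (\int[mu]_x (u x * psi_ n x)%:E)%E @[n --> \oo] -->
  (\int[mu]_x (u x * psi x)%:E)%E.
Proof.
move=> iu mpsi psiM cpsi.
have mu_ : measurable_fun setT u by case/integrableP : iu => /measurable_EFinP.
apply: (@dominated_cvg _ _ _ mu setT measurableT _ _ (fun x => M%:E * `|(u x)%:E|)%E).
- by move=> n; apply/measurable_EFinP; exact: measurable_funM.
- move=> x _; apply: cvg_EFin; first exact: nearW.
  exact: (cvgM (cvg_cst (u x)) (cpsi x)).
- by [].
- by apply: integrableZl => //; exact: integrable_abse.
- by move=> n x _; rewrite -EFinM lee_fin normrM mulrC ler_wpM2r.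
Qed.

Section cancellation.
Context (R : realType) (d : nat) (Omega : domain).
Local Notation X := 'rV[R]_d.
Local Notation V := (phase R d).
Local Notation leb := (@lebesgue_rV R d).
Local Notation lebV := (prod_measure leb leb).
Local Notation volV := (phase_vol R d Omega).
Local Notation I := ('I_d + 'I_d)%type.
Local Notation xbox := (open_box (@rV_coord _ R d)).

Section cutoff.
Variables (a b : 'I_d -> R) (j : 'I_d).

Let k n (i : I) : R := if i is inl _ then n.+1%:R else 1.
Let A n (i : I) : R := if i is inl l then a l else - n%:R.
Let B n (i : I) : R := if i is inl l then b l else n%:R.

(* The x-sides converge to the indicator of the box while the v-sides are
   flattened out, so that the v-derivatives tend to 0 boundedly. *)
Definition cutoff n : V -> R := box_bump (k n) (A n) (B n).

Let k0 n i : 0 < k n i. Proof. by case: i => i; rewrite /k. Qed.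

Lemma test_in_cutoff n : test_in (A n) (B n) (cutoff n).
Proof. exact: test_in_bump. Qed.

Lemma norm_cutoff_le1 n z : `|cutoff n z| <= 1.
Proof.
by have /andP[h0 h1] := bump_itv (k n) (A n) (B n) z; rewrite ger0_norm.
Qed.

Lemma cutoff_eq0 n (z : V) : ~ xbox a b z.1 ->
  cutoff n z = 0 /\ 'D_(vdir R j) (cutoff n : V -> R^o) z = 0.
Proof.
move=> /existsNP[l /negP zl].
have f0 : bump_factor (k n) (A n) (B n) (inl l) z = 0 by exact: bump_factor_eq0.
split; first by rewrite /cutoff /box_bump (bigD1 (inl l))//= f0 mul0r.
rewrite derive_bump_vdir; last by rewrite /k.
by rewrite (bigD1 (inl l))//= f0 !mul0r.
Qed.

Let cvgy_natrD (c : R) : n%:R + c @[n --> \oo] --> +oo.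
Proof.
apply/cvgryPge => x; near=> n; rewrite -lerBlDr.
by near: n; exact: nbhs_infty_ger.
Unshelve. all: by end_near. Qed.

Let cvgy_natrM (c : R) : 0 < c -> n.+1%:R * c @[n --> \oo] --> +oo.
Proof.
move=> c0; apply/cvgryPge => x; near=> n; rewrite -ler_pdivrMr//.
apply: (@le_trans _ _ n%:R); last by rewrite ler_nat.
by near: n; exact: nbhs_infty_ger.
Unshelve. all: by end_near. Qed.

Lemma cvg_cutoff (z : V) : cutoff n z @[n --> \oo] --> (\1_(xbox a b) z.1 : R).
Proof.
rewrite indicE; have [zab|zab] := pselect (xbox a b z.1); last first.
  rewrite memNset//= (_ : (fun n => _) = cst 0); first exact: cvg_cst.
  by apply/funext => n; rewrite (cutoff_eq0 n zab).1.
rewrite mem_set//=; apply: cvg_bump => -[l|l] /=.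
- by apply: cvgy_natrM; have /andP[? ?] := zab l; rewrite subr_gt0.
- by under eq_fun do rewrite mul1r opprK addrC; exact: cvgy_natrD.
- by apply: cvgy_natrM; have /andP[? ?] := zab l; rewrite subr_gt0.
- by under eq_fun do rewrite mul1r; exact: cvgy_natrD.
Qed.

Let q := flat_deriv (1 : {poly R}).

Let norm_derive_cutoff n (z : V) :
  `|'D_(vdir R j) (cutoff n : V -> R^o) z| <=
  `|flat q (n%:R + z.2 ord0 j)| + `|flat q (n%:R - z.2 ord0 j)|.
Proof.
rewrite derive_bump_vdir /k// normrM /A /B opprK [z.2 ord0 j + _]addrC.
rewrite -[leRHS]mul1r ler_pM//.
  rewrite ger0_norm; last by apply: prodr_ge0 => i _; case/andP: (bump_factor_itv (k n) (A n) (B n) i z).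
  rewrite -[leRHS](@big1_eq _ 1 *%R I (index_enum I) (fun i => i != inr j)).
  by apply: ler_prod => i _; exact: bump_factor_itv.
apply: le_trans (ler_normB _ _) _; rewrite !normrM !(ger0_norm (flat1_ge0 _)).
by rewrite lerD// ?ler_piMr ?ler_piMl ?flat1_le1.
Qed.

(** Only the factor of v_j is differentiated, and its steepness stays 1; the growing steepness n + 1
    occurs only in the x-factors, which are bounded by 1. *)
Lemma derive_cutoff_bounded : exists M : R, forall n z,
  `|'D_(vdir R j) (cutoff n : V -> R^o) z| <= M.
Proof.
have [M HM] := flat_bounded q; exists (M + M) => n z.
by apply: le_trans (norm_derive_cutoff n z) _; rewrite lerD.
Qed.

Lemma cvg_derive_cutoff (z : V) :
  'D_(vdir R j) (cutoff n : V -> R^o) z @[n --> \oo] --> (0 : R).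
Proof.
have q0 : q.[0] = 0 by rewrite hornerM hornerXn expr0n mulr0.
apply/norm_cvg0P.
have h (c : R) : `|flat q (n%:R + c)| @[n --> \oo] --> (0 : R).
  by apply/norm_cvg0P; rewrite -q0; apply: cvg_flat; exact: cvgy_natrD.
have hD := cvgD (h (z.2 ord0 j)) (h (- z.2 ord0 j)); rewrite addr0 in hD.
pose F n := `|flat q (n%:R + z.2 ord0 j)| + `|flat q (n%:R - z.2 ord0 j)|.
have {}hD : F n @[n --> \oo] --> (0 : R) by exact: hD.
apply: (squeeze_cvgr _ (cvg_cst (0 : R)) hD).
by apply: nearW => n; rewrite normr_ge0/=; exact: norm_derive_cutoff.
Qed.

End cutoff.

Section vanishing.
Variables (f g : V -> R) (j : 'I_d).
Hypotheses (fg : weak_derivative (vdir R j) f g)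
  (if_ : volV.-integrable setT (EFin \o f)) (ig : volV.-integrable setT (EFin \o g)).

(** The weak derivative identity lives on the whole space, whereas [f] and [g] are integrable over
    the cell. A box inside the cell makes the cutoff vanish outside it, so both volumes give the
    same integrals. In the limit the side carrying the v-derivative tends to 0 by dominated
    convergence. *)
Lemma integral_xbox_eq0 (a b : 'I_d -> R) : xbox a b `<=` cell Omega ->
  (\int[volV]_z (g z * \1_(xbox a b) z.1)%:E = 0)%E.
Proof.
move=> abO; have [hf hg H] := fg.
pose phi := cutoff a b.
pose D n z := 'D_(vdir R j) (phi n : V -> R^o) z.
have tphi n := test_in_cutoff a b n.
have talg n := (tphi n).1.
have [M HM] := derive_cutoff_bounded a b j.
have mD n : measurable_fun setT (D n).
  exact: measurable_test_alg ((test_alg_diff (talg n)).2 (vdir R j)).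
have L1 : (\int[volV]_z (f z * D n z)%:E)%E @[n --> \oo] --> 0%E.
  have := integral_mul_bounded_cvg if_ mD HM (cvg_derive_cutoff a b j).
  by under [X in _ --> X]eq_integral do rewrite mulr0; rewrite integral0.
have L2 : (\int[volV]_z (g z * phi n z)%:E)%E @[n --> \oo] -->
    (\int[volV]_z (g z * \1_(xbox a b) z.1)%:E)%E.
  apply: (integral_mul_bounded_cvg ig (M := 1)).
  - by move=> n; exact: measurable_test_alg.
  - by move=> n z; exact: norm_cutoff_le1.
  - exact: cvg_cutoff.
have E n : (\int[volV]_z (f z * D n z)%:E = - \int[volV]_z (g z * phi n z)%:E)%E.
  have out (z : V) : ~ cell Omega z.1 -> phi n z = 0 /\ D n z = 0.
    by move=> h; apply: cutoff_eq0 => /abO.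
  have E1 : (\int[volV]_z (f z * D n z)%:E = \int[lebV]_z (f z * D n z)%:E)%E.
    by apply: integral_phase_vol => z /out[_ ->]; rewrite mulr0.
  have E2 : (\int[volV]_z (g z * phi n z)%:E = \int[lebV]_z (g z * phi n z)%:E)%E.
    by apply: integral_phase_vol => z /out[-> _]; rewrite mulr0.
  rewrite E1 E2.
  have i1 := integrable_mul_derive (vdir R j) hf (tphi n).
  have i2 := integrable_mul_test hg (tphi n).
  have := congr1 EFin (H _ (test_function_in (tphi n))).
  rewrite EFinN /Rintegral (fineK (integrable_fin_num measurableT i1)).
  by rewrite (fineK (integrable_fin_num measurableT i2)).
have L3 : (\int[volV]_z (f z * D n z)%:E)%E @[n --> \oo] -->
    (- \int[volV]_z (g z * \1_(xbox a b) z.1)%:E)%E.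
  by under eq_fun do rewrite E; exact: cvgeN.
have := cvg_unique _ L1 L3 => /(_ (@ereal_hausdorff R)) h.
by apply/eqP; rewrite -oppe_eq0 -h.
Qed.

End vanishing.
End cancellation.

Section moments_of_gradient.
Context (R : realType) (d : nat) (Omega : domain).
Local Notation X := 'rV[R]_d.
Local Notation V := (phase R d).
Local Notation leb := (@lebesgue_rV R d).
Local Notation lebV := (prod_measure leb leb).
Local Notation vol := (@vol R d Omega).
Local Notation volV := (phase_vol R d Omega).
Local Notation xbox := (open_box (@rV_coord _ R d)).

Lemma lebesgue_rV_hyperplane (i : 'I_d) (c : R) :
  leb [set x : X | x ord0 i = c] = 0%E.
Proof.
pose A (l : 'I_d) : set R := if l == i then [set c] else setT.
rewrite (_ : [set x : X | _] = [set x : X | forall l, A l (x ord0 l)]).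
  rewrite lebesgue_rV_box; last by move=> l; rewrite /A; case: ifP.
  by rewrite (bigD1 i)//= /A eqxx lebesgue_measure_set1 mul0e.
apply/seteqP; split=> x /=.
  by move=> xi l; rewrite /A; case: eqP => [->|].
by move=> /(_ i); rewrite /A eqxx.
Qed.

Lemma lebesgue_rV_ae_neq (c : R) : {ae leb, forall x : X, forall i, x ord0 i != c}.
Proof.
apply: filter_forall => i; exists [set x : X | x ord0 i = c].
split; [|exact: lebesgue_rV_hyperplane|by move=> x /= /negP; rewrite negbK => /eqP].
rewrite (_ : [set x : X | _] = rV_coord i @^-1` [set c])//.
by rewrite -[X in measurable X]setTI; exact: measurable_rV_coord.
Qed.

Lemma ae_fst (P : X -> Prop) : {ae leb, forall x, P x} -> {ae lebV, forall z, P z.1}.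
Proof.
move=> [N [mN N0 PN]]; exists (N `*` setT); split; first exact: measurableX.
- by rewrite /prod_measure product_measure1E// [X in (X * _)%E]N0 mul0e.
- by move=> [x v] /= /PN.
Qed.

Lemma phase_vol_ae_cell : {ae volV, forall z, cell Omega z.1}.
Proof.
exists (~` (cell Omega `*` setT)); split.
- by apply: measurableC; exact: measurable_cell_phase.
- rewrite phase_volE; last by apply: measurableC; exact: measurable_cell_phase.
  by rewrite setICl measure0.
- by move=> z /= h [].
Qed.

(** On the torus the box is intersected with the open unit cube. The half-open cell differs from it
    only by parts of the hyperplanes x_i = 0, which are null. *)
Lemma xbox_cell (a b : 'I_d -> R) : exists a' b', xbox a' b' `<=` cell Omega /\
  {ae volV, forall z, \1_(xbox a b) z.1 = \1_(xbox a' b') z.1 :> R}.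
Proof.
rewrite /cell; case: Omega phase_vol_ae_cell => /= [_|h].
  by exists a, b; split => //; apply: aeW.
exists (fun i => Num.max 0 (a i)), (fun i => Num.min 1 (b i)); split.
  move=> x /= xab i; have := xab i; rewrite in_itv/= gt_max lt_min /rV_coord.
  by move=> /andP[/andP[h1 _] /andP[h2 _]]; rewrite ltW.
have := phase_vol_ae flat_torus (ae_fst (lebesgue_rV_ae_neq 0)).
apply: filterS2 h => z zc z0; rewrite !indicE; congr (_%:R : R); congr nat_of_bool.
apply/idP/idP; rewrite !inE => zab i; have := zab i; rewrite gt_max lt_min.
  have := zc i; rewrite in_itv/= => /andP[c1 c2] /andP[h1 h2].
  by rewrite h1 h2 c2 lt_neqAle c1 eq_sym z0.
by move=> /andP[/andP[_ ->] /andP[_ ->]].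
Qed.

Section vanishing.
Variables (f g : V -> R) (j : 'I_d).
Hypotheses (fg : weak_derivative (vdir R j) f g)
  (if_ : volV.-integrable setT (EFin \o f)) (ig : volV.-integrable setT (EFin \o g)).

Let mg : measurable_fun setT g.
Proof. by case/integrableP : ig => /measurable_EFinP. Qed.

Let mind (A : set X) : measurable A -> measurable_fun setT (fun z : V => \1_A z.1 : R).
Proof. by move=> mA; apply: measurableT_comp => //; exact: measurable_indic. Qed.

Let good (A : set X) : Prop := (\int[volV]_z (g z * \1_A z.1)%:E = 0)%E.

Let igI (A : set X) : measurable A -> volV.-integrable setT (fun z => (g z * \1_A z.1)%:E).
Proof.
move=> mA.
rewrite (_ : (fun z => _) = (EFin \o g) \* (EFin \o (fun z : V => \1_A z.1 : R)))%E.
  apply: integrableMl => //; first exact: mind.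
  exists 1; split; first exact: num_real.
  move=> x x1 z _ /=; rewrite indicE (le_trans _ (ltW x1))//.
  by case: (_ \in _); rewrite ?normr1 ?normr0.
by apply/funext => z; rewrite /= EFinM.
Qed.

Let good_cvg (F : (set X)^nat) (A : set X) : (forall n, measurable (F n)) ->
  (forall x, \1_(F n) x @[n --> \oo] --> (\1_A x : R)) -> (forall n, good (F n)) ->
  good A.
Proof.
move=> mF cF gF.
have := integral_mul_bounded_cvg ig (M := 1) (fun n => mind (mF n)) _ (fun z => cF z.1).
have h n (z : V) : `|\1_(F n) z.1 : R| <= 1.
  by rewrite indicE; case: (_ \in _); rewrite ?normr1 ?normr0.
move=> /(_ h); under eq_fun do rewrite gF.
by move=> /(cvg_unique (@ereal_hausdorff R) (cvg_cst 0%E)).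
Qed.

Let good_lin (A B C : set X) (c : R) : measurable A -> measurable B -> measurable C ->
  (forall x, \1_C x = \1_A x + c * \1_B x :> R) -> good A -> good B -> good C.
Proof.
move=> mA mB mC CE gA gB; rewrite /good.
transitivity (\int[volV]_z ((g z * \1_A z.1)%:E + c%:E * (g z * \1_B z.1)%:E))%E.
  by apply: eq_integral => z _; rewrite CE -EFinM -EFinD; congr EFin; ring.
rewrite integralD//; [|exact: igI|exact: integrableZl (igI mB)].
by rewrite integralZl//; [rewrite gA gB mule0 adde0|exact: igI].
Qed.

Let good_nd (F : (set X)^nat) : (forall n, measurable (F n)) ->
  {homo F : m n / (m <= n)%N >-> m `<=` n} -> (forall n, good (F n)) ->
  good (\bigcup_n F n).
Proof.
move=> mF ndF gF; apply: (good_cvg mF _ gF) => x; rewrite [X in _ --> X]indicE.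
have [xF|xF] := pselect ((\bigcup_n F n) x).
  rewrite mem_set//; have [m _ Fmx] := xF.
  apply: cvg_near_cst; exists m => // n /= mn; rewrite indicE mem_set//.
  exact: ndF mn _ Fmx.
rewrite memNset//; apply: cvg_near_cst; apply: nearW => n.
by rewrite indicE memNset// => Fnx; apply: xF; exists n.
Qed.

Let mxbox a b : measurable (xbox a b : set X).
Proof. exact: (measurable_open_box (@measurable_rV_coord _ R d)). Qed.

Let good_xbox (a b : 'I_d -> R) : good (xbox a b).
Proof.
have [a' [b' [sub ab]]] := xbox_cell a b.
rewrite /good -(integral_xbox_eq0 fg if_ ig sub); apply: ae_eq_integral => //.
- by apply/measurable_EFinP; apply: measurable_funM => //; exact: mind.
- by apply/measurable_EFinP; apply: measurable_funM => //; exact: mind.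
- by apply: filterS ab => z h _; rewrite h.
Qed.

Lemma integral_indic_eq0 (A : set X) : measurable A ->
  (\int[volV]_z (g z * \1_A z.1)%:E = 0)%E.
Proof.
move=> mA; suff : good A by [].
have goodT : good setT.
  rewrite -(@bigcup_cube _ _ R _ (@rV_coord _ R d)); apply: good_nd => [n||n].
  - exact: mxbox.
  - by move=> m n; exact: nd_cube.
  - exact: good_xbox.
have goodC B : measurable B -> good B -> good (~` B).
  move=> mB; apply: (good_lin (c := -1)) goodT => //; first exact: measurableC.
  move=> x; rewrite !indicE in_setT in_setC.
  by case: (x \in B); rewrite /= ?mulr1 ?mulr0 ?subrr ?addr0.
have gen := measurable_open_boxes (@measurable_rV_coord _ R d) (@rV_generated R d).
have mA' : <<s open_boxes (@rV_coord _ R d) >> A by rewrite -gen.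
move: A mA mA' => A mA; apply: dynkin_induction => //.
- exact: setI_closed_open_boxes.
- by move=> _ [[a b] _ <-]; exact: good_xbox.
move=> F mF tF gF.
have mU n : measurable (\big[setU/set0]_(i < n) F i).
  by apply: bigsetU_measurable => i _; exact: mF.
rewrite -bigcup_bigsetU_bigcup; apply: good_nd => [n||].
- exact: mU.
- by move=> m n mn; exact: subset_bigsetU.
elim=> [|n IH]; first by rewrite big_ord1.
rewrite big_ord_recr/=; apply: (good_lin (c := 1)) IH (gF n.+1) => //.
  by apply: measurableU => //; exact: mU.
move=> x; rewrite !indicE in_setU mul1r.
have h : (x \in \big[setU/set0]_(i < n.+1) F i) -> (x \in F n.+1) -> False.
  rewrite !inE => + Fnx; rewrite -bigcup_mkord => -[m /= mn Fmx].
  have := tF m n.+1 Logic.I Logic.I (ex_intro _ x (conj Fmx Fnx)) => mnE.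
  by rewrite mnE ltnn in mn.
case: (x \in \big[setU/set0]_(i < n.+1) F i) h; case: (x \in F n.+1) => //=;
  rewrite ?addr0 ?add0r// => h; by have := h isT isT.
Qed.

End vanishing.
End moments_of_gradient.

Section moments_of_gradient_fubini.
Context (R : realType) (d : nat) (Omega : domain).
Local Notation X := 'rV[R]_d.
Local Notation V := (phase R d).
Local Notation leb := (@lebesgue_rV R d).
Local Notation vol := (@vol R d Omega).
Local Notation volV := (phase_vol R d Omega).
Variables (f g : V -> R) (j : 'I_d).
Hypotheses (fg : weak_derivative (vdir R j) f g)
  (if_ : volV.-integrable setT (EFin \o f)) (ig : volV.-integrable setT (EFin \o g)).

Let integrable_mul_x (h : X -> R) : measurable_fun setT h -> (exists b, forall x, `|h x| <= b) ->
  volV.-integrable setT (fun z => (g z * h z.1)%:E).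
Proof.
move=> mh [b hb].
rewrite (_ : (fun z => _) = (EFin \o g) \* (EFin \o (fun z : V => h z.1 : R)))%E.
  apply: integrableMl => //.
    exact: (measurableT_comp mh measurable_fst).
  by exists b; split; [exact: num_real|move=> x x1 z _ /=; rewrite (le_trans (hb _))// ltW].
by apply/funext => z; rewrite /= EFinM.
Qed.

(** The v-integral [gam] of [g] has integral 0 over every measurable set of positions, hence
    vanishes almost everywhere; Fubini then handles any bounded [h] without approximating it. *)
Lemma integral_vgrad_eq0 (h : X -> R) : measurable_fun setT h ->
  (exists b, forall x, `|h x| <= b) -> (\int[volV]_z (g z * h z.1)%:E = 0)%E.
Proof.
move=> mh hb.
pose gam x := (\int[leb]_v (g (x, v))%:E)%E.
have igam : vol.-integrable setT gam by exact: (integrable_fubini_F ig).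
have aeg := ae_integrable1 ig.
have gam0 : ae_eq vol setT gam (cst 0%E).
  apply: integral_ae_eq => // E _ mE; rewrite integral0 integral_mkcond.
  rewrite -[RHS](integral_indic_eq0 fg if_ ig mE).
  have iE : volV.-integrable setT (fun z : V => (g z * \1_E z.1)%:E).
    apply: integrable_mul_x; first exact: measurable_indic.
    by exists 1 => x; rewrite indicE; case: (_ \in _); rewrite ?normr1 ?normr0.
  rewrite -[RHS](integral12_prod_meas1 iE); apply: eq_integral => x _.
  rewrite patchE /fubini_F /=; case: ifPn => xE.
    by apply: eq_integral => v _; rewrite indicE xE mulr1.
  by under eq_integral do rewrite indicE (negbTE xE) mulr0; rewrite integral0.
have ih := integrable_mul_x mh hb.
rewrite -[LHS](integral12_prod_meas1 ih) -[RHS](integral0 vol setT).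
have igh := integrable_fubini_F ih.
apply: ae_eq_integral => //; first by case/integrableP : igh.
apply: filterS2 aeg gam0 => x ix /(_ Logic.I) gx _.
rewrite /fubini_F /=; under eq_integral do rewrite mulrC EFinM.
by rewrite integralZl// [X in (_ * X)%E]gx mule0.
Qed.

End moments_of_gradient_fubini.

(** * The kernel and the logarithmic gradient *)

Section euclidean_norm.
Context (R : realType) (d : nat).
Local Notation X := 'rV[R]_d.
Implicit Types u v w : X.

Lemma dotC u v : dot u v = dot v u.
Proof. by apply: eq_bigr => k _; rewrite mulrC. Qed.

Lemma dot_ge0 u : 0 <= dot u u.
Proof. by apply: sumr_ge0 => k _; rewrite -expr2 sqr_ge0. Qed.

Lemma dotBr u v w : dot u (v - w) = dot u v - dot u w.
Proof. by rewrite /dot -sumrB; apply: eq_bigr => k _; rewrite !mxE mulrBr. Qed.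

Lemma dotZl c u v : dot (c *: u) v = c * dot u v.
Proof. by rewrite /dot mulr_sumr; apply: eq_bigr => k _; rewrite mxE mulrA. Qed.

Lemma enorm_ge0 u : 0 <= enorm u.
Proof. exact: sqrtr_ge0. Qed.

Lemma sqr_enorm u : enorm u ^+ 2 = dot u u.
Proof. by rewrite sqr_sqrtr// dot_ge0. Qed.

Lemma enorm0 : enorm (0 : X) = 0.
Proof. by rewrite /enorm /dot big1 ?sqrtr0// => k _; rewrite mxE mul0r. Qed.

Lemma enormZ c u : enorm (c *: u) = `|c| * enorm u.
Proof.
by rewrite /enorm dotZl dotC dotZl mulrA -expr2 sqrtrM ?sqr_ge0// sqrtr_sqr.
Qed.

Lemma norm_coord_le_enorm u k : `|u ord0 k| <= enorm u.
Proof.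
rewrite -sqrtr_sqr ler_wsqrtr// /dot (bigD1 k)//= -expr2 lerDl.
by apply: sumr_ge0 => l _; rewrite -expr2 sqr_ge0.
Qed.

Lemma dot_le_enorm u v : dot u v <= enorm u * enorm v.
Proof.
(* With s = |v| and t = |u| the right-hand side is 2 |u|^2 |v|^2, and division by 2 |u| |v| gives
   Cauchy-Schwarz. *)
have h (s t : R) : 2 * (s * t) * dot u v <= s ^+ 2 * dot u u + t ^+ 2 * dot v v.
  rewrite -subr_ge0 (_ : _ - _ = \sum_k (s * u ord0 k - t * v ord0 k) ^+ 2).
    by apply: sumr_ge0 => k _; exact: sqr_ge0.
  rewrite /dot !mulr_sumr -big_split -sumrB; apply: eq_bigr => k _ /=; ring.
have z0 w w' : enorm w = 0 -> dot w w' = 0.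
  move=> w0; apply: big1 => k _.
  have := norm_coord_le_enorm w k; rewrite w0 normr_le0 => /eqP ->.
  by rewrite mul0r.
have := enorm_ge0 u; rewrite le_eqVlt => /predU1P[/esym u0|u0].
  by rewrite z0// u0 mul0r.
have := enorm_ge0 v; rewrite le_eqVlt => /predU1P[/esym v0|v0].
  by rewrite dotC z0// v0 mulr0.
have := h (enorm v) (enorm u); rewrite -!sqr_enorm => huv.
have uv0 : 0 < 2 * (enorm v * enorm u) by rewrite !mulr_gt0.
rewrite -(ler_pM2l uv0) (le_trans huv)// le_eqVlt; apply/orP; left; apply/eqP; ring.
Qed.

Lemma enormB u v : enorm (u - v) <= enorm u + enorm v.
Proof.
rewrite -(@ler_pXn2r _ 2)// ?nnegrE ?addr_ge0 ?enorm_ge0//.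
rewrite sqr_enorm dotBr ![dot (u - v) _]dotC !dotBr [dot v u]dotC sqrrD !sqr_enorm.
have := dot_le_enorm u (- 1 *: v); rewrite enormZ normrN normr1 mul1r dotC dotZl dotC.
by rewrite mulr2n; lra.
Qed.

Lemma measurable_enorm : measurable_fun setT (@enorm R d).
Proof.
apply: (measurableT_comp (continuous_measurable_fun (@sqrt_continuous R))).
by apply: measurable_sum => k; apply: measurable_funM; exact: measurable_rV_coord.
Qed.

End euclidean_norm.

Section periodic_null_sets.
Context (R : realType) (d : nat).
Local Notation X := 'rV[R]_d.
Local Notation leb := (@lebesgue_rV R d).

Lemma on_domain_intr (T : Type) (u : X -> T) : on_domain flat_torus u ->
  forall (k : 'rV[int]_d) x, u (x + map_mx intr k) = u x.
Proof.
move=> per k.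
have opp w : (forall x, u (x + w) = u x) -> forall x, u (x - w) = u x.
  by move=> h x; rewrite -[LHS]h subrK.
have add w w' : (forall x, u (x + w) = u x) -> (forall x, u (x + w') = u x) ->
    forall x, u (x + (w + w')) = u x.
  by move=> h h' x; rewrite addrA h' h.
have mul i (n : nat) x : u (x + delta_mx ord0 i *+ n) = u x.
  elim: n x => [|n IH] x; first by rewrite mulr0n addr0.
  by rewrite mulrS; apply: add => //; exact: per.
have -> : map_mx intr k = \sum_i ((k ord0 i)%:~R *: delta_mx ord0 i) :> X.
  by rewrite [LHS]row_sum_delta; apply: eq_bigr => i _; rewrite mxE.
elim: (index_enum _) => [|i s IH] x; first by rewrite big_nil addr0.
rewrite big_cons; apply: add => // {}x; rewrite scaler_int.
case: (k ord0 i) => n; first exact: mul.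
by rewrite NegzE mulrNz; apply: opp => y; exact: mul.
Qed.

(** On the torus, periodicity moves the part of [A] in one cell to all integer translates; these are
    countably many null sets and cover [A]. *)
Lemma vol_null_on_domain Omega (A : set X) : measurable A -> on_domain Omega A ->
  vol Omega A = 0%E -> leb A = 0%E.
Proof.
case: Omega => mA; first by rewrite /vol /mrestr /cell setIT.
move=> perA A0.
pose F n := if @unpickle ('rV[int]_d) n is Some k then
  rV_reflect false (- map_mx intr k) @^-1` (A `&` cell flat_torus) else set0.
have mAc : measurable (A `&` cell flat_torus : set X).
  by apply: measurableI => //; exact: measurable_cell.
have mF n : measurable (F n).
  rewrite /F; case: unpickle => // k.
  by rewrite -[X in measurable X]setTI; exact: measurable_rV_reflect.
apply: (@subset_measure0 _ _ _ leb _ (\bigcup_n F n)) => //.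
- exact: bigcupT_measurable.
- move=> x Ax; pose k : 'rV[int]_d := \row_i Num.floor (x ord0 i).
  exists (pickle k) => //; rewrite /F pickleK /=.
  have E : rV_reflect false (- map_mx intr k) x = x - map_mx intr k.
    by rewrite /rV_reflect expr0 scale1r addrC.
  rewrite E; split.
    by rewrite -(on_domain_intr perA k) subrK.
  move=> i; rewrite in_itv/= !mxE.
  have /andP[h1 h2] := floor_itv (x ord0 i).
  by rewrite subr_ge0 h1/= ltrBlDl -[X in _ + X]/(1%:~R) -intrD.
- apply: measure_negligible; first exact: bigcupT_measurable.
  apply: negligible_bigcup => n; apply/negligibleP; first exact: mF.
  rewrite /F; case: unpickle => [k|]; last exact: measure0.
  by rewrite [LHS]pushforward_rV_reflect.
Qed.

End periodic_null_sets.

Section essential_bound.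
Context (R : realType) (d : nat) (Omega : domain) (K : 'rV[R]_d -> 'rV[R]_d).
Local Notation X := 'rV[R]_d.
Local Notation leb := (@lebesgue_rV R d).
Hypotheses (perK : on_domain Omega K) (mK : measurable_fun setT K)
  (Koo : (Linfty_norm Omega K < +oo)%E).

Lemma Linfty_norm_ge0 : (0 <= Linfty_norm Omega K)%E.
Proof. exact: Lnorm_ge0. Qed.

(** The bound is needed almost everywhere in R^d, since differences of two points of the unit cell
    leave that cell. *)
Lemma enorm_le_Linfty_norm : {ae leb, forall x, enorm (K x) <= fine (Linfty_norm Omega K)}.
Proof.
set L := fine _.
pose A := [set x | ~~ (enorm (K x) <= L)].
have mA : measurable A.
  rewrite (_ : A = (@enorm R d \o K) @^-1` `]L, +oo[).
    rewrite -[X in measurable X]setTI; apply: measurableT_comp => //; exact: measurable_enorm.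
  by apply/seteqP; split => x; rewrite /A /= in_itv/= andbT ltNge.
exists A; split=> //; last by move=> x /= /negP.
apply: (@vol_null_on_domain R d Omega A mA).
  move: perK; rewrite /on_domain; case: Omega => // per i x.
  by rewrite /A /= per.
have Lfin : Linfty_norm Omega K = L%:E.
  by rewrite /L fineK// ge0_fin_numE ?Linfty_norm_ge0.
move: Lfin; rewrite /Linfty_norm unlock /=; case: ifPn => [_ EL|].
  have [N [mN N0 AN]] := ess_sup_ge (@vol R d Omega) (abse \o (EFin \o (@enorm R d) \o K)).
  apply: (@subset_measure0 _ _ _ (@vol R d Omega) A N) => //.
  move=> x Ax; apply: AN => /=; rewrite EL lee_fin ger0_norm ?enorm_ge0//.
  exact/negP.
(* Here the norm is 0 by convention because the whole volume is 0, and then so is that of [A]. *)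
rewrite -leNgt => T0 _.
apply: (@subset_measure0 _ _ _ (@vol R d Omega) A setT) => //.
by apply/eqP; rewrite eq_le T0 measure_ge0.
Qed.

End essential_bound.

Section reflection_ae.
Context (R : realType) (d : nat).
Local Notation X := 'rV[R]_d.
Local Notation leb := (@lebesgue_rV R d).

Lemma rV_reflectT (c x : X) : rV_reflect true c x = c - x.
Proof. by rewrite /rV_reflect expr1 scaleN1r. Qed.

Lemma ae_reflect (Q : X -> Prop) c : {ae leb, forall x, Q x} ->
  {ae leb, forall x, Q (c - x)}.
Proof.
move=> [N [mN N0 QN]]; exists (rV_reflect true c @^-1` N); split.
- by rewrite -[X in measurable X]setTI; exact: measurable_rV_reflect.
- by rewrite [LHS]pushforward_rV_reflect.
- by move=> x /= Qx; apply: QN; rewrite rV_reflectT.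
Qed.

Lemma vol_ae Omega (Q : X -> Prop) : {ae leb, forall x, Q x} ->
  {ae vol Omega, forall x, Q x}.
Proof.
move=> [N [mN N0 QN]]; exists N; split => //.
apply: (@subset_measure0 _ _ _ leb _ N) => //.
by apply: measurableI => //; exact: measurable_cell.
Qed.

Lemma measurable_fun_rVB dT (T : measurableType dT) (u v : T -> X) :
  measurable_fun setT u -> measurable_fun setT v -> measurable_fun setT (fun t => u t - v t).
Proof.
move=> /measurable_fun_rVP mu /measurable_fun_rVP mv; apply/measurable_fun_rVP => i.
apply: (eq_measurable_fun (fun t => u t ord0 i - v t ord0 i)).
  by move=> t _; rewrite /rV_coord /= !mxE.
by apply: measurable_funB; [exact: mu|exact: mv].
Qed.

End reflection_ae.

Lemma integral_density dT (T : measurableType dT) (R : realType)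
    (mu nu : {measure set T -> \bar R}) (f : T -> R) :
  (forall x, 0 <= f x) ->
  (forall g : T -> \bar R, measurable_fun setT g -> (forall x, 0 <= g x)%E ->
    \int[nu]_x g x = \int[mu]_x (g x * (f x)%:E))%E ->
  forall g : T -> R, measurable_fun setT g -> 
  (\int[nu]_x (g x)%:E = \int[mu]_x (g x * f x)%:E)%E.
Proof.
move=> f0 H g mg; have mg' : measurable_fun setT (EFin \o g) by exact/measurable_EFinP.
have hp := H _ (measurable_funepos mg') (fun x => funepos_ge0 _ x).
have hn := H _ (measurable_funeneg mg') (fun x => funeneg_ge0 _ x).
rewrite integralE [RHS]integralE; congr (_ - _)%E.
- rewrite [LHS]hp; apply: eq_integral => x _.
  by rewrite !funeposE /= -!EFin_max -EFinM maxr_pMl// mul0r.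
- rewrite [LHS]hn; apply: eq_integral => x _.
  by rewrite !funenegE /= -!EFin_max -EFinM maxr_pMl// mul0r mulNr.
Qed.

Lemma norm_dot_le (R : realType) d (u v : 'rV[R]_d) : `|dot u v| <= enorm u * enorm v.
Proof.
rewrite ler_norml dot_le_enorm andbT lerNl -mulN1r -dotZl.
by rewrite (le_trans (dot_le_enorm _ _))// enormZ normrN normr1 mul1r.
Qed.

Section truncation.
Context (R : realType) (d : nat) (L : R) (K : 'rV[R]_d -> 'rV[R]_d).
Local Notation X := 'rV[R]_d.

(* The essential bound |K| <= L is needed at every point. Replacing K by 0 where it
   fails changes K(x_i - x_j) with probability 0: for i = j because K(0) = 0, for
   i <> j because x_j has a density. *)
Definition truncate (x : X) : X := if enorm (K x) <= L then K x else 0.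

Lemma enorm_truncate_le x : 0 <= L -> enorm (truncate x) <= L.
Proof. by rewrite /truncate; case: ifP => // _ L0; rewrite enorm0. Qed.

Lemma measurable_truncate : measurable_fun setT K -> measurable_fun setT truncate.
Proof.
move=> mK; apply: measurable_fun_ifT => //.
apply: measurable_fun_ler => //.
exact: (measurableT_comp (@measurable_enorm R d) mK).
Qed.

Lemma truncate0 : K 0 = 0 -> truncate 0 = 0.
Proof. by rewrite /truncate => ->; case: ifP. Qed.

End truncation.

Section mean_field.
Context (R : realType) (d : nat) (Omega : domain).
Local Notation X := 'rV[R]_d.
Local Notation V := (phase R d).
Local Notation leb := (@lebesgue_rV R d).
Local Notation vol := (@vol R d Omega).
Local Notation volV := (phase_vol R d Omega).
Variables (K K' : X -> X) (L : R) (f : V -> R) (P : probability V R).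
Hypotheses (mK : measurable_fun setT K) (mK' : measurable_fun setT K')
  (K'K : {ae leb, forall x, K' x = K x}) (K'L : forall x, enorm (K' x) <= L).
Hypotheses (f0 : forall z, 0 <= f z) (if_ : volV.-integrable setT (EFin \o f))
  (HP : forall g : V -> \bar R, measurable_fun setT g -> (forall x, (0 <= g x)%E) ->
    (\int[P]_x g x = \int[volV]_x (g x * (f x)%:E))%E).

Let mf : measurable_fun setT f.
Proof. by case/integrableP : if_ => /measurable_EFinP. Qed.

Lemma measurable_shifted_kernel (c : 'I_d) :
  measurable_fun setT (fun p : X * V => K' (p.1 - p.2.1) ord0 c).
Proof.
have m1 : measurable_fun setT (fun p : X * V => p.1 - p.2.1).
  by apply: measurable_fun_rVB => //; exact: measurableT_comp.
exact: (measurableT_comp (measurable_rV_coord c) (measurableT_comp mK' m1)).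
Qed.

Lemma measurable_kernel_at (c : 'I_d) (x : X) :
  measurable_fun setT (fun z : V => K' (x - z.1) ord0 c).
Proof. exact: (measurableT_comp (measurable_shifted_kernel c) (measurable_pair1 x)). Qed.

Lemma kernel_bound c x : `|K' x ord0 c| <= L.
Proof. exact: le_trans (norm_coord_le_enorm _ _) (K'L x). Qed.

Lemma integrable_kernel_at c x : P.-integrable setT (fun z : V => (K' (x - z.1) ord0 c)%:E).
Proof.
apply: (@finite_measure_integrable_le _ _ _ P _ L) => [|z].
  exact: measurable_kernel_at.
exact: kernel_bound.
Qed.

(** For each fixed x the two kernels agree at x - y for almost every y, so the convolution can be
    computed with the everywhere bounded [K'], at every x. Fubini then turns the weight rho into the
    law [P]. *)
Lemma K_conv_rhoE c x :
  (K_conv_rho Omega K f x ord0 c)%:E = (\int[P]_z (K' (x - z.1) ord0 c)%:E)%E.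
Proof.
rewrite (integral_density f0 HP (measurable_kernel_at c x)).
have i1 : volV.-integrable setT (fun z : V => (K' (x - z.1) ord0 c * f z)%:E).
  rewrite (_ : (fun z => _) =
      (EFin \o f) \* (EFin \o (fun z : V => K' (x - z.1) ord0 c)))%E.
    apply: integrableMl => //; first exact: measurable_kernel_at.
    exists L; split; first exact: num_real.
    by move=> y Ly z _ /=; rewrite (le_trans (kernel_bound _ _))// ltW.
  by apply/funext => z; rewrite /= -EFinM mulrC.
rewrite -[RHS](integral12_prod_meas1 i1).
have mF : measurable_fun setT (fun y : X => \int[leb]_v (f (y, v))%:E)%E.
  exact: ((integrableP _ _ _ (integrable_fubini_F if_)).1).
have mrho : measurable_fun setT (rho f).
  exact: (measurableT_comp (fine_measurable measurableT) mF).
have mKx : measurable_fun setT (fun y : X => K (x - y) ord0 c).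
  apply: (measurableT_comp (measurable_rV_coord c)); apply: (measurableT_comp mK).
  exact: measurable_fun_rVB.
have E : ae_eq vol setT (fubini_F leb (fun z : V => (K' (x - z.1) ord0 c * f z)%:E))
    (fun y : X => (K (x - y) ord0 c * rho f y)%:E).
  have a1 := ae_integrable1 if_.
  have a2 := vol_ae Omega (ae_reflect x K'K).
  apply: filterS2 a1 a2 => y iy Ky _; rewrite -Ky /fubini_F /=.
  under eq_integral do rewrite EFinM.
  rewrite integralZl// EFinM; congr (_ * _)%E.
  by rewrite /rho /Rintegral fineK//; exact: (integrable_fin_num measurableT iy).
rewrite mxE.
have mR : measurable_fun setT (fun y : X => (K (x - y) ord0 c * rho f y)%:E).
  by apply/measurable_EFinP; exact: measurable_funM.
have iF := integrable_fubini_F i1.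
have EE : (\int[vol]_y fubini_F leb (fun z : V => (K' (x - z.1) ord0 c * f z)%:E) y =
    \int[vol]_y (K (x - y) ord0 c * rho f y)%:E)%E.
  by apply: ae_eq_integral => //; case/integrableP : iF.
rewrite [RHS]EE /Rintegral fineK// -EE.
exact: (integrable_fin_num measurableT iF).
Qed.

Local Notation Kc x := (K_conv_rho Omega K f x).

Lemma measurable_K_conv_rho c : measurable_fun setT (fun x : X => Kc x ord0 c).
Proof.
(* Adding [L] makes the integrand nonnegative, so that Tonelli gives the measurability of its
   partial integral; [L] is subtracted afterwards. *)
pose F (p : X * V) := (K' (p.1 - p.2.1) ord0 c + L)%:E.
have mF : measurable_fun setT F.
  by apply/measurable_EFinP; apply: measurable_funD => //; exact: measurable_shifted_kernel.
have F0 p : (0 <= F p)%E.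
  have := kernel_bound c (p.1 - p.2.1); rewrite ler_norml => /andP[h _].
  by rewrite lee_fin -lerBlDr sub0r.
have mI := @measurable_fun_fubini_tonelli_F _ _ _ _ R P F mF F0.
apply: (eq_measurable_fun (fun x => fine (fubini_F P F x) - L)).
  move=> x _; apply/EFin_inj; rewrite K_conv_rhoE /fubini_F /F.
  under eq_integral do rewrite EFinD.
  rewrite integralD//; last exact: finite_measure_integrable_cst.
    rewrite -K_conv_rhoE integral_cst// [X in (_ * X)%E](@probability_setT _ _ _ P) mule1.
    by rewrite -EFinD /= addrK.
  exact: integrable_kernel_at.
apply: measurable_funB => //.
exact: (measurableT_comp (fine_measurable measurableT) mI).
Qed.

Lemma K_conv_rho_dot x (u : X) :
  (dot u (Kc x))%:E = (\int[P]_z (dot u (K' (x - z.1)))%:E)%E.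
Proof.
have iK c : P.-integrable setT (fun z : V => (u ord0 c)%:E * (K' (x - z.1) ord0 c)%:E)%E.
  by apply: integrableZl => //; exact: integrable_kernel_at.
rewrite /dot -sumEFin.
transitivity (\int[P]_z (\sum_(c < d) ((u ord0 c)%:E * (K' (x - z.1) ord0 c)%:E)))%E.
  rewrite integral_sum//; apply: eq_bigr => c _.
  rewrite EFinM K_conv_rhoE integralZl//; exact: integrable_kernel_at.
by apply: eq_integral => z _; rewrite -sumEFin.
Qed.

(** The vector is paired with itself: its squared norm is the mean of its scalar product with [K'],
    at most its norm times [L]. Bounding each coordinate by [L] would lose a factor sqrt(d). *)
Lemma enorm_K_conv_rho_le x : enorm (Kc x) <= L.
Proof.
have L0 : 0 <= L := le_trans (enorm_ge0 _) (K'L 0).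
have h : enorm (Kc x) ^+ 2 <= enorm (Kc x) * L.
  rewrite sqr_enorm -lee_fin K_conv_rho_dot.
  apply: (@le_trans _ _ (\int[P]_z (enorm (Kc x) * L)%:E)%E); last first.
    by rewrite integral_cst// [X in (_ * X)%E](@probability_setT _ _ _ P) mule1.
  apply: le_integral => //.
  - apply: (@finite_measure_integrable_le _ _ _ P _ (enorm (Kc x) * L)).
      by apply: measurable_sum => c; apply: measurable_funM => //; exact: measurable_kernel_at.
    by move=> z; rewrite (le_trans (norm_dot_le _ _))// ler_wpM2l// enorm_ge0.
  - exact: finite_measure_integrable_cst.
  - by move=> z _; rewrite lee_fin (le_trans (dot_le_enorm _ _))// ler_wpM2l// enorm_ge0.
have := enorm_ge0 (Kc x); rewrite le_eqVlt => /predU1P[<-//|K0].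
by move: h; rewrite expr2 ler_pM2l.
Qed.

Lemma integral_centered_dot x (u : X) :
  (\int[P]_z (dot u (K' (x - z.1) - Kc x))%:E = 0)%E.
Proof.
under eq_integral do rewrite dotBr EFinB.
have L0 : 0 <= L := le_trans (enorm_ge0 _) (K'L 0).
rewrite integralB//; last exact: finite_measure_integrable_cst.
  rewrite -K_conv_rho_dot integral_cst// [X in (_ * X)%E](@probability_setT _ _ _ P) mule1.
  by rewrite subee.
apply: (@finite_measure_integrable_le _ _ _ P _ (enorm u * L)).
  by apply: measurable_sum => c; apply: measurable_funM => //; exact: measurable_kernel_at.
by move=> z; rewrite (le_trans (norm_dot_le _ _))// ler_wpM2l// enorm_ge0.
Qed.

End mean_field.

(** The quotient a^a / a! is one term of the series of exp(a). *)
Lemma expr_self_le (R : realType) (a : nat) : a%:R ^+ a <= expR 1 ^+ a * a`!%:R :> R.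
Proof.
case: a => [|a]; first by rewrite !expr0 fact0 mulr1.
have := @expR_ge1Dxn R a.+1%:R a (ler0n _ _) => h.
rewrite -expRM_natr mul1r -ler_pdivrMr ?ltr0n ?fact_gt0//.
by apply: le_trans h; rewrite lerDr.
Qed.

Section gradient_moments.
Context (R : realType) (d : nat) (Omega : domain).
Local Notation V := (phase R d).
Local Notation volV := (phase_vol R d Omega).
Variables (f : V -> R) (G : V -> 'rV[R]_d).
Hypotheses (f0 : forall z, 0 <= f z) (f1 : (\int[volV]_z (f z)%:E = 1)%E)
  (Moo : (supMp Omega f G < +oo)%E).

Let M : R := fine (supMp Omega f G).

Let Mp_le (p : R) : 1 <= p -> (Mp Omega f G p * (p^-1)%:E <= supMp Omega f G)%E.
Proof. by move=> p1; apply: ereal_sup_ubound; exists p. Qed.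

Lemma supMp_ge0 : (0 <= supMp Omega f G)%E.
Proof.
apply: le_trans (Mp_le (lexx 1)).
by rewrite mule_ge0// ?poweR_ge0// lee_fin invr_ge0.
Qed.

Let ME : supMp Omega f G = M%:E.
Proof. by rewrite /M fineK// ge0_fin_numE ?supMp_ge0. Qed.

(** At p = a the growth assumption gives (M a)^a, and [expr_self_le] trades a^a for e^a a!. The case
    a = 0, outside the range p >= 1, is the total mass of [f]. *)
Lemma gradient_moment_le a :
  (\int[volV]_z (enorm (grad_log f G z) ^+ a * f z)%:E <=
   ((expR 1 * M) ^+ a * a`!%:R)%:E)%E.
Proof.
have M0 : 0 <= M by rewrite -lee_fin -ME supMp_ge0.
case: a => [|a].
  by rewrite expr0 mul1r fact0; under eq_integral do rewrite expr0 mul1r; rewrite f1.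
set p : R := a.+1%:R.
have p0 : 0 < p by rewrite ltr0n.
have p1 : 1 <= p by rewrite ler1n.
set J := (\int[volV]_z _)%E.
have J0 : (0 <= J)%E by apply: integral_ge0 => z _; rewrite lee_fin mulr_ge0// exprn_ge0// enorm_ge0.
have JE : J = (\int[volV]_z (enorm (grad_log f G z) `^ p * f z)%:E)%E.
  by apply: eq_integral => z _; rewrite powR_mulrn// enorm_ge0.
have h : (J `^ p^-1 <= (M * p)%:E)%E.
  by rewrite JE EFinM -ME -lee_pdivrMr//; exact: Mp_le.
rewrite -[J]poweRe1// -[X in (J `^ X)%E](@mulVf _ p) ?gt_eqF// poweRrM.
apply: (@le_trans _ _ ((M * p)%:E `^ p)%E).
  apply: gt0_ler_poweR => //.
  - by rewrite in_itv/= poweR_ge0 leey.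
  - by rewrite in_itv/= leey andbT lee_fin mulr_ge0// ltW.
rewrite poweR_EFin lee_fin powR_mulrn; last by rewrite mulr_ge0// ltW.
have -> : (expR 1 * M) ^+ a.+1 * a.+1`!%:R = M ^+ a.+1 * (expR 1 ^+ a.+1 * a.+1`!%:R).
  by rewrite [(expR 1 * M) ^+ _]exprMn mulrAC [RHS]mulrC.
rewrite [leLHS]exprMn ler_wpM2l ?exprn_ge0//.
exact: expr_self_le.
Qed.

End gradient_moments.

Section logarithmic_gradient.
Context (R : realType) (d : nat) (Omega : domain).
Local Notation X := 'rV[R]_d.
Local Notation V := (phase R d).
Local Notation leb := (@lebesgue_rV R d).
Local Notation lebV := (prod_measure leb leb).
Local Notation volV := (phase_vol R d Omega).
Variables (f : V -> R) (G : V -> X).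
Hypotheses (f0 : forall z, 0 <= f z) (f1 : (\int[volV]_z (f z)%:E = 1)%E)
  (if_ : volV.-integrable setT (EFin \o f))
  (fG : weak_vgrad f G)
  (GW : forall p : \bar R, (1 <= p)%E -> forall k : 'I_d, W1ploc p (fun z => G z ord0 k))
  (Moo : (supMp Omega f G < +oo)%E).

Let mf : measurable_fun setT f.
Proof. by case/integrableP : if_ => /measurable_EFinP. Qed.

Let mG k : measurable_fun setT (fun z => G z ord0 k).
Proof. by have [_ hG _] := fG k; exact: measurable_Lploc1 hG. Qed.

Lemma measurable_grad_log k : measurable_fun setT (fun z => grad_log f G z ord0 k).
Proof.
apply: (eq_measurable_fun (fun z => f z `^ (-1) * G z ord0 k)).
  by move=> z _; rewrite mxE powR_inv1.
apply: measurable_funM => //.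
exact: (measurableT_comp (measurable_powR (-1)) mf).
Qed.

Lemma measurable_enorm_grad_log : measurable_fun setT (fun z => enorm (grad_log f G z)).
Proof.
apply: (measurableT_comp (@measurable_enorm R d)).
by apply/measurable_fun_rVP => k; exact: measurable_grad_log.
Qed.

(** Where f > 0 the factor f cancels. Where f = 0 the left side is 0, and [G] has to vanish: this
    uses the regularity of [G] with p = +oo, that is, a locally bounded second derivative along
    v_k. *)
Lemma grad_log_mul_ae k :
  {ae volV, forall z, grad_log f G z ord0 k * f z = G z ord0 k}.
Proof.
apply: phase_vol_ae.
have [_ /(_ k)[_ [m Gm my]]] := GW (leey 1) k.
have e1 i : `|pcrd i (vdir R k)| <= 1.
  case: i => i; rewrite /= mxE ?normr0 ?ler01//.
  by case: (_ && _); rewrite ?normr1 ?normr0 ?ler01.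
have := weak_derivative_eq0 f0 (fG k) Gm my e1.
apply: filterS => z h; rewrite mxE mulrAC.
have [fz|fz] := eqVneq (f z) 0; first by rewrite h// mulr0.
by rewrite mulVf// mul1r.
Qed.

(** Almost everywhere |G_k| is at most f times the norm of [grad_log], so the first moment controls
    it. *)
Lemma integrable_vgrad k : volV.-integrable setT (EFin \o (fun z => G z ord0 k)).
Proof.
apply/integrableP; split; first exact/measurable_EFinP.
apply: (@le_lt_trans _ _ (\int[volV]_z (enorm (grad_log f G z) ^+ 1 * f z)%:E)%E); last first.
  by apply: le_lt_trans (gradient_moment_le f0 f1 Moo 1) _; exact: ltry.
apply: ae_ge0_le_integral => //.
- by apply: measurableT_comp => //; exact/measurable_EFinP.
- by move=> z _; rewrite lee_fin mulr_ge0// expr1 enorm_ge0.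
- apply/measurable_EFinP; apply: measurable_funM => //.
  by apply: measurable_funX; exact: measurable_enorm_grad_log.
apply: filterS (grad_log_mul_ae k) => z h _.
by rewrite /= -h lee_fin normrM expr1 ler_pM// ?norm_coord_le_enorm// ger0_norm.
Qed.

Lemma integral_grad_log_eq0 k (h : X -> R) : measurable_fun setT h ->
  (exists b, forall x, `|h x| <= b) ->
  (\int[volV]_z (grad_log f G z ord0 k * h z.1 * f z)%:E = 0)%E.
Proof.
move=> mh hb; rewrite -(integral_vgrad_eq0 (fG k) if_ (integrable_vgrad k) mh hb).
have mh1 : measurable_fun setT (fun z : V => h z.1) := measurableT_comp mh measurable_fst.
apply: ae_eq_integral => //.
- apply/measurable_EFinP; apply: measurable_funM => //; apply: measurable_funM => //.
  exact: measurable_grad_log.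
- by apply/measurable_EFinP; exact: measurable_funM.
- by apply: filterS (grad_log_mul_ae k) => z e _; rewrite -e mulrAC.
Qed.

End logarithmic_gradient.

Section interaction_functional.
Context (R : realType) (d : nat) (N : nat).
Local Notation X := 'rV[R]_d.
Local Notation V := (phase R d).

(** The kernel and the mean field [H] are separate parameters, so that [K] and its truncation can be
    compared with the same [H]. *)
Definition mean_field_sum (xi : V -> X) (K H : X -> X) (Z : N.-tuple V) : R :=
  N%:R^-1 * \sum_(i < N) \sum_(j < N)
    dot (xi (tnth Z i)) (K ((tnth Z i).1 - (tnth Z j).1) - H (tnth Z i).1).

Lemma measurable_mean_field_sum xi K H : measurable_fun setT xi ->
  measurable_fun setT K -> measurable_fun setT H ->
  measurable_fun setT (mean_field_sum xi K H).
Proof.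
move=> mxi mK mH; apply: measurable_funM => //.
apply: measurable_sum => i; apply: measurable_sum => j.
have mt l : measurable_fun setT (fun Z : N.-tuple V => (tnth Z l).1).
  exact: (measurableT_comp measurable_fst (@measurable_tnth _ _ _ l)).
have mu : measurable_fun setT (fun Z : N.-tuple V => xi (tnth Z i)).
  exact: (measurableT_comp mxi (@measurable_tnth _ _ _ i)).
have mv : measurable_fun setT
    (fun Z : N.-tuple V => K ((tnth Z i).1 - (tnth Z j).1) - H (tnth Z i).1).
  apply: measurable_fun_rVB; last exact: measurableT_comp.
  by apply: (measurableT_comp mK); exact: measurable_fun_rVB.
apply: measurable_sum => c; apply: measurable_funM.
  exact: (measurableT_comp (measurable_rV_coord c) mu).
exact: (measurableT_comp (measurable_rV_coord c) mv).
Qed.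

End interaction_functional.

Section almost_sure_kernel.
Context (R : realType) (d : nat) (Omega : domain).
Local Notation X := 'rV[R]_d.
Local Notation V := (phase R d).
Local Notation leb := (@lebesgue_rV R d).
Local Notation volV := (phase_vol R d Omega).
Variables (f : V -> R) (P : probability V R) (N : nat).
Hypotheses (mf : measurable_fun setT f)
  (HP : forall g : V -> \bar R, measurable_fun setT g -> (forall x, (0 <= g x)%E) ->
    (\int[P]_x g x = \int[volV]_x (g x * (f x)%:E))%E).

(** Redraw particle j with particle i frozen: the position of j must then avoid a reflected null
    set, which it does because [P] has a density. *)
Lemma ae_tuple_power_difference (Q : X -> Prop) (i j : 'I_N) : i != j ->
  {ae leb, forall x, Q x} ->
  {ae tuple_power P N, forall Z, Q ((tnth Z i).1 - (tnth Z j).1)}.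
Proof.
move=> ij aeQ; have [B [mB B0 QB]] := aeQ.
have mt l : measurable_fun setT (fun Z : N.-tuple V => (tnth Z l).1).
  exact: (measurableT_comp measurable_fst (@measurable_tnth _ _ _ l)).
have mD : measurable_fun setT (fun Z : N.-tuple V => (tnth Z i).1 - (tnth Z j).1).
  exact: measurable_fun_rVB.
pose A := (fun Z : N.-tuple V => (tnth Z i).1 - (tnth Z j).1) @^-1` B.
have mA : measurable A by rewrite -[A]setTI; exact: mD.
exists A; split=> //; last by move=> Z /= nQ; exact: QB.
have mI : measurable_fun setT (fun Z => (\1_A Z)%:E : \bar R).
  by apply/measurable_EFinP; exact: measurable_indic.
rewrite -[A]setIT -integral_indic//.
have I0 Z : (0 <= (\1_A Z)%:E :> \bar R)%E by rewrite lee_fin.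
rewrite [LHS](ge0_integral_resample (@probability_setT _ _ _ P) j mI I0).
rewrite integral0_eq// => Z _.
set x := (tnth Z i).1.
have mx : measurable_fun setT (fun z : V => (\1_B (x - z.1))%:E : \bar R).
  apply/measurable_EFinP; apply: measurableT_comp; first exact: measurable_indic.
  exact: measurable_fun_rVB.
transitivity (\int[P]_z (\1_B (x - z.1))%:E)%E.
  apply: eq_integral => z _; rewrite !indicE; congr (_%:R%:E); congr nat_of_bool.
  by apply/idP/idP; rewrite !inE /A /= !tnth_tset eqxx (negbTE ij).
rewrite HP//; rewrite -[RHS](integral0 volV setT).
apply: ae_eq_integral => //.
  by apply: emeasurable_funM => //; exact/measurable_EFinP.
have aeB : {ae leb, forall y, ~ B y}.
  by exists B; split => // y /= /contrapT.
have := phase_vol_ae Omega (ae_fst (ae_reflect x aeB)).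
by apply: filterS => z h _; rewrite indicE memNset// mul0e.
Qed.

End almost_sure_kernel.

(** * Reduction of the theorem to the abstract exponential moment bound *)

Theorem theorem3 (R : realType) (d : nat) (Omega : domain)
    (K : 'rV[R]_d -> 'rV[R]_d)
    (f : phase R d -> R) (G : phase R d -> 'rV[R]_d) :
  (1 <= d)%N ->
  (* K \in L^\infty(Omega; R^d), with K(0) = 0 *)
  on_domain Omega K ->
  measurable_fun setT K ->
  (Linfty_norm Omega K < +oo)%E ->
  K 0 = 0 ->
  (* f \in L^1 \cap L^\infty is a probability density *)
  (forall v, on_domain Omega (fun x => f (x, v))) ->
  f \in Lfun (phase_vol R d Omega) +oo%E ->
  f \in Lfun (phase_vol R d Omega) 1%E ->
  (forall z, 0 <= f z) ->
  (\int[phase_vol R d Omega]_z (f z)%:E = 1)%E ->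
  (* G = \nabla_v f \in W^{1,p}_loc for every 1 <= p <= oo *)
  weak_vgrad f G ->
  (forall p : \bar R, (1 <= p)%E ->
     forall k : 'I_d, W1ploc p (fun z => G z ord0 k)) ->
  (supMp Omega f G < +oo)%E ->
  (Linfty_norm Omega K * supMp Omega f G < (1 / (8 * expR 1 ^+ 2))%:E)%E ->
  let a := 8 * expR 1 ^+ 2 * fine (Linfty_norm Omega K) * fine (supMp Omega f G) in
  forall N : nat, (1 <= N)%N ->
  (\int[tuple_power (phase_vol R d Omega) N]_Z
      (fbar f Z * expR `|RN Omega K f G Z|)%:E
    <= (5 + 6 * (a / (1 - a ^+ 2)) ^+ 2)%:E < +oo)%E.

Proof.
move=> d1 perK mK Koo K0 perf fLoo fL1 f0 f1 fG GW Moo LM a N N0.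
have if_ : (phase_vol R d Omega).-integrable setT (EFin \o f).
  by move: fL1 => /Lfun1_integrable.
have mf : measurable_fun setT f by case/integrableP : if_ => /measurable_EFinP.
have [P HP] := density_probability mf f0 f1.
pose L := fine (Linfty_norm Omega K); pose M := fine (supMp Omega f G).
have L0 : 0 <= L by rewrite fine_ge0// Linfty_norm_ge0.
have M0 : 0 <= M by rewrite fine_ge0// (supMp_ge0 Omega f G).
pose K' := truncate L K.
have mK' : measurable_fun setT K' by exact: measurable_truncate.
have K'L x : enorm (K' x) <= L by exact: enorm_truncate_le.
have K'K : {ae @lebesgue_rV R d, forall x, K' x = K x}.
  apply: filterS (enorm_le_Linfty_norm perK mK Koo) => x KxL.
  by rewrite /K' /truncate KxL.
pose Kc := K_conv_rho Omega K f.
have mKc c := measurable_K_conv_rho mK mK' K'K K'L f0 if_ HP c.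
pose xi (c : 'I_d) z := grad_log f G z ord0 c.
pose kappa (c : 'I_d) x x' := K' (x - x') ord0 c - Kc x ord0 c.
(* The factor 2 L bounds K' - K*rho, each of the two terms being at most L. *)
pose w z := (2 * L) * enorm (grad_log f G z).
(* This choice makes 4 e C equal to [a]. *)
pose C := 2 * L * (expR 1 * M).
have rVBE (u v : 'rV[R]_d) c : (u - v) ord0 c = u ord0 c - v ord0 c by rewrite !mxE.
have qE z z' : interaction xi kappa z z' = dot (grad_log f G z) (K' (z.1 - z'.1) - Kc z.1).
  by apply: eq_bigr => c _; congr (_ * _); rewrite [RHS]rVBE.
have aE : 4 * expR 1 * C = a by rewrite /a /C /L /M; ring.
have LE : Linfty_norm Omega K = L%:E.
  by rewrite fineK// ge0_fin_numE// Linfty_norm_ge0.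
have ME : supMp Omega f G = M%:E.
  by rewrite fineK// ge0_fin_numE// supMp_ge0.
have a1 : a < 1.
  move: LM; rewrite LE ME -EFinM lte_fin ltr_pdivlMr; last by rewrite mulr_gt0// exprn_gt0// expR_gt0.
  by rewrite /a -/L -/M [X in X < _]mulrC mulrA.
have w0 z : 0 <= w z by rewrite !mulr_ge0// enorm_ge0.
have mw : measurable_fun setT w.
  by apply: measurable_funM => //; exact: (measurable_enorm_grad_log f0 if_ fG).
have diffL x x' : enorm (K' (x - x') - Kc x) <= 2 * L.
  rewrite (le_trans (enormB _ _))// mulr_natl mulr2n lerD//.
  exact: (enorm_K_conv_rho_le mK mK' K'K K'L f0 if_ HP).
have mxi c : measurable_fun setT (xi c) by exact: (measurable_grad_log f0 if_ fG).
have mgrad : measurable_fun setT (grad_log f G) by exact/measurable_fun_rVP.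
have mKcv : measurable_fun setT Kc by exact/measurable_fun_rVP.
have main : (\int[tuple_power P N]_Z
    (expR `|\sum_i mean_interaction xi kappa i Z|)%:E <=
    (5 + 6 * (a / (1 - a ^+ 2)) ^+ 2)%:E)%E.
  rewrite -aE; apply: (@integral_expR_interaction_le _ _ _ _ R d P xi kappa w (2 * L) C).
  - exact: mxi.
  - move=> c; apply/integrableP; split; first exact/measurable_EFinP.
    have mxia : measurable_fun setT (fun z => `|(xi c z)%:E|%E).
      by apply: measurableT_comp => //; exact/measurable_EFinP.
    rewrite (HP _ mxia)//.
    apply: (@le_lt_trans _ _ (\int[phase_vol R d Omega]_z
        (enorm (grad_log f G z) ^+ 1 * f z)%:E)%E); last first.
      by apply: le_lt_trans (gradient_moment_le f0 f1 Moo 1) _; exact: ltry.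
    apply: ge0_le_integral => //.
    + by move=> z _; rewrite mule_ge0// lee_fin.
    + by apply: emeasurable_funM => //; exact/measurable_EFinP.
    + apply/measurable_EFinP; apply: measurable_funM => //; apply: measurable_funX.
      exact: (measurable_enorm_grad_log f0 if_ fG).
    + move=> z _; rewrite -EFinM lee_fin expr1 ler_wpM2r//.
      exact: norm_coord_le_enorm.
  - move=> c; apply: measurable_funB; last exact: (measurableT_comp (mKc c) measurable_fst).
    apply: (measurableT_comp (measurable_rV_coord c)); apply: (measurableT_comp mK').
    exact: measurable_fun_rVB.
  - by move=> c x x'; rewrite /kappa -rVBE (le_trans (norm_coord_le_enorm _ _)).
  - exact: mw.
  - move=> z z'; rewrite qE (le_trans (norm_dot_le _ _))// mulrC ler_wpM2r ?enorm_ge0//.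
  - move=> z; under eq_integral do rewrite qE.
    exact: (integral_centered_dot mK mK' K'K K'L f0 if_ HP).
  - move=> c h mh hb; rewrite (integral_density f0 HP); last first.
      by apply: measurable_funM => //; exact: (measurableT_comp mh measurable_fst).
    exact: (integral_grad_log_eq0 f0 f1 if_ fG GW Moo).
  - move=> b.
    have mwb : measurable_fun setT (fun z => w z ^+ b) by exact: measurable_funX.
    rewrite (integral_density f0 HP)//.
    have mgb : measurable_fun setT (fun z => enorm (grad_log f G z) ^+ b * f z).
      apply: measurable_funM => //; apply: measurable_funX.
      exact: (measurable_enorm_grad_log f0 if_ fG).
    have wE z : w z ^+ b * f z = (2 * L) ^+ b * (enorm (grad_log f G z) ^+ b * f z).
      by rewrite exprMn mulrA.
    under eq_integral do rewrite wE EFinM.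
    rewrite ge0_integralZl//; last 3 first.
    + exact/measurable_EFinP.
    + by move=> z _; rewrite lee_fin mulr_ge0// exprn_ge0// enorm_ge0.
    + by rewrite lee_fin exprn_ge0// mulr_ge0.
    rewrite [C ^+ b]exprMn -mulrA [leRHS]EFinM; apply: lee_wpmul2l.
      by rewrite lee_fin exprn_ge0// mulr_ge0.
    exact: gradient_moment_le.
  - by [].
  - by rewrite aE.
have sumE Z : \sum_i mean_interaction xi kappa i Z = mean_field_sum (grad_log f G) K' Kc Z.
  rewrite /mean_field_sum mulr_sumr; apply: eq_bigr => i _; congr (_ * _).
  by apply: eq_bigr => j _; rewrite qE.
have RNE Z : RN Omega K f G Z = mean_field_sum (grad_log f G) K Kc Z by [].
apply/andP; split; last exact: ltry.
apply: le_trans main.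
under eq_integral do rewrite /fbar EFinM muleC RNE.
have mexp K1 : measurable_fun setT K1 ->
    measurable_fun setT (fun Z : N.-tuple (phase R d) =>
      (expR `|mean_field_sum (grad_log f G) K1 Kc Z|)%:E).
  move=> mK1; apply/measurable_EFinP; apply: measurableT_comp => //.
  by apply: measurableT_comp => //; exact: measurable_mean_field_sum.
rewrite -(ge0_integral_tuple_power_density (P := P) mf f0 HP)//; last exact: mexp.
under [leRHS]eq_integral do rewrite sumE.
(* The two integrands differ only by [K] against [K'], hence on a null set; the mean field [Kc] is
   the same on both sides. *)
rewrite le_eqVlt; apply/orP; left; apply/eqP.
apply: ae_eq_integral => //; [exact: mexp|exact: mexp|].
have aeK (i j : 'I_N) : {ae tuple_power P N, forall Z,
    K' ((tnth Z i).1 - (tnth Z j).1) = K ((tnth Z i).1 - (tnth Z j).1)}.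
  (* On the diagonal the argument is 0, where no density helps; the convention K(0) = 0 gives the
     equality at every [Z]. *)
  have [<-|ij] := eqVneq i j.
    by apply: aeW => Z; rewrite subrr K0 /K' truncate0.
  exact: (ae_tuple_power_difference mf HP ij K'K).
have : {ae tuple_power P N, forall Z, forall i j : 'I_N,
    K' ((tnth Z i).1 - (tnth Z j).1) = K ((tnth Z i).1 - (tnth Z j).1)}.
  by apply: filter_forall => i; apply: filter_forall => j; exact: aeK.
apply: filterS => Z h _; congr (expR `|_ * _|)%:E.
by apply: eq_bigr => i _; apply: eq_bigr => j _; rewrite h.
Qed.
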